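(* Let $\varepsilon>0$ be fixed, let $p>2$ be a fixed prime, and let $\Phi:\mathbb{R}\rightarrow\mathbb{R}_{\ge 0}$ be a Schwartz class function. For $n\in\mathbb{N}$ set $q:=p^n$, and let $\alpha_1,\alpha_2,\alpha_3$ be integers coprime to $p$ which are allowed to vary with $n$, subject to $p>s_p(\alpha_1,\alpha_2,\alpha_3)$. Then, as $n\rightarrow\infty$, uniformly for $N\ge q^{11/18+\varepsilon}$, $$ \sum_{\substack{(x_1,x_2,x_3)\in\mathbb{Z}^3\\ (x_1x_2x_3,p)=1\\ \alpha_1x_1^2+\alpha_2x_2^2+\alpha_3x_3^2\equiv 0 \bmod q}}\Phi\left(\frac{x_1}{N}\right)\Phi\left(\frac{x_2}{N}\right)\Phi\left(\frac{x_3}{N}\right)\sim \hat{\Phi}(0)^3\cdot C_p(\alpha_1,\alpha_2,\alpha_3)\cdot\frac{N^3}{q}. $$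
   Context: For integers $\alpha_1,\alpha_2,\alpha_3$ coprime to $p$, define $$s_p(\alpha_1,\alpha_2,\alpha_3):=2+\left(\frac{-\alpha_1\alpha_2}{p}\right)+\left(\frac{-\alpha_1\alpha_3}{p}\right)+\left(\frac{-\alpha_2\alpha_3}{p}\right),$$ where $\left(\frac{\cdot}{p}\right)$ is the Legendre symbol, and $$C_p(\alpha_1,\alpha_2,\alpha_3):=\frac{(p-s_p(\alpha_1,\alpha_2,\alpha_3))(p-1)}{p^2}.$$ $\hat{\Phi}$ denotes the Fourier transform $\hat\Phi(y)=\int_{\mathbb{R}}\Phi(x)e^{-2\pi i xy}\,dx$. The asymptotic ''$\sim$'' means the ratio of the two sides tends to $1$ as $n\to\infty$, for arbitrary choices $\alpha_i=\alpha_i(n)$ and $N=N(n)\ge q^{11/18+\varepsilon}$ satisfying the hypotheses. *)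

(* Defs.v *)
From HB Require Import structures.
From mathcomp Require Import all_boot all_order all_algebra.
From mathcomp Require Import all_classical all_reals all_analysis.
Set Implicit Arguments. Unset Strict Implicit. Unset Printing Implicit Defensive.
Import Order.TTheory GRing.Theory Num.Theory.
Import numFieldNormedType.Exports.
Local Open Scope classical_set_scope.
Local Open Scope ring_scope.

Definition schwartz {R : realType} (Phi : R -> R) : Prop :=
  (forall (m : nat) (x : R), derivable (derive1n m Phi) x 1) /\
  (forall k m : nat, exists C : R, forall x : R,
      `|x| ^+ k * `|derive1n m Phi x| <= C).

Definition fourier_hat0 {R : realType} (Phi : R -> R) : \bar R :=
  (\int[lebesgue_measure]_x (Phi x)%:E)%E.

Definition legendre (a : int) (p : nat) : int :=
  if (p%:Z %| a)%Z then 0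
  else if [exists x : 'I_p, (p%:Z %| (x%:Z ^+ 2 - a))%Z] then 1 else -1.

Definition s_p (p : nat) (a1 a2 a3 : int) : int :=
  2 + legendre (- (a1 * a2)) p + legendre (- (a1 * a3)) p
    + legendre (- (a2 * a3)) p.

Definition C_p {R : realType} (p : nat) (a1 a2 a3 : int) : R :=
  ((p%:Z - s_p p a1 a2 a3)%:~R * (p%:R - 1)) / (p%:R ^+ 2).

Definition count_sum {R : realType} (Phi : R -> R) (p n : nat)
    (a1 a2 a3 : int) (N : R) : \bar R :=
  esum [set x : int * int * int |
      coprimez (x.1.1 * x.1.2 * x.2) p /\
      ((p ^ n)%:Z %| a1 * x.1.1 ^+ 2 + a2 * x.1.2 ^+ 2 + a3 * x.2 ^+ 2)%Z]
     (fun x => (Phi (x.1.1%:~R / N) * Phi (x.1.2%:~R / N) * Phi (x.2%:~R / N))%:E).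

(* Main.v *)
(** Write q = p ^ n.  A finite Fourier transform modulo q, playing the role of
    Poisson summation, turns q ^ 3 times the weighted count over a large cube
    into a sum over frequencies v modulo q of K(v) times the three exponential
    sums of Phi (x / N) at -v_i / q, where K(v) is the sum of e(v . x / q) over
    the unit points x of the conic modulo q.  The frequency 0 is the main term:
    K(0) is a point count, and a Riemann sum gives the integral.  Repeated
    summation by parts makes frequencies with some |v_i| > Y = q ^ (7/18)
    negligible.  For v = p ^ j y with y primitive, Gauss sums show that K(v)
    vanishes unless p ^ (n - j - 1) divides the dual form at y, and is otherwise
    at most p ^ (2 j) p ^ (3 (n - j) / 2).

    What remains is to count primitive points of height Y on a conic modulo
    p ^ m, up to proportionality.  Points in one class modulo p ^ k, 2 k <= m,
    have determinants divisible by p ^ (3 k), so they lie on one line as soon as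
    6 Y ^ 3 < p ^ (3 k).  A class with several points forces its line to be
    tangent to the conic to high p-adic order, so that the normal vectors of
    these lines are themselves points of small height on the dual conic; the
    same count applied to them bounds the contribution of the rich classes. *)

Require Import Defs.
From HB Require Import structures.
From mathcomp Require Import all_boot all_order all_algebra.
From mathcomp Require Import all_classical all_reals all_analysis.
From mathcomp Require Import measurable_realfun complex.
From mathcomp Require Import zify ring lra.
Set Implicit Arguments. Unset Strict Implicit. Unset Printing Implicit Defensive.
Import Order.TTheory GRing.Theory Num.Theory.
Import numFieldNormedType.Exports.
Local Open Scope classical_set_scope.
Local Open Scope ring_scope.

(** * Integer points on a conic modulo prime powers *)

(** After the factor q ^ 3 the error must be o(q ^ 2 N ^ 3). Each of the three exponential sums is
    O(N), so the |K(v)| over the nonzero v of height at most Y have to add up to o(q ^ 2). As |K(v)|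
    may reach q ^ (3/2) at primitive v, fewer than q ^ (1/2) admissible frequencies can be afforded.
    Bounding the rich classes trivially gives about Y ^ (8/5) points, which would stop at Y = q ^
    (5/16). Feeding that count back through the normal vectors gives Y ^ (5/4) up to logarithms,
    good for any Y below q ^ (2/5). At Y = q ^ (7/18) this is q ^ (35/72), and the saving of q ^
    (1/72) over q ^ (1/2) pays for the logarithms. The exponents 11/18 and 7/18 add up to 1, so each
    summation by parts beyond Y gains a factor q ^ epsilon.

    Heights and moduli are compared through integer powers, as in Y ^ 5 <= p ^ (4 k), which keeps
    real exponents out of the counting. No constant depends on the coefficients of the conic, which
    is why they may vary with n. *)

Notation vec := (int * int * int)%type.

Definition crs (y z : vec) : vec :=
  (y.1.2 * z.2 - y.2 * z.1.2, y.2 * z.1.1 - y.1.1 * z.2,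
   y.1.1 * z.1.2 - y.1.2 * z.1.1).
Definition dot (y z : vec) : int := y.1.1 * z.1.1 + y.1.2 * z.1.2 + y.2 * z.2.
(** A multiple s y is written [comb s 0 y 0], so that every vector identity below is a
    coordinatewise [ring]. *)
Definition comb (s t : int) (y z : vec) : vec :=
  (s * y.1.1 + t * z.1.1, s * y.1.2 + t * z.1.2, s * y.2 + t * z.2).
Definition bf (b y z : vec) : int :=
  b.1.1 * y.1.1 * z.1.1 + b.1.2 * y.1.2 * z.1.2 + b.2 * y.2 * z.2.
Definition qf (b y : vec) : int := bf b y y.
(** The adjugate of the diagonal form [b], whose determinant is [vol b]. *)
Definition dual (b : vec) : vec := (b.1.2 * b.2, b.1.1 * b.2, b.1.1 * b.1.2).
Definition vol (b : vec) : int := b.1.1 * b.1.2 * b.2.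
Definition dvdv (d : int) (y : vec) : bool :=
  [&& (d %| y.1.1)%Z, (d %| y.1.2)%Z & (d %| y.2)%Z].

Ltac vec_unfold := rewrite /qf /bf /dot /crs /comb /dual /vol /=.

Lemma dvdvP d y : reflect (exists z, y = comb d 0 z 0) (dvdv d y).
Proof.
case: y => [[y1 y2] y3]; apply: (iffP and3P) => /=.
  move=> [/dvdzP[q1 ->] /dvdzP[q2 ->] /dvdzP[q3 ->]].
  by exists (q1, q2, q3); rewrite /comb /=; congr (_, _, _); ring.
by move=> [z [-> -> ->]]; split; apply/dvdzP; eexists; rewrite mul0r addr0 mulrC.
Qed.

(** The right-hand side is the Gram determinant of the three vectors, expanded along its first
    row. *)
Lemma gram b x y z : vol b * dot x (crs y z) ^+ 2 =
  qf b x * (qf b y * qf b z - bf b y z ^+ 2)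
  - bf b x y * (bf b x y * qf b z - bf b y z * bf b x z)
  + bf b x z * (bf b x y * bf b y z - qf b y * bf b x z).
Proof. by vec_unfold; ring. Qed.

(** Lagrange's identity for a diagonal form. It is the source of the dual conic: the normal of a
    chord between two p-adically close points gets a dual value divisible by a high power of [p]. *)
Lemma lagrange b y z :
  qf (dual b) (crs y z) = qf b y * qf b z - bf b y z ^+ 2.
Proof. by vec_unfold; ring. Qed.

Lemma qf_comb b s t y z :
  qf b (comb s t y z) = s ^+ 2 * qf b y + t ^+ 2 * qf b z + 2 * s * t * bf b y z.
Proof. by vec_unfold; ring. Qed.

Lemma bf_comb b s t x y z :
  bf b x (comb s t y z) = s * bf b x y + t * bf b x z.
Proof. by vec_unfold; ring. Qed.

Lemma bfC b y z : bf b y z = bf b z y.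
Proof. by vec_unfold; ring. Qed.

Lemma crsvv x : crs x x = 0.
Proof. by vec_unfold; congr (_, _, _); ring. Qed.

Lemma crsC x y : crs y x = comb (-1) 0 (crs x y) 0.
Proof. by vec_unfold; congr (_, _, _); ring. Qed.

Lemma dvdv_comb d s t y z : dvdv d y -> dvdv d z -> dvdv d (comb s t y z).
Proof.
move=> /dvdvP[y' ->] /dvdvP[z' ->]; apply/dvdvP; exists (comb s t y' z').
by vec_unfold; congr (_, _, _); ring.
Qed.

Lemma dvdv_trans d e y : (d %| e)%Z -> dvdv e y -> dvdv d y.
Proof.
by move=> h /and3P[h1 h2 h3]; apply/and3P; split; apply: dvdz_trans h _.
Qed.

Lemma qf_dvd d b y : dvdv d y -> (d ^+ 2 %| qf b y)%Z.
Proof.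
move=> /dvdvP[z ->]; apply/dvdzP; exists (qf b z).
by vec_unfold; ring.
Qed.

(** * Primitive vectors modulo p and tangency to the conic *)

Section PrimitiveVectors.
Variables (p : nat) (b : vec).
Hypotheses (p_pr : prime p) (p_odd : (2 < p)%N) (b_unit : coprimez (vol b) p).

(** Primitive at [p] alone: common factors prime to [p] are allowed. *)
Definition pprim (y : vec) := ~~ dvdv p y.

Lemma coprime_pX (s : int) K : ~~ (p %| s)%Z -> coprimez (p%:Z ^+ K) s.
Proof.
move=> h; apply: coprimezXl; rewrite coprimezE /= prime_coprime //.
Qed.

Lemma punit_mul (s t : int) : ~~ (p %| s)%Z -> ~~ (p %| t)%Z -> ~~ (p %| s * t)%Z.
Proof. by rewrite !dvdzE abszM /= Euclid_dvdM // => /negbTE-> /negbTE->. Qed.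

Lemma punit2 : ~~ (p %| 2)%Z.
Proof. by rewrite dvdzE /=; apply/negP => /dvdn_leq; move: p_odd; clear; lia. Qed.

Lemma vol_punit : ~~ (p %| vol b)%Z.
Proof.
by move: b_unit; rewrite coprimez_sym coprimezE /= prime_coprime.
Qed.

Lemma gauss_pX (s x : int) K :
  ~~ (p %| s)%Z -> (p%:Z ^+ K %| s * x)%Z -> (p%:Z ^+ K %| x)%Z.
Proof. by move=> h; rewrite Gauss_dvdzr // coprime_pX. Qed.

Lemma gauss_p (s x : int) :
  ~~ (p %| s)%Z -> (p %| s * x)%Z -> (p %| x)%Z.
Proof. by move=> h; have := @gauss_pX s x 1 h; rewrite expr1. Qed.

(* Gram determinant with the coordinate vector: a totally isotropic pair has
   a vanishing 2x2 minor in each pair of coordinates. *)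
Lemma isotropic y z : (p %| qf b y)%Z -> (p %| qf b z)%Z -> (p %| bf b y z)%Z ->
  dvdv p (crs y z).
Proof.
move=> hy hz hyz.
have key e : (p %| dot e (crs y z))%Z.
  have h : (p %| vol b * dot e (crs y z) ^+ 2)%Z.
    rewrite gram; case/dvdzP: hy => u ->; case/dvdzP: hz => v ->.
    case/dvdzP: hyz => w ->; apply/dvdzP.
    exists (qf b e * (u * v * p - w ^+ 2 * p)
     - bf b e y * (bf b e y * v - w * bf b e z)
     + bf b e z * (bf b e y * w - u * bf b e z)); ring.
  move/(gauss_p vol_punit): h.
  by rewrite !dvdzE abszX /= Euclid_dvdX // andbT.
have k1 := key (1, 0, 0); have k2 := key (0, 1, 0); have k3 := key (0, 0, 1).
by apply/and3P; split; [move: k1|move: k2|move: k3];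
   rewrite /dot /= ?mul1r ?mul0r ?add0r ?addr0.
Qed.

Lemma pprim_scale s y : ~~ (p %| s)%Z -> dvdv p (comb s 0 y 0) -> dvdv p y.
Proof.
move=> hs /and3P[]; rewrite /= !mul0r !addr0.
by move=> *; apply/and3P; split; apply: (gauss_p hs).
Qed.

(** A coordinate of [y] prime to [p] serves as [s], and minus the same coordinate of [z] as [t]; the
    coordinates of the combination are then entries of the cross product up to sign. *)
Lemma parallel y z K : pprim y -> dvdv (p%:Z ^+ K) (crs y z) ->
  exists s t, ~~ (p %| s)%Z /\ dvdv (p%:Z ^+ K) (comb s t z y).
Proof.
rewrite /pprim /dvdv !negb_and => /or3P h /and3P[/dvdzP[u hu] /dvdzP[v hv] /dvdzP[w hw]].
move: hu hv hw; rewrite /crs /= => hu hv hw.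
case: h => h; [exists y.1.1, (- z.1.1)|exists y.1.2, (- z.1.2)|exists y.2, (-z.2)];
  (split; first by []); rewrite /comb /=; apply/and3P; split; apply/dvdzP.
- by exists 0; ring.
- by exists w; rewrite -hw; ring.
- by exists (- v); rewrite [RHS]mulNr -hv; ring.
- by exists (- w); rewrite [RHS]mulNr -hw; ring.
- by exists 0; ring.
- by exists u; rewrite -hu; ring.
- by exists v; rewrite -hv; ring.
- by exists (- u); rewrite [RHS]mulNr -hu; ring.
- by exists 0; ring.
Qed.

(* Points that are proportional modulo [p ^ K] lie near a common tangent line,
   which gains a factor two in the exponent. *)
Lemma bf_tangent m K y z : pprim y -> pprim z ->
  (p%:Z ^+ m %| qf b y)%Z -> (p%:Z ^+ m %| qf b z)%Z ->
  dvdv (p%:Z ^+ K) (crs y z) -> (p%:Z ^+ (minn (2 * K) m) %| bf b y z)%Z.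
Proof.
case: K => [|K]; first by rewrite muln0 min0n expr0 dvd1z.
move=> py pz hy hz hyz; have [s [t [us hst]]] := parallel py hyz.
(* If [p] divided [t], then [s z], and with it [z], would vanish modulo [p]. *)
have ut : ~~ (p %| t)%Z.
  apply/negP => /dvdzP[t' Et]; move/negP: pz; apply.
  apply: (pprim_scale us).
  have -> : comb s 0 z 0 = comb 1 (- t) (comb s t z y) y.
    by vec_unfold; congr (_, _, _); ring.
  have h1 : dvdv p (comb s t z y).
    by apply: dvdv_trans hst; apply: dvdz_exp.
  have -> : comb 1 (- t) (comb s t z y) y = comb 1 (- 1) (comb s t z y) (comb t 0 y 0).
    by vec_unfold; congr (_, _, _); ring.
  apply: dvdv_comb => //; apply/dvdvP; exists (comb t' 0 y 0).
  by rewrite Et; vec_unfold; congr (_, _, _); ring.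
set L := minn _ _.
(* The vector s z + t y is divisible by p ^ K, so the form there is divisible by p ^ (2 K).
   Expanding it leaves a unit multiple, 2 s t, of the bilinear value. *)
have d1 : (p%:Z ^+ L %| qf b (comb s t z y))%Z.
  apply: (dvdz_trans _ (qf_dvd b hst)); rewrite -exprM.
  by apply: dvdz_exp2l; rewrite mulnC geq_minl.
have hL : (p%:Z ^+ L %| p%:Z ^+ m)%Z by apply: dvdz_exp2l; rewrite geq_minr.
have {}hy := dvdz_trans hL hy; have {}hz := dvdz_trans hL hz.
have u2 := punit_mul (punit_mul punit2 us) ut.
apply: (gauss_pX u2); move: d1; rewrite qf_comb (bfC b z) => /dvdzP[e He].
case/dvdzP: hy => f Hf; case/dvdzP: hz => g Hg; apply/dvdzP.
exists (e - s ^+ 2 * g - t ^+ 2 * f); rewrite !mulrBl -He Hg Hf; ring.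
Qed.

(* Converse of [bf_tangent]: the restriction of the form to a tangent line has
   rank one, so the gain is exactly a factor two. *)
Lemma bf_tangent_inv m v y z : pprim y -> (2 * v < m)%N ->
  (p%:Z ^+ m %| qf b y)%Z -> (p%:Z ^+ m %| qf b z)%Z ->
  dvdv (p%:Z ^+ v) (crs y z) -> (p%:Z ^+ m %| bf b y z)%Z ->
  dvdv (p%:Z ^+ v.+1) (crs y z).
Proof.
move=> py hv hy hz hyz hB; have [s [t [us /dvdvP[x Ex]]]] := parallel py hyz.
have p0 : p%:Z != 0 by rewrite eqz_nat; lia.
have hQ : (p%:Z ^+ m %| qf b (comb s t z y))%Z.
  rewrite qf_comb (bfC b z); case/dvdzP: hy => f ->; case/dvdzP: hz => g ->.
  case/dvdzP: hB => e ->; apply/dvdzP.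
  by exists (s ^+ 2 * g + t ^+ 2 * f + 2 * s * t * e); ring.
have hB' : (p%:Z ^+ m %| bf b y (comb s t z y))%Z.
  rewrite bf_comb; case/dvdzP: hy => f; rewrite /qf => ->.
  case/dvdzP: hB => e ->; apply/dvdzP.
  by exists (s * e + t * f); ring.
(* [x] is the combination divided by p ^ v. With [y] it is a totally isotropic pair modulo [p],
   which a nondegenerate ternary form allows only for proportional vectors. The bound 2 v < m keeps
   one factor [p] in the form at [x]. *)
have iso : dvdv p (crs y x).
  apply: isotropic.
  - by apply: dvdz_trans hy; apply: dvdz_exp => //; lia.
  - rewrite -(dvdz_mul2l (p := p%:Z ^+ (2 * v))) ?expf_neq0 // -exprSr.
    have -> : p%:Z ^+ (2 * v) * qf b x = qf b (comb s t z y).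
      by rewrite Ex mulnC exprM; vec_unfold; ring.
    by apply: dvdz_trans hQ; apply: dvdz_exp2l.
  - rewrite -(dvdz_mul2l (p := p%:Z ^+ v)) ?expf_neq0 // -exprSr.
    have -> : p%:Z ^+ v * bf b y x = bf b y (comb s t z y).
      by rewrite Ex; vec_unfold; ring.
    by apply: dvdz_trans hB'; apply: dvdz_exp2l; lia.
have h : dvdv (p%:Z ^+ v.+1) (comb s 0 (crs y z) 0).
  have -> : comb s 0 (crs y z) 0 = comb (p%:Z ^+ v) 0 (crs y x) 0.
    have -> : comb (p%:Z ^+ v) 0 (crs y x) 0 = crs y (comb (p%:Z ^+ v) 0 x 0).
      by vec_unfold; congr (_, _, _); ring.
    by rewrite -Ex; vec_unfold; congr (_, _, _); ring.
  case/dvdvP: iso => r ->; apply/dvdvP; exists r.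
  by rewrite exprSr; vec_unfold; congr (_, _, _); ring.
case/and3P: h; rewrite /= !mul0r !addr0 => *.
by apply/and3P; split; apply: (gauss_pX us).
Qed.

(** All entries of the Gram matrix are divisible by p ^ (2 k), hence its determinant by p ^ (6 k),
    and the determinant of the three vectors by p ^ (3 k), which exceeds its size. *)
Lemma coplanar m k Y x y z : pprim x -> pprim y -> pprim z -> (2 * k <= m)%N ->
  (p%:Z ^+ m %| qf b x)%Z -> (p%:Z ^+ m %| qf b y)%Z -> (p%:Z ^+ m %| qf b z)%Z ->
  dvdv (p%:Z ^+ k) (crs x y) -> dvdv (p%:Z ^+ k) (crs x z) ->
  dvdv (p%:Z ^+ k) (crs y z) -> (`|dot x (crs y z)| <= Y)%N -> (Y < p ^ (3 * k))%N ->
  dot x (crs y z) = 0.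
Proof.
move=> px py pz hk hx hy hz hxy hxz hyz hY Yp.
have T u v hu hv pu pv huv := bf_tangent (m := m) (K := k) (y := u) (z := v) pu pv hu hv huv.
have := T _ _ hx hy px py hxy; have := T _ _ hx hz px pz hxz.
have := T _ _ hy hz py pz hyz.
rewrite (minn_idPl hk) => hB1 hB2 hB3.
have hk' : (p%:Z ^+ (2 * k) %| p%:Z ^+ m)%Z by apply: dvdz_exp2l.
have {}hx := dvdz_trans hk' hx; have {}hy := dvdz_trans hk' hy.
have {}hz := dvdz_trans hk' hz.
have h : (p%:Z ^+ (2 * (3 * k)) %| vol b * dot x (crs y z) ^+ 2)%Z.
  rewrite gram; case/dvdzP: hx => u ->; case/dvdzP: hy => v ->.
  case/dvdzP: hz => w ->; case/dvdzP: hB1 => d ->; case/dvdzP: hB2 => e ->.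
  case/dvdzP: hB3 => f ->; apply/dvdzP.
  have -> : (2 * (3 * k) = 2 * k + 2 * k + 2 * k)%N by lia.
  rewrite !exprD; set P := p%:Z ^+ _.
  exists (u * (v * w - d ^+ 2) - f * (f * w - d * e) + e * (f * d - v * e)); ring.
move/(gauss_pX vol_punit): h; rewrite mulnC exprM dvdz_pexp2r // dvdzE abszX /=.
move=> h; apply/eqP; rewrite -absz_eq0; apply/negPn/negP.
rewrite -lt0n => /dvdn_leq/(_ h) h'.
by have := leq_trans h' hY; rewrite leqNgt Yp.
Qed.

(** Two coefficients divisible by [p] would force the third to be, since the vector it multiplies is
    primitive at [p]. So at most one of them is divisible by [p]. *)
Lemma two_unit_coeffs x y z c1 c2 c3 : pprim x -> pprim y -> pprim z ->
  comb 1 c3 (comb c1 c2 x y) z = 0 ->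
  ~~ [&& (p %| c1)%Z, (p %| c2)%Z & (p %| c3)%Z] ->
  [\/ ~~ (p %| c1)%Z /\ ~~ (p %| c2)%Z, ~~ (p %| c2)%Z /\ ~~ (p %| c3)%Z
    | ~~ (p %| c3)%Z /\ ~~ (p %| c1)%Z].
Proof.
move=> px py pz [e1 e2 e3].
have imp a1 a2 a3 (u v w : vec) : pprim u ->
    a1 * u.1.1 + a2 * v.1.1 + a3 * w.1.1 = 0 ->
    a1 * u.1.2 + a2 * v.1.2 + a3 * w.1.2 = 0 ->
    a1 * u.2 + a2 * v.2 + a3 * w.2 = 0 ->
    (p %| a2)%Z -> (p %| a3)%Z -> (p %| a1)%Z.
  move=> pu f1 f2 f3 /dvdzP[q2 E2] /dvdzP[q3 E3]; apply: contraNT pu => h1.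
  by apply/and3P; split; apply: (gauss_p h1); apply/dvdzP;
    [exists (- q2 * v.1.1 - q3 * w.1.1)|exists (- q2 * v.1.2 - q3 * w.1.2)|
     exists (- q2 * v.2 - q3 * w.2)]; move: f1 f2 f3; rewrite E2 E3; lia.
have i1 := imp c1 c2 c3 x y z px; have i2 := imp c2 c3 c1 y z x py.
have i3 := imp c3 c1 c2 z x y pz.
move: i1 i2 i3 e1 e2 e3; rewrite /= => i1 i2 i3 e1 e2 e3.
have {}i1 : (p %| c2)%Z -> (p %| c3)%Z -> (p %| c1)%Z by apply: i1; lia.
have {}i2 : (p %| c3)%Z -> (p %| c1)%Z -> (p %| c2)%Z by apply: i2; lia.
have {}i3 : (p %| c1)%Z -> (p %| c2)%Z -> (p %| c3)%Z by apply: i3; lia.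
case: (boolP (p %| c1)%Z) i1 i2 i3 => h1; case: (boolP (p %| c2)%Z) => h2;
  case: (boolP (p %| c3)%Z) => h3 //= i1 i2 i3 _;
  by [apply: Or31 | apply: Or32 | apply: Or33 | have := i1 isT isT
     | have := i2 isT isT | have := i3 isT isT].
Qed.

(** Evaluating the form on c1 x + c2 y = - c3 z makes the bilinear value at x, y divisible by p ^ m.
    Then [bf_tangent_inv] raises the exponent of the cross product one step at a time, as long as it
    stays below k. *)
Lemma relation_proportional m k x y z c1 c2 c3 : pprim x -> (2 * k <= m)%N ->
  (p%:Z ^+ m %| qf b x)%Z -> (p%:Z ^+ m %| qf b y)%Z -> (p%:Z ^+ m %| qf b z)%Z ->
  comb 1 c3 (comb c1 c2 x y) z = 0 -> ~~ (p %| c1)%Z -> ~~ (p %| c2)%Z ->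
  dvdv (p%:Z ^+ k) (crs x y).
Proof.
move=> px hk hx hy hz rel u1 u2.
have hB : (p%:Z ^+ m %| bf b x y)%Z.
  apply: (gauss_pX (punit_mul (punit_mul punit2 u1) u2)).
  have E : comb c1 c2 x y = comb (- c3) 0 z 0.
    by case: rel => e1 e2 e3; rewrite /comb; congr (_, _, _); lia.
  have : qf b (comb c1 c2 x y) = c3 ^+ 2 * qf b z by rewrite E; vec_unfold; ring.
  rewrite qf_comb => E'; case/dvdzP: hx E' => u ->; case/dvdzP: hy => v ->.
  case/dvdzP: hz => w -> E'; apply/dvdzP; exists (c3 ^+ 2 * w - c1 ^+ 2 * u - c2 ^+ 2 * v).
  move: E'; set P := p%:Z ^+ m; set B := bf b x y => E'.
  have -> : (c3 ^+ 2 * w - c1 ^+ 2 * u - c2 ^+ 2 * v) * P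
     = c3 ^+ 2 * (w * P) - c1 ^+ 2 * (u * P) - c2 ^+ 2 * (v * P) by ring.
  by rewrite -E'; ring.
suff H j : (j <= k)%N -> dvdv (p%:Z ^+ j) (crs x y) by apply: H.
elim: j => [|j IH] jk; first by rewrite expr0 /dvdv !dvd1z.
by apply: (bf_tangent_inv (m := m)); rewrite ?IH // ?(ltnW jk) //; lia.
Qed.
End PrimitiveVectors.

(** * Normal vectors of rational lines *)

Definition unimod (w : vec) := exists a, dot a w = 1.

(** The first nonzero coordinate is positive. This selects one of w and - w, so that a line has a
    single normal vector. *)
Definition lexpos (w : vec) : bool :=
  [|| 0 < w.1.1, (w.1.1 == 0) && (0 < w.1.2)
    | [&& w.1.1 == 0, w.1.2 == 0 & 0 < w.2]].

Definition normal (w : vec) := unimod w /\ lexpos w.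

(** The expansion of the triple product: a x (v x w) = (a . w) v - (a . v) w. *)
Lemma unimod_parallel w v a : dot a w = 1 -> crs v w = 0 -> v = comb (dot a v) 0 w 0.
Proof.
move=> ha h.
have : comb (dot a w) 0 v 0 = comb 1 1 (comb (dot a v) 0 w 0) (crs a (crs v w)).
  by vec_unfold; congr (_, _, _); ring.
rewrite ha h.
have -> : comb 1 0 v 0 = v by case: v {h} => [[? ?] ?]; vec_unfold; congr (_, _, _); ring.
by move=> E; rewrite [LHS]E; vec_unfold; congr (_, _, _); ring.
Qed.

Lemma unimod_pprim p w : prime p -> unimod w -> pprim p w.
Proof.
move=> pp [a ha]; apply/negP => /dvdvP[z Ez].
have : (p %| dot a w)%Z.
  by rewrite Ez; apply/dvdzP; exists (dot a z); vec_unfold; ring.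
by rewrite ha dvdz1 => /eqP; case: p pp {Ez} => [|[|p]].
Qed.

Lemma crs_orth w y z : dot w y = 0 -> dot w z = 0 -> crs (crs y z) w = 0.
Proof.
move=> h1 h2; have : crs (crs y z) w = comb (dot w y) (- dot w z) z y.
  by vec_unfold; congr (_, _, _); ring.
by rewrite h1 h2 => ->; vec_unfold; congr (_, _, _); ring.
Qed.

Lemma normal_exists v : v <> 0 -> exists D w, [/\ D <> 0, normal w & v = comb D 0 w 0].
Proof.
case: v => [[v1 v2] v3] v0.
have [u [u' Hu]] := Bezoutz v1 v2; have [t [t' Ht]] := Bezoutz (gcdz v1 v2) v3.
set g := gcdz (gcdz v1 v2) v3.
have g0 : g != 0.
  rewrite !gcdz_eq0; apply/negP => /andP[/andP[/eqP e1 /eqP e2] /eqP e3].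
  by apply: v0; rewrite e1 e2 e3.
have /dvdzP[q3 E3] : (g %| v3)%Z by apply: dvdz_gcdr.
have /dvdzP[q1 E1] : (g %| v1)%Z.
  by apply: dvdz_trans (dvdz_gcdl v1 v2); apply: dvdz_gcdl.
have /dvdzP[q2 E2] : (g %| v2)%Z.
  by apply: dvdz_trans (dvdz_gcdr v1 v2); apply: dvdz_gcdl.
have um : t * u * q1 + t * u' * q2 + t' * q3 = 1.
  apply: (mulIf g0); rewrite mul1r -[in RHS]/g -[RHS]Ht -Hu E1 E2 E3; ring.
have : lexpos (q1, q2, q3) || lexpos (- q1, - q2, - q3).
  rewrite /lexpos /=; apply: contraT => h.
  have [e1 [e2 e3]] : q1 = 0 /\ q2 = 0 /\ q3 = 0 by lia.
  by move: um; rewrite e1 e2 e3 !mulr0.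
case/orP => hl; [exists g, (q1, q2, q3)|exists (- g), (- q1, - q2, - q3)]; split.
- exact/eqP.
- by split=> //; exists (t * u, t * u', t').
- by rewrite /comb /= E1 E2 E3; congr (_, _, _); ring.
- by apply/eqP; rewrite oppr_eq0.
- split=> //; exists (- (t * u), - (t * u'), - t').
  by rewrite /dot /= !mulrNN.
- by rewrite /comb /= E1 E2 E3; congr (_, _, _); ring.
Qed.

Lemma normal_inj v w : normal v -> normal w -> crs v w = 0 -> v = w.
Proof.
move=> [[a ha] lv] [[c hc] lw] h.
have h' : crs w v = 0 by rewrite crsC h; vec_unfold; congr (_, _, _); ring.
have E := unimod_parallel hc h; have E' := unimod_parallel ha h'.
move: E E'; set s := dot c v; set t := dot a w => E E'.
have st : s * t = 1.
  have : dot c w = 1 by []. rewrite E' => e; rewrite -e /s; vec_unfold; ring.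
have [] : s = 1 \/ s = - 1.
  have : (`|s| * `|t| = 1)%N by rewrite -abszM st.
  by move=> /eqP; rewrite muln_eq1 => /andP[/eqP]; lia.
  by move=> s1; rewrite E s1; case: (w) => [[w1 w2] w3]; vec_unfold; congr (_, _, _); ring.
move=> s1; move: lv lw; rewrite E s1; case: (w) => [[w1 w2] w3]; rewrite /lexpos /=; lia.
Qed.

Section TwoClasses.
Variables (p : nat) (b : vec).
Hypotheses (p_pr : prime p) (p_odd : (2 < p)%N) (b_unit : coprimez (vol b) p).

(** The p-adic form of the fact that a line meets a conic in at most two points. The three cross
    products are multiples of [w], and the multipliers are the coefficients of a linear relation
    between the points. Once this relation is made primitive two of its coefficients are units, and
    the corresponding points are proportional modulo p ^ k. *)
Lemma line_two_classes m k w x y z : unimod w -> (2 * k <= m)%N ->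
  pprim p x -> pprim p y -> pprim p z ->
  (p%:Z ^+ m %| qf b x)%Z -> (p%:Z ^+ m %| qf b y)%Z -> (p%:Z ^+ m %| qf b z)%Z ->
  dot w x = 0 -> dot w y = 0 -> dot w z = 0 ->
  [\/ dvdv (p%:Z ^+ k) (crs x y), dvdv (p%:Z ^+ k) (crs y z)
    | dvdv (p%:Z ^+ k) (crs z x)].
Proof.
move=> [a ha] hk px py pz hx hy hz ox oy oz.
have E1 := unimod_parallel ha (crs_orth oy oz).
have E2 := unimod_parallel ha (crs_orth oz ox).
have E3 := unimod_parallel ha (crs_orth ox oy).
move: E1 E2 E3; set D1 := dot a _; set D2 := dot a _; set D3 := dot a _.
move=> E1 E2 E3.
have rel0 : comb 1 D3 (comb D1 D2 x y) z = 0.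
  have det0 : dot x (crs y z) = 0.
    rewrite E1; have -> : dot x (comb D1 0 w 0) = D1 * dot w x by vec_unfold; ring.
    by rewrite ox mulr0.
  rewrite /D1 /D2 /D3.
  have -> : comb 1 (dot a (crs x y)) (comb (dot a (crs y z)) (dot a (crs z x)) x y) z =
    comb (dot x (crs y z)) 0 a 0 by vec_unfold; congr (_, _, _); ring.
  by rewrite det0; vec_unfold; congr (_, _, _); ring.
have [/eqP D0|Dn0] := boolP (((D1, D2), D3) == 0 :> vec).
  case: D0 => d1 d2 d3; apply: Or31; rewrite E3 d3.
  by apply/dvdvP; exists 0; vec_unfold; congr (_, _, _); ring.
have [g [[[c1 c2] c3] [/eqP g0 [um _] [F1 F2 F3]]]] := normal_exists (elimN eqP Dn0).
have rel : comb 1 c3 (comb c1 c2 x y) z = 0.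
  move: rel0; rewrite F1 F2 F3 /comb /= => -[r1 r2 r3].
  by congr (_, _, _); apply: (mulfI g0); rewrite mulr0; [rewrite -r1|rewrite -r2|rewrite -r3]; ring.
have nd : ~~ [&& (p %| c1)%Z, (p %| c2)%Z & (p %| c3)%Z].
  exact: (unimod_pprim p_pr um).
have rel2 : comb 1 c1 (comb c2 c3 y z) x = 0.
  by rewrite -rel; vec_unfold; congr (_, _, _); ring.
have rel3 : comb 1 c2 (comb c3 c1 z x) y = 0.
  by rewrite -rel; vec_unfold; congr (_, _, _); ring.
have [[u v]|[u v]|[u v]] := two_unit_coeffs p_pr p_odd b_unit px py pz rel nd.
- by apply: Or31; apply: (relation_proportional p_pr p_odd b_unit px hk hx hy hz rel).
- by apply: Or32; apply: (relation_proportional p_pr p_odd b_unit py hk hy hz hx rel2).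
- by apply: Or33; apply: (relation_proportional p_pr p_odd b_unit pz hk hz hx hy rel3).
Qed.
End TwoClasses.

(** * Slopes, and residue classes with several points *)

Definition boxed (Y : nat) (y : vec) : bool :=
  [&& (`|y.1.1| <= Y)%N, (`|y.1.2| <= Y)%N & (`|y.2| <= Y)%N].

(* Sort the points by slope [g / f]: distinct slopes differ by [H / Y ^ 2]. *)
Lemma slopes_half (T : eqType) (s : seq T) (f g : T -> int) (Y H : nat) :
  uniq s -> (0 < H)%N -> (0 < Y)%N ->
  (forall y, y \in s -> f y != 0) ->
  (forall y, y \in s -> (`|g y| <= `|f y|)%N) ->
  (forall y, y \in s -> (`|f y| <= Y)%N) ->
  (forall y z, y \in s -> z \in s -> y != z -> (H <= `|(f y * g z - g y * f z)%R|)%N) ->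
  (size s * H <= 2 * Y ^ 2 + H)%N.
Proof.
move=> us H0 Y0 f0 gf fY sep.
(* The sign is moved to the numerator, so that the slope G / F lies in [-1, 1] with F positive. *)
pose F y : int := `|f y|%N; pose G y : int := sgz (f y) * g y.
have F0 y : y \in s -> 0 < F y by move=> /f0; rewrite /F; lia.
have G0 y : y \in s -> - F y <= G y <= F y.
  move=> ys; have := gf _ ys; have := f0 _ ys; rewrite /F /G.
  by case: sgzP => // h _; lia.
(* The index of the cell of length H / Y ^ 2 that contains the slope shifted by 1. Distinct points
   lie in distinct cells. *)
pose c y := `|((G y + F y) * Y%:Z ^+ 2 %/ (F y * H%:Z))%Z|%N.
have den y : y \in s -> 0 < F y * H%:Z by move=> ys; rewrite mulr_gt0 ?F0.
have cE y : y \in s -> (c y)%:Z = ((G y + F y) * Y%:Z ^+ 2 %/ (F y * H%:Z))%Z.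
  move=> ys; rewrite /c gez0_abs // divz_ge0 ?den // mulr_ge0 ?sqr_ge0 //.
  by have := G0 _ ys; lia.
have lo y : y \in s -> (c y)%:Z * (F y * H%:Z) <= (G y + F y) * Y%:Z ^+ 2.
  by move=> ys; rewrite cE // lez_floor // gt_eqF // den.
have up y : y \in s -> (G y + F y) * Y%:Z ^+ 2 < ((c y)%:Z + 1) * (F y * H%:Z).
  by move=> ys; rewrite cE // ltz_ceil // den.
have inj : {in s &, injective c}.
  move=> y z ys zs e; apply/eqP; apply: contraT => nyz.
  have := sep _ _ ys zs nyz.
  have Ey := F0 _ ys; have Ez := F0 _ zs.
  have -> : `|(f y * g z - g y * f z)%R|%N = `|(F y * G z - G y * F z)%R|%N.
    have FE u : F u = sgz (f u) * f u by rewrite /F abszE normrEsg sgrEz intz.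
    have sg1 u : u \in s -> `|sgz (f u)|%N = 1%N by move=> /f0; case: sgzP.
    rewrite !FE /G.
    have -> : sgz (f y) * f y * (sgz (f z) * g z) - sgz (f y) * g y * (sgz (f z) * f z)
      = sgz (f y) * sgz (f z) * (f y * g z - g y * f z) by ring.
    by rewrite !abszM !sg1 // !mul1n.
  have := lo _ ys; have := up _ ys; have := lo _ zs; have := up _ zs; rewrite e.
  have := fY _ ys; have := fY _ zs.
  have {}Ey : F y <= Y -> F y <= Y by [].
  move=> fz fy u1 l1 u2 l2.
  have FyY : F y <= Y by rewrite /F; lia.
  have FzY : F z <= Y by rewrite /F; lia.
  have Fy := F0 _ ys; have Fz := F0 _ zs.
  have Yp : 0 < Y%:Z ^+ 2 by rewrite exprn_gt0.
  set P := F y * F z.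
  have PY : P <= Y%:Z ^+ 2 by rewrite /P expr2 ler_pM // ltW.
  have m1 : ((G y + F y) * F z - (G z + F z) * F y) * Y%:Z ^+ 2 < P * H%:Z.
    have := ltr_pM2r Fz ((G y + F y) * Y%:Z ^+ 2) (((c z)%:Z + 1) * (F y * H%:Z)).
    rewrite u2 => /idP a1.
    have := ler_pM2r Fy ((c z)%:Z * (F z * H%:Z)) ((G z + F z) * Y%:Z ^+ 2).
    rewrite l1 => /idP a2.
    have -> : ((G y + F y) * F z - (G z + F z) * F y) * Y%:Z ^+ 2 =
       (G y + F y) * Y%:Z ^+ 2 * F z - (G z + F z) * Y%:Z ^+ 2 * F y by ring.
    have -> : P * H%:Z = ((c z)%:Z + 1) * (F y * H%:Z) * F z - (c z)%:Z * (F z * H%:Z) * F y.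
      by rewrite /P; ring.
    by apply: ltr_leB.
  have m2 : ((G z + F z) * F y - (G y + F y) * F z) * Y%:Z ^+ 2 < P * H%:Z.
    have := ltr_pM2r Fy ((G z + F z) * Y%:Z ^+ 2) (((c z)%:Z + 1) * (F z * H%:Z)).
    rewrite u1 => /idP a1.
    have := ler_pM2r Fz ((c z)%:Z * (F y * H%:Z)) ((G y + F y) * Y%:Z ^+ 2).
    rewrite l2 => /idP a2.
    have -> : ((G z + F z) * F y - (G y + F y) * F z) * Y%:Z ^+ 2 =
       (G z + F z) * Y%:Z ^+ 2 * F y - (G y + F y) * Y%:Z ^+ 2 * F z by ring.
    have -> : P * H%:Z = ((c z)%:Z + 1) * (F z * H%:Z) * F y - (c z)%:Z * (F y * H%:Z) * F z.
      by rewrite /P; ring.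
    by apply: ltr_leB.
  have PH : P * H%:Z <= H%:Z * Y%:Z ^+ 2 by rewrite mulrC ler_wpM2l.
  have {}m1 := lt_le_trans m1 PH; have {}m2 := lt_le_trans m2 PH.
  rewrite ltr_pM2r // in m1; rewrite ltr_pM2r // in m2.
  by move: m1 m2; lia.
have bnd y : y \in s -> (c y < (2 * Y ^ 2) %/ H + 1)%N.
  move=> ys; rewrite addn1 ltnS leq_divRL //.
  have := lo _ ys; have := G0 _ ys; have Fy := F0 _ ys => /andP[_ h] l.
  have : (c y)%:Z * H%:Z * F y <= 2 * Y%:Z ^+ 2 * F y.
    rewrite -mulrA [H%:Z * _]mulrC (le_trans l) // [X in _ <= X]mulrAC.
    by rewrite ler_wpM2r ?sqr_ge0 //; lia.
  by rewrite ler_pM2r //; lia.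
have : (size (map c s) <= size (iota 0 ((2 * Y ^ 2) %/ H + 1)))%N.
  apply: uniq_leq_size; first by rewrite map_inj_in_uniq.
  by move=> _ /mapP[y ys ->]; rewrite mem_iota /= add0n bnd.
rewrite size_map size_iota => h.
apply: (leq_trans (leq_mul h (leqnn H))).
by rewrite mulnDl mul1n leq_add2r leq_trunc_div.
Qed.

(** The points with |g| <= |f| are sorted by g / f, the others by f / g. The two halves give 4 Y ^ 2
    + 2 H, and a single pair of points already shows H <= 2 Y ^ 2. *)
Lemma slopes (T : eqType) (s : seq T) (f g : T -> int) (Y H : nat) :
  uniq s -> (1 < size s)%N -> (0 < H)%N ->
  (forall y, y \in s -> (`|f y| <= Y)%N) ->
  (forall y, y \in s -> (`|g y| <= Y)%N) ->
  (forall y z, y \in s -> z \in s -> y != z -> (H <= `|(f y * g z - g y * f z)%R|)%N) ->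
  (size s * H <= 8 * Y ^ 2)%N.
Proof.
move=> us s1 H0 fY gY sep.
have [x [y [xs ys nxy]]] : exists x y, [/\ x \in s, y \in s & x != y].
  case: s us s1 {fY gY sep} => [|x [|y s]] //= /andP[]; rewrite inE negb_or => /andP[nxy _] _ _.
  by exists x, y; rewrite !inE eqxx nxy /= eqxx orbT.
have other z : z \in s -> exists2 t, t \in s & t != z.
  by move=> zs; have [e|ne] := eqVneq x z; [exists y => //; rewrite -e eq_sym|exists x].
have HY : (H <= 2 * Y ^ 2)%N.
  apply: leq_trans (sep _ _ xs ys nxy) _.
  have := fY _ xs; have := fY _ ys; have := gY _ xs; have := gY _ ys.
  move=> h1 h2 h3 h4; apply: leq_trans (leqD_dist _ 0 _) _.
  rewrite subr0 sub0r abszN !abszM.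
  have := leq_mul h4 h1; have := leq_mul h2 h3; lia.
have Y0 : (0 < Y)%N by case: Y HY {fY gY} => //; lia.
pose a z := (`|g z| <= `|f z|)%N.
have h1 : (size [seq z <- s | a z] * H <= 2 * Y ^ 2 + H)%N.
  apply: (@slopes_half _ _ f g) => //; rewrite ?filter_uniq //.
  - move=> z; rewrite mem_filter => /andP[az zs]; have [t ts ntz] := other _ zs.
    apply/eqP => fz; have := sep _ _ ts zs ntz.
    move: az; rewrite /a fz => gz; have gz0 : g z = 0 by move: gz; clear; lia.
    by rewrite gz0 !mulr0 subrr leqNgt H0.
  - by move=> z; rewrite mem_filter => /andP[].
  - by move=> z; rewrite mem_filter => /andP[_ /fY].
  - by move=> u v; rewrite !mem_filter => /andP[_ us'] /andP[_ vs]; apply: sep.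
have h2 : (size [seq z <- s | predC a z] * H <= 2 * Y ^ 2 + H)%N.
  apply: (@slopes_half _ _ g f) => //; rewrite ?filter_uniq //.
  - by move=> z; rewrite mem_filter => /andP[/= az zs]; move: az; rewrite /a; lia.
  - by move=> z; rewrite mem_filter => /andP[/= az _]; move: az; rewrite /a; lia.
  - by move=> z; rewrite mem_filter => /andP[_ /gY].
  - move=> u v; rewrite !mem_filter => /andP[_ us'] /andP[_ vs] nuv.
    by have := sep _ _ us' vs nuv; lia.
rewrite -(count_predC a s) -!size_filter mulnDl.
apply: leq_trans (leq_add h1 h2) _; clear -HY.
by move: (Y ^ 2)%N HY => Z; lia.
Qed.

Definition ncol (s : seq vec) := {in s &, forall y z, crs y z = 0 -> y = z}.

Section RichClass.
Variables (p : nat) (b : vec).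
Hypotheses (p_pr : prime p) (p_odd : (2 < p)%N) (b_unit : coprimez (vol b) p).

Definition conic_pt m Y (y : vec) : bool :=
  [&& pprim p y, (p%:Z ^+ m %| qf b y)%Z & boxed Y y].

Lemma boxed_det Y x y z : boxed Y x -> boxed Y y -> boxed Y z ->
  (`|dot x (crs y z)| <= 6 * Y ^ 3)%N.
Proof.
move=> /and3P[x1 x2 x3] /and3P[y1 y2 y3] /and3P[z1 z2 z3].
have bnd (a c d : int) : (`|a| <= Y)%N -> (`|c| <= Y)%N -> (`|d| <= Y)%N ->
    (`|(a * c * d)%R| <= Y ^ 3)%N.
  by move=> ha hc hd; rewrite !abszM !expnS expn0 muln1 mulnA !leq_mul.
have -> : dot x (crs y z) = x.1.1 * y.1.2 * z.2 - x.1.1 * y.2 * z.1.2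
  + (x.1.2 * y.2 * z.1.1 - x.1.2 * y.1.1 * z.2)
  + (x.2 * y.1.1 * z.1.2 - x.2 * y.1.2 * z.1.1) by vec_unfold; ring.
have := bnd _ _ _ x1 y2 z3; have := bnd _ _ _ x1 y3 z2.
have := bnd _ _ _ x2 y3 z1; have := bnd _ _ _ x2 y1 z3.
have := bnd _ _ _ x3 y1 z2; have := bnd _ _ _ x3 y2 z1.
clear; move: (_ * _ * _) => a1; move: (_ * _ * _) => a2; move: (_ * _ * _) => a3.
move: (_ * _ * _) => a4; move: (_ * _ * _) => a5; move: (_ * _ * _) => a6.
by move: (Y ^ 3)%N => Z; lia.
Qed.

(** Lagrange's identity supplies the exponent 2 min(2 K, m), of which the two factors p ^ K of the
    cross product take 2 K. The rest is left for the dual form at the normal. *)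
Lemma tangent_exponent m K : (K <= m)%N ->
  (2 * K + minn (2 * K) (2 * (m - K)) = 2 * minn (2 * K) m)%N.
Proof. by lia. Qed.

(* [w] is the line through the class; two points of the class at minimal
   p-adic distance [p ^ -K] make it tangent to the conic to order [2 * K]. *)
Lemma rich_class m k Y (t : seq vec) : uniq t -> (1 < size t)%N -> (2 * k <= m)%N ->
  (6 * Y ^ 3 < p ^ (3 * k))%N -> {in t, forall y, conic_pt m Y y} -> ncol t ->
  {in t &, forall y z, dvdv (p%:Z ^+ k) (crs y z)} ->
  exists w K, [/\ normal w, (k <= K)%N, {in t, forall y, dot w y = 0},
    (p%:Z ^+ minn (2 * K) (2 * (m - K)) %| qf (dual b) w)%Z &
    [/\ (size t * (p ^ K * `|w.1.1|) <= 8 * Y ^ 2)%N,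
        (size t * (p ^ K * `|w.1.2|) <= 8 * Y ^ 2)%N &
        (size t * (p ^ K * `|w.2|) <= 8 * Y ^ 2)%N]].
Proof.
move=> ut s1 hk Yp ht nc hc.
have p1 := prime_gt1 p_pr.
have [x [y [xt yt nxy]]] : exists x y, [/\ x \in t, y \in t & x != y].
  case: t ut s1 {ht nc hc} => [|x [|y s]] //= /andP[]; rewrite inE negb_or => /andP[nxy _] _ _.
  by exists x, y; rewrite !inE eqxx nxy /= eqxx orbT.
have nz u v : u \in t -> v \in t -> u != v -> crs u v <> 0.
  by move=> ut' vt nuv e; case/eqP: nuv; apply: nc.
have [D [w [/eqP D0 nw Ew]]] := normal_exists (nz _ _ xt yt nxy).
have [a ha] := nw.1.
have pt u : u \in t -> [/\ pprim p u, (p%:Z ^+ m %| qf b u)%Z & boxed Y u].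
  by move=> /ht /and3P.
have orth : {in t, forall u, dot w u = 0}.
  move=> u ut'; apply: (mulfI D0); rewrite mulr0.
  have -> : D * dot w u = dot u (crs x y) by rewrite Ew; vec_unfold; ring.
  have [pu hu bu] := pt _ ut'; have [px hx bx] := pt _ xt; have [py hy by_] := pt _ yt.
  by apply: (coplanar p_pr p_odd b_unit pu px py hk hu hx hy _ _ _ _ Yp);
    rewrite ?hc //; apply: boxed_det.
(* The multiplier in u x v = d w, read off with the Bezout vector [a] of [w]. *)
pose d u v := dot a (crs u v).
have dE u v : u \in t -> v \in t -> crs u v = comb (d u v) 0 w 0.
  by move=> hu hv; apply: unimod_parallel => //; apply: crs_orth; apply: orth.
have d0 u v : u \in t -> v \in t -> u != v -> d u v != 0.
  move=> hu hv nuv; apply/eqP => e; apply: (nz _ _ hu hv nuv).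
  by rewrite dE // e; vec_unfold; congr (_, _, _); ring.
(* [K] will be the least valuation of a multiplier between distinct points. It divides all of them
   and is attained by one pair, and both facts are used. *)
pose P n := `[< exists u v, [/\ u \in t, v \in t, u != v & logn p `|d u v| = n] >].
have exP : exists n, P n.
  by exists (logn p `|d x y|); apply/asboolP; exists x, y.
case: (ex_minnP exP) => K /asboolP[u [v [hu hv nuv EK]]] Kmin.
have pK r s : r \in t -> s \in t -> (p%:Z ^+ K %| d r s)%Z.
  move=> hr hs; have [->|nrs] := eqVneq r s.
    have -> : d s s = 0 by rewrite /d crsvv; vec_unfold; ring.
    exact: dvdz0.
  have := Kmin (logn p `|d r s|); have -> : P (logn p `|d r s|).
    by apply/asboolP; exists r, s.
  move=> /(_ isT) h; apply: (dvdz_trans (dvdz_exp2l _ h)).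
  by rewrite dvdzE abszX /= pfactor_dvdnn.
exists w, K; split=> //.
- rewrite -EK -(pfactor_dvdn _ p_pr) ?absz_gt0 ?d0 //.
  have /and3P[h1 h2 h3] := hc _ _ hu hv.
  have : (p%:Z ^+ k %| d u v)%Z.
    by rewrite /d /dot; rewrite !rpredD ?dvdz_mull.
  by rewrite dvdzE abszX.
- have [Km|Km] := leqP K m; last first.
    have -> : (m - K = 0)%N by apply/eqP; rewrite subn_eq0 ltnW.
    by rewrite muln0 minn0 expr0 dvd1z.
  have [pu hu' _] := pt _ hu; have [pv hv' _] := pt _ hv.
  have hB : (p%:Z ^+ minn (2 * K) m %| bf b u v)%Z.
    apply: (bf_tangent p_pr p_odd) => //.
    rewrite dE //; case/dvdzP: (pK _ _ hu hv) => q ->; apply/dvdvP.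
    by exists (comb q 0 w 0); vec_unfold; congr (_, _, _); ring.
  have [q Eq] := dvdzP (pK _ _ hu hv).
  have uq : ~~ (p %| q)%Z.
    apply/negP => /dvdzP[q' Eq']; have := pfactor_dvdn K.+1 p_pr (_ : (0 < `|d u v|)%N).
    rewrite absz_gt0 d0 // EK ltnn => /(_ isT) /negbT/negP; apply.
    rewrite Eq Eq' -mulrA -exprS abszM abszX dvdn_mull //.
  have L := lagrange b u v; rewrite dE // in L.
  have {}L : p%:Z ^+ (2 * K) * (q ^+ 2 * qf (dual b) w) =
    qf b u * qf b v - bf b u v ^+ 2.
    by rewrite -L Eq mulnC exprM; vec_unfold; ring.
  have u2 : ~~ (p %| q ^+ 2)%Z by rewrite expr2 (punit_mul p_pr).
  apply: (gauss_pX p_pr u2).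
  have p0 : p%:Z ^+ (2 * K) != 0 by rewrite expf_neq0 // eqz_nat -lt0n prime_gt0.
  rewrite -(dvdz_mul2l p0) L -exprD.
  rewrite (tangent_exponent Km).
  have hm : (p%:Z ^+ minn (2 * K) m %| p%:Z ^+ m)%Z by apply: dvdz_exp2l; rewrite geq_minr.
  rewrite mulnC exprM expr2 rpredB // ?expr2 ?dvdz_mul //; by apply: dvdz_trans hm _.
(* For two coordinates f, g, the minor of two points is the multiplier times the third coordinate of
   [w], so its size is at least p ^ K times that coordinate. This is the separation that [slopes]
   requires. *)
- have aux (f g : vec -> int) (c : int) :
    (forall r, boxed Y r -> (`|f r| <= Y)%N) -> (forall r, boxed Y r -> (`|g r| <= Y)%N) ->
    (forall r s, r \in t -> s \in t -> f r * g s - g r * f s = d r s * c) ->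
    (size t * (p ^ K * `|c|) <= 8 * Y ^ 2)%N.
    move=> hf hg hfg; have [->|c0] := eqVneq c 0; first by rewrite !muln0.
    apply: (slopes (f := f) (g := g)) => //.
    - by rewrite muln_gt0 expn_gt0 absz_gt0 c0 andbT prime_gt0.
    - by move=> r /pt[_ _ /hf].
    - by move=> r /pt[_ _ /hg].
    - move=> r s hr hs nrs; rewrite hfg // abszM leq_mul2r; apply/orP; right.
      apply: dvdn_leq; first by rewrite absz_gt0 d0.
      by have := pK _ _ hr hs; rewrite dvdzE abszX.
  split.
  + apply: (aux (fun r => r.1.2) (fun r => r.2)) => [r /and3P[]|r /and3P[]|r s hr hs] //.
    by have := dE _ _ hr hs; rewrite /crs /comb => -[-> _ _]; rewrite mul0r addr0.
  + apply: (aux (fun r => r.2) (fun r => r.1.1)) => [r /and3P[]|r /and3P[]|r s hr hs] //.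
    by have := dE _ _ hr hs; rewrite /crs /comb => -[_ -> _]; rewrite mul0r addr0.
  + apply: (aux (fun r => r.1.1) (fun r => r.1.2)) => [r /and3P[]|r /and3P[]|r s hr hs] //.
    by have := dE _ _ hr hs; rewrite /crs /comb => -[_ _ ->]; rewrite mul0r addr0.
Qed.
End RichClass.

(** * Residue classes on the conic modulo p ^ k *)

Definition rotv (y : vec) : vec := (y.1.2, y.2, y.1.1).

Lemma qf_rot b y : qf (rotv b) (rotv y) = qf b y.
Proof. by rewrite /rotv; vec_unfold; ring. Qed.

Lemma vol_rot b : vol (rotv b) = vol b.
Proof. by rewrite /rotv; vec_unfold; ring. Qed.

Lemma dvdv_crs_rot d y z : dvdv d (crs (rotv y) (rotv z)) = dvdv d (crs y z).
Proof. by rewrite /dvdv /rotv /crs /=; rewrite andbA andbC. Qed.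

Definition zseq (n : nat) : seq int := map Posz (iota 0 n).

Lemma size_zseq n : size (zseq n) = n.
Proof. by rewrite size_map size_iota. Qed.

Lemma mem_zseq_mod (x : int) (n : nat) : (0 < n)%N -> (x %% n)%Z \in zseq n.
Proof.
move=> n0; have n0' : n%:Z != 0 by rewrite eqz_nat -lt0n.
have := modz_ge0 x n0'; have := ltz_pmod x (n0 : 0 < n%:Z).
case: (x %% n)%Z => // a h _; apply/mapP; exists a => //.
by rewrite mem_iota /= add0n.
Qed.

Lemma size_partition (T U : eqType) (f : T -> U) (s : seq T) (L : seq U) :
  (forall y, y \in s -> f y \in L) ->
  (size s <= \sum_(l <- L) size [seq y <- s | f y == l])%N.
Proof.
elim: s => [|y s IH] h //=.
have hs z : z \in s -> f z \in L by move=> zs; apply: h; rewrite inE zs orbT.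
apply: (@leq_trans ((f y \in L) + \sum_(l <- L) size [seq z <- s | f z == l])).
  by rewrite h ?mem_head // add1n ltnS IH.
rewrite -has_pred1 has_count -[X in (X + _ <= _)%N]/(nat_of_bool _).
apply: (@leq_trans (\sum_(l <- L) (f y == l) + \sum_(l <- L) size [seq z <- s | f z == l])).
  rewrite leq_add2r; elim: (L) => [|l L' IHL] /=; first by rewrite big_nil.
  rewrite big_cons eq_sym; case: eqP => //= _; rewrite ?add0n //.
rewrite -big_split /=; apply: leq_sum => l _.
by case: eqP.
Qed.

Lemma size_fibre2 (T U : eqType) (f : T -> U) (s : seq T) :
  uniq s ->
  (forall x y z, x \in s -> y \in s -> z \in s -> f x = f y -> f y = f z ->
     [\/ x = y, y = z | z = x]) ->
  (size s <= 2 * size (undup (map f s)))%N.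
Proof.
move=> us h; apply: (leq_trans (size_partition (f := f) (L := undup (map f s)) _)).
  by move=> y ys; rewrite mem_undup map_f.
rewrite mulnC -sum1_size big_distrl /=; apply: leq_sum => u _; rewrite mul1n.
have : uniq [seq y <- s | f y == u] by rewrite filter_uniq.
have : {in [seq y <- s | f y == u], forall x, x \in s /\ f x = u}.
  by move=> x; rewrite mem_filter => /andP[/eqP].
case: [seq _ <- _ | _] => [|x [|y [|z t]]] //= H.
have [hx Ex] := H x (mem_head _ _).
have [hy Ey] : y \in s /\ f y = u by apply: H; rewrite !inE eqxx orbT.
have [hz Ez] : z \in s /\ f z = u by apply: H; rewrite !inE eqxx !orbT.
rewrite !inE !negb_or => /andP[/and3P[xy xz _] /andP[/andP[yz _] _]].
have [] := h x y z hx hy hz; rewrite ?Ex ?Ey ?Ez // => e.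
- by rewrite e eqxx in xy.
- by rewrite e eqxx in yz.
- by rewrite e eqxx in xz.
Qed.

Lemma size_box (s : seq vec) Y : uniq s -> {in s, forall y, boxed Y y} ->
  (size s <= (2 * Y + 1) ^ 3)%N.
Proof.
move=> us hs; pose I := [seq x - Y%:Z | x <- zseq (2 * Y + 1)].
have memI (x : int) : (`|x| <= Y)%N -> x \in I.
  move=> hx; apply/mapP; exists (x + Y%:Z); last by rewrite addrK.
  have : 0 <= x + Y%:Z < (2 * Y + 1)%:Z by lia.
  case: (x + _) => // a /andP[_ h]; apply/mapP; exists a => //.
  by rewrite mem_iota /= add0n.
have : (size s <= size [seq (x, z) | x <- [seq (x, y) | x <- I, y <- I], z <- I])%N.
  apply: uniq_leq_size => // -[[x y] z] /hs /and3P[/= hx hy hz].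
  by apply: allpairs_f; [apply: allpairs_f|]; apply: memI.
by rewrite !size_allpairs !size_map size_iota !expnS expn0 muln1 mulnA.
Qed.

Section ResidueClasses.
Variables (p : nat) (b : vec).
Hypotheses (p_pr : prime p) (p_odd : (2 < p)%N) (b_unit : coprimez (vol b) p).

(** The conic determines the square of the ratio of the first two coordinates from the ratio of the
    third to the first. Of the two square roots, the residue modulo [p] selects one because [p] is
    odd: a sum congruent to 2 y2 z1 is a unit. *)
Lemma ratio_class k y z : (0 < k)%N ->
  ~~ (p %| y.1.1)%Z -> ~~ (p %| y.1.2)%Z -> ~~ (p %| z.1.1)%Z ->
  (p %| y.1.1 - z.1.1)%Z -> (p %| y.1.2 - z.1.2)%Z ->
  (p%:Z ^+ k %| y.2 * z.1.1 - z.2 * y.1.1)%Z ->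
  (p%:Z ^+ k %| qf b y)%Z -> (p%:Z ^+ k %| qf b z)%Z -> dvdv (p%:Z ^+ k) (crs y z).
Proof.
move=> k0 uy1 uy2 uz1 h1 h2 h3 hy hz.
have ub2 : ~~ (p %| b.1.2)%Z.
  apply: contra (vol_punit p_pr b_unit) => h.
  by rewrite /vol dvdz_mulr // dvdz_mull.
have e3 : (p%:Z ^+ k %| y.1.1 * z.1.2 - y.1.2 * z.1.1)%Z.
  have us : ~~ (p %| y.1.1 * z.1.2 + y.1.2 * z.1.1)%Z.
    have : ~~ (p %| 2 * (y.1.2 * z.1.1))%Z.
      by rewrite !(punit_mul p_pr) // (punit2 p_odd).
    apply: contra => h.
    have -> : 2 * (y.1.2 * z.1.1) = (y.1.1 * z.1.2 + y.1.2 * z.1.1)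
       + (z.1.1 * (y.1.2 - z.1.2) - z.1.2 * (y.1.1 - z.1.1)) by ring.
    by rewrite rpredD // rpredB // dvdz_mull.
  apply: (gauss_pX p_pr us); apply: (gauss_pX p_pr ub2).
  have -> : b.1.2 * ((y.1.1 * z.1.2 + y.1.2 * z.1.1) * (y.1.1 * z.1.2 - y.1.2 * z.1.1))
    = y.1.1 ^+ 2 * qf b z - z.1.1 ^+ 2 * qf b y
      + b.2 * (y.2 * z.1.1 + z.2 * y.1.1) * (y.2 * z.1.1 - z.2 * y.1.1).
    by vec_unfold; ring.
  by rewrite rpredD ?rpredB // dvdz_mull.
have e2 : (p%:Z ^+ k %| y.2 * z.1.1 - y.1.1 * z.2)%Z.
  by have -> : y.2 * z.1.1 - y.1.1 * z.2 = y.2 * z.1.1 - z.2 * y.1.1 by ring.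
apply/and3P; split => //=.
apply: (gauss_pX p_pr uy1).
have -> : y.1.1 * (y.1.2 * z.2 - y.2 * z.1.2) =
   - (y.1.2 * (y.2 * z.1.1 - y.1.1 * z.2) + y.2 * (y.1.1 * z.1.2 - y.1.2 * z.1.1)) by ring.
by rewrite rpredN rpredD // dvdz_mull.
Qed.

Definition pinv k (u : int) : int := projT1 (Bezoutz u (p%:Z ^+ k)).

Lemma pinvP k u : ~~ (p %| u)%Z -> (p%:Z ^+ k %| pinv k u * u - 1)%Z.
Proof.
move=> hu; rewrite /pinv; case: Bezoutz => v [w /= E].
have : gcdz u (p%:Z ^+ k) = 1.
  by apply/eqP; have := coprime_pX p_pr k hu; rewrite coprimez_sym /coprimez.
move=> g1; apply/dvdzP; exists (- w); rewrite -[1]g1 -E; ring.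
Qed.

Lemma ratio_eq k (y1 y3 z1 z3 : int) : ~~ (p %| y1)%Z -> ~~ (p %| z1)%Z ->
  (y3 * pinv k y1 = z3 * pinv k z1 %[mod p%:Z ^+ k])%Z ->
  (p%:Z ^+ k %| y3 * z1 - z3 * y1)%Z.
Proof.
move=> /(pinvP k) hy /(pinvP k) hz /eqP; rewrite eqz_mod_dvd => h.
have -> : y3 * z1 - z3 * y1 = (y3 * pinv k y1 - z3 * pinv k z1) * (y1 * z1)
   - (pinv k y1 * y1 - 1) * (y3 * z1) + (pinv k z1 * z1 - 1) * (z3 * y1) by ring.
by rewrite rpredD ?rpredB // dvdz_mulr.
Qed.

(** A class is determined by residues modulo [p] and a single ratio modulo p ^ k, which gives p ^ (k
    + 3) labels rather than about p ^ (2 k). Which ratio is recorded depends on the residues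
    only. *)
Definition label k (y : vec) : vec * int :=
  ((y.1.1 %% p)%Z, (y.1.2 %% p)%Z, (y.2 %% p)%Z,
   if ~~ (p %| y.1.1)%Z && ~~ (p %| y.1.2)%Z then
     (y.2 * pinv k y.1.1 %% (p%:Z ^+ k))%Z
   else if ~~ (p %| y.1.2)%Z && ~~ (p %| y.2)%Z then
     (y.1.1 * pinv k y.1.2 %% (p%:Z ^+ k))%Z
   else (y.1.2 * pinv k y.2 %% (p%:Z ^+ k))%Z).

(** If two coordinates were divisible by [p], the equation would force the third. *)
Lemma two_units y : pprim p y -> (p %| qf b y)%Z ->
  [|| ~~ (p %| y.1.1)%Z && ~~ (p %| y.1.2)%Z, ~~ (p %| y.1.2)%Z && ~~ (p %| y.2)%Z
    | ~~ (p %| y.2)%Z && ~~ (p %| y.1.1)%Z].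
Proof.
move=> py hy; have imp b1 b2 b3 (a c d : int) : ~~ (p %| b1 * b2 * b3)%Z ->
   (p %| b1 * a ^+ 2 + b2 * c ^+ 2 + b3 * d ^+ 2)%Z ->
   (p %| a)%Z -> (p %| c)%Z -> (p %| d)%Z.
  move=> ub h ha hc.
  have ub3 : ~~ (p %| b3)%Z by apply: contra ub => ?; rewrite dvdz_mull.
  have : (p %| b3 * d ^+ 2)%Z.
    have -> : b3 * d ^+ 2 = (b1 * a ^+ 2 + b2 * c ^+ 2 + b3 * d ^+ 2)
       - (b1 * a * a) - (b2 * c * c) by ring.
    by rewrite !rpredB // dvdz_mull.
  by move/(gauss_p p_pr ub3); rewrite !dvdzE abszX /= Euclid_dvdX // andbT.
move: py; rewrite /pprim /dvdv.
have v1 := vol_punit p_pr b_unit.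
have v2 : ~~ (p %| b.1.2 * b.2 * b.1.1)%Z.
  by have -> : b.1.2 * b.2 * b.1.1 = vol b by rewrite /vol; ring.
have v3 : ~~ (p %| b.2 * b.1.1 * b.1.2)%Z.
  by have -> : b.2 * b.1.1 * b.1.2 = vol b by rewrite /vol; ring.
have i1 := imp _ _ _ y.1.1 y.1.2 y.2 v1.
have i2 := imp _ _ _ y.1.2 y.2 y.1.1 v2.
have i3 := imp _ _ _ y.2 y.1.1 y.1.2 v3.
have {}i1 : (p %| y.1.1)%Z -> (p %| y.1.2)%Z -> (p %| y.2)%Z.
  apply: i1; have -> // : b.1.1 * y.1.1 ^+ 2 + b.1.2 * y.1.2 ^+ 2 + b.2 * y.2 ^+ 2 = qf b y.
  by vec_unfold; ring.
have {}i2 : (p %| y.1.2)%Z -> (p %| y.2)%Z -> (p %| y.1.1)%Z.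
  apply: i2; have -> // : b.1.2 * y.1.2 ^+ 2 + b.2 * y.2 ^+ 2 + b.1.1 * y.1.1 ^+ 2 = qf b y.
  by vec_unfold; ring.
have {}i3 : (p %| y.2)%Z -> (p %| y.1.1)%Z -> (p %| y.1.2)%Z.
  apply: i3; have -> // : b.2 * y.2 ^+ 2 + b.1.1 * y.1.1 ^+ 2 + b.1.2 * y.1.2 ^+ 2 = qf b y.
  by vec_unfold; ring.
case: (p %| y.1.1)%Z i1 i2 i3; case: (p %| y.1.2)%Z; case: (p %| y.2)%Z => //= i1 i2 i3 _.
- by have := i1 isT isT.
- by have := i3 isT isT.
- by have := i2 isT isT.
Qed.
End ResidueClasses.

Lemma eq_mod_dvdz (d x y : int) : (x = y %[mod d])%Z -> (d %| x)%Z = (d %| y)%Z.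
Proof. by move=> e; apply/dvdz_mod0P/dvdz_mod0P; rewrite e. Qed.

Lemma label_class p b k m Y y z : prime p -> (2 < p)%N -> coprimez (vol b) p ->
  (0 < k)%N -> (k <= m)%N ->
  conic_pt p b m Y y -> conic_pt p b m Y z -> label p k y = label p k z ->
  dvdv (p%:Z ^+ k) (crs y z).
Proof.
move=> p_pr p_odd b_unit k0 km /and3P[py hy _] /and3P[pz hz _].
have p0 : p%:Z ^+ k != 0 by rewrite expf_neq0 // eqz_nat -lt0n prime_gt0.
have pkm : (p%:Z ^+ k %| p%:Z ^+ m)%Z by apply: dvdz_exp2l.
have {}hy := dvdz_trans pkm hy; have {}hz := dvdz_trans pkm hz.
have pk : (p %| p%:Z ^+ k)%Z by apply: dvdz_exp.
have hy' := two_units p_pr b_unit py (dvdz_trans pk hy).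
have hz' := two_units p_pr b_unit pz (dvdz_trans pk hz).
rewrite /label => -[e1 e2 e3].
have d1 : (p %| y.1.1)%Z = (p %| z.1.1)%Z by exact: eq_mod_dvdz.
have d2 : (p %| y.1.2)%Z = (p %| z.1.2)%Z by exact: eq_mod_dvdz.
have d3 : (p %| y.2)%Z = (p %| z.2)%Z by exact: eq_mod_dvdz.
move/eqP: e1; move/eqP: e2; move/eqP: e3; rewrite !eqz_mod_dvd => f3 f2 f1.
move: hy' hz'; rewrite d1 d2 d3.
case: ifP => [/andP[u1 u2] _ _ /(ratio_eq p_pr)|h /=].
  move=> h; apply: (ratio_class p_pr p_odd b_unit k0) => //; rewrite ?d1 ?d2 //.
  by apply: h; rewrite ?d1.
case: ifP => [/andP[u2 u3] _ _ /(ratio_eq p_pr)|h' /= /andP[u3 u1] _ /(ratio_eq p_pr)].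
  move=> h''; rewrite -dvdv_crs_rot.
  have vr : coprimez (vol (rotv b)) p by rewrite vol_rot.
  apply: (ratio_class p_pr p_odd vr k0) => //; rewrite ?qf_rot //= ?d2 ?d3 //.
  by apply: h''; rewrite ?d2.
move=> h''; rewrite -dvdv_crs_rot -dvdv_crs_rot.
have vr : coprimez (vol (rotv (rotv b))) p by rewrite !vol_rot.
apply: (ratio_class p_pr p_odd vr k0) => //; rewrite ?qf_rot //= ?d1 ?d3 //.
by apply: h''; rewrite ?d3.
Qed.

Definition labels p k : seq (vec * int) :=
  [seq (y, z) | y <- [seq (x, z) | x <- [seq (x, y) | x <- zseq p, y <- zseq p],
                                    z <- zseq p], z <- zseq (p ^ k)].

Lemma size_labels p k : size (labels p k) = (p ^ (k + 3))%N.
Proof.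
by rewrite !size_allpairs !size_zseq addnC expnD !expnS expn0 muln1 !mulnA.
Qed.

Lemma label_in p k y : (0 < p)%N -> label p k y \in labels p k.
Proof.
move=> p0; have Z0 : (0 < p ^ k)%N by rewrite expn_gt0 p0.
have E : p%:Z ^+ k = (p ^ k)%N by rewrite -[RHS]natz natrX natz.
apply: allpairs_f.
  by apply: allpairs_f; [apply: allpairs_f|]; apply: mem_zseq_mod.
by rewrite /label E; case: ifP => _; [|case: ifP => _]; apply: mem_zseq_mod.
Qed.

Lemma dvdv_crsC d y z : dvdv d (crs y z) = dvdv d (crs z y).
Proof.
have imp u v : dvdv d (crs u v) -> dvdv d (crs v u).
  move=> /dvdvP[w E]; apply/dvdvP; exists (comb (- 1) 0 w 0).
  by rewrite crsC E; vec_unfold; congr (_, _, _); ring.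
by apply/idP/idP; apply: imp.
Qed.

(** A coordinate of [z] prime to [p], times y x w, is a combination of the two given cross products
    and of the determinant of the three vectors. *)
Lemma dvdv_crs_trans p k y z w : prime p -> pprim p z ->
  dvdv (p%:Z ^+ k) (crs y z) -> dvdv (p%:Z ^+ k) (crs z w) ->
  dvdv (p%:Z ^+ k) (crs y w).
Proof.
move=> p_pr pz h1 h2.
have det : (p%:Z ^+ k %| dot y (crs z w))%Z.
  by case/dvdvP: h2 => v ->; apply/dvdzP; exists (dot y v); vec_unfold; ring.
case/dvdzP: det => q Hq; case/dvdvP: h1 => u [u1 u2 u3]; case/dvdvP: h2 => v [v1 v2 v3].
have key (f : vec -> int) (g : vec) : (forall x, f x = dot g x) ->
    dvdv (p%:Z ^+ k) (comb (f z) 0 (crs y w) 0).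
  move=> fE; have -> : comb (f z) 0 (crs y w) 0 =
    comb 1 (- dot y (crs z w)) (comb (f y) (f w) (crs z w) (crs y z)) g.
    by rewrite !fE; vec_unfold; congr (_, _, _); ring.
  rewrite Hq; have -> : crs z w = comb (p%:Z ^+ k) 0 v 0 by rewrite /crs v1 v2 v3.
  have -> : crs y z = comb (p%:Z ^+ k) 0 u 0 by rewrite /crs u1 u2 u3.
  apply/dvdvP; exists (comb 1 (- q) (comb (f y) (f w) v u) g).
  by vec_unfold; congr (_, _, _); ring.
move: pz; rewrite /pprim /dvdv !negb_and => /or3P[] uz.
- have : dvdv (p%:Z ^+ k) (comb z.1.1 0 (crs y w) 0).
    by apply: (key (fun x => x.1.1) (1, 0, 0)) => x; rewrite /dot /=; ring.
  by move=> /and3P[]; rewrite /= ?mul0r ?addr0 => *; apply/and3P; split;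
    apply: (gauss_pX p_pr uz).
- have : dvdv (p%:Z ^+ k) (comb z.1.2 0 (crs y w) 0).
    by apply: (key (fun x => x.1.2) (0, 1, 0)) => x; rewrite /dot /=; ring.
  by move=> /and3P[]; rewrite /= ?mul0r ?addr0 => *; apply/and3P; split;
    apply: (gauss_pX p_pr uz).
- have : dvdv (p%:Z ^+ k) (comb z.2 0 (crs y w) 0).
    by apply: (key (fun x => x.2) (0, 0, 1)) => x; rewrite /dot /=; ring.
  by move=> /and3P[]; rewrite /= ?mul0r ?addr0 => *; apply/and3P; split;
    apply: (gauss_pX p_pr uz).
Qed.

(** [L] lists representatives of the classes with at least two points, [T] their numbers of points,
    [W] the normals of their lines and [K] the exponents from [rich_class]. All other classes are
    covered by p ^ (k + 3). The more points a class has, the smaller its normal, and a normal is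
    shared by at most two classes. *)
Lemma rich_lines p b m k Y (s : seq vec) : prime p -> (2 < p)%N ->
  coprimez (vol b) p -> (0 < k)%N -> (2 * k <= m)%N -> (6 * Y ^ 3 < p ^ (3 * k))%N ->
  uniq s -> {in s, forall y, conic_pt p b m Y y} -> ncol s ->
  exists (L : seq vec) (T K : vec -> nat) (W : vec -> vec),
  [/\ uniq L, (size s <= p ^ (k + 3) + \sum_(l <- L) T l)%N,
    {in L, forall l, [/\ (0 < T l)%N, normal (W l), (k <= K l)%N &
      (p%:Z ^+ minn (2 * K l) (2 * (m - K l)) %| qf (dual b) (W l))%Z]},
    {in L, forall l, boxed ((8 * Y ^ 2) %/ (T l * p ^ K l)) (W l)} &
    (forall l1 l2 l3, l1 \in L -> l2 \in L -> l3 \in L -> W l1 = W l2 -> W l2 = W l3 ->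
      [\/ l1 = l2, l2 = l3 | l3 = l1])].
Proof.
move=> p_pr p_odd b_unit k0 hk Yp us hs nc.
have p0 := prime_gt0 p_pr.
(* The first point of [s] in the class of [y]; [y] itself is in the list, so the default value is
   never returned. *)
pose can y := nth y s (find (fun z => dvdv (p%:Z ^+ k) (crs y z)) s).
have ps y : y \in s -> pprim p y by move=> /hs /and3P[].
have canP y : y \in s -> can y \in s /\ dvdv (p%:Z ^+ k) (crs y (can y)).
  move=> ys; have h : has (fun z => dvdv (p%:Z ^+ k) (crs y z)) s.
    by apply/hasP; exists y => //; rewrite crsvv; apply/dvdvP; exists 0;
      vec_unfold; congr (_, _, _); ring.
  by split; [rewrite mem_nth // -has_find | apply: (nth_find y h)].
have can_eq y z : y \in s -> z \in s -> dvdv (p%:Z ^+ k) (crs y z) -> can y = can z.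
  move=> ys zs yz; rewrite /can.
  have -> : find (fun u => dvdv (p%:Z ^+ k) (crs y u)) s =
            find (fun u => dvdv (p%:Z ^+ k) (crs z u)) s.
    apply: eq_in_find => u us' /=; apply/idP/idP => h.
      by apply: (dvdv_crs_trans p_pr (ps _ ys) _ h); rewrite dvdv_crsC.
    exact: (dvdv_crs_trans p_pr (ps _ zs) yz h).
  apply: set_nth_default; rewrite -has_find; apply/hasP; exists z => //.
  by rewrite crsvv; apply/dvdvP; exists 0; vec_unfold; congr (_, _, _); ring.
pose L0 := undup (map can s).
pose t l := [seq y <- s | can y == l].
have km : (k <= m)%N by apply: leq_trans hk; rewrite leq_pmull.
have ut l : uniq (t l) by rewrite filter_uniq.
have ts l y : y \in t l -> y \in s by rewrite mem_filter => /andP[].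
have tc l : {in t l &, forall y z, dvdv (p%:Z ^+ k) (crs y z)}.
  move=> y z; rewrite !mem_filter => /andP[/eqP ey ys] /andP[/eqP ez zs].
  have [cs h] := canP _ ys; have [_ h'] := canP _ zs.
  apply: (dvdv_crs_trans p_pr (ps _ cs) h).
  by rewrite dvdv_crsC ey -ez.
have L0s l : l \in L0 -> l \in s /\ can l = l.
  rewrite mem_undup => /mapP[y ys ->]; have [h1 h2] := canP _ ys; split=> //.
  by apply: can_eq => //; rewrite dvdv_crsC.
have sL0 : (size L0 <= p ^ (k + 3))%N.
  rewrite -(size_labels p k) -(size_map (label p k)); apply: uniq_leq_size.
    rewrite map_inj_in_uniq ?undup_uniq // => x y /L0s[xs ex] /L0s[ys ey] e.
    rewrite -ex -ey; apply: can_eq => //.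
    exact: (label_class p_pr p_odd b_unit k0 km (hs _ xs) (hs _ ys)).
  by move=> _ /mapP[y _ ->]; apply: label_in.
(* Classes with at most one point get a dummy pair, so that a choice function on all of [vec]
   exists. *)
have ex l : exists wK, (1 < size (t l))%N ->
   [/\ normal wK.1, (k <= wK.2)%N, {in t l, forall y, dot wK.1 y = 0},
    (p%:Z ^+ minn (2 * wK.2) (2 * (m - wK.2)) %| qf (dual b) wK.1)%Z &
    [/\ (size (t l) * (p ^ wK.2 * `|wK.1.1.1|) <= 8 * Y ^ 2)%N,
        (size (t l) * (p ^ wK.2 * `|wK.1.1.2|) <= 8 * Y ^ 2)%N &
        (size (t l) * (p ^ wK.2 * `|wK.1.2|) <= 8 * Y ^ 2)%N]].
  have [s1|s1] := leqP (size (t l)) 1; first by exists (0, 0%N).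
  have [||w [K h]] := rich_class p_pr p_odd b_unit (ut l) s1 hk Yp _ _ (tc l).
  - by move=> y /ts /hs.
  - by move=> y z /ts ys /ts zs; apply: nc.
  by exists (w, K).
have [WK hWK] := choice ex.
exists [seq l <- L0 | (1 < size (t l))%N].
exists (fun l => size (t l)), (fun l => (WK l).2), (fun l => (WK l).1).
have inL l : l \in [seq l <- L0 | (1 < size (t l))%N] ->
    (1 < size (t l))%N /\ l \in L0 by rewrite mem_filter => /andP[].
split.
- by rewrite filter_uniq // undup_uniq.
- apply: (leq_trans (size_partition (f := can) (L := L0) _)).
    by move=> y ys; rewrite mem_undup map_f.
  rewrite big_filter (bigID (fun l => 1 < size (t l))%N) /= addnC leq_add2r.
  apply: (@leq_trans (\sum_(l <- L0) 1)); last by rewrite sum1_size.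
  rewrite [X in (_ <= X)%N](bigID (fun l => ~~ (1 < size (t l)))%N) /=.
  by apply: leq_trans (leq_addr _ _); apply: leq_sum => l; rewrite -leqNgt.
- move=> l lL; have [s1 _] := inL _ lL; have [h1 h2 _ h3 _] := hWK _ s1.
  by split=> //; apply: ltnW.
- move=> l lL; have [s1 _] := inL _ lL; have [_ _ _ _ [h1 h2 h3]] := hWK _ s1.
  have d0 : (0 < size (t l) * p ^ (WK l).2)%N by rewrite muln_gt0 expn_gt0 p0 (ltnW s1).
  by apply/and3P; split; rewrite leq_divRL // mulnC -mulnA.
move=> l1 l2 l3 /inL[s1 /L0s[i1 e1]] /inL[s2 /L0s[i2 e2]] /inL[s3 /L0s[i3 e3]] e12 e23.
have [[um _] _ o1 _ _] := hWK _ s1; have [_ _ o2 _ _] := hWK _ s2.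
have [_ _ o3 _ _] := hWK _ s3.
rewrite -e23 -e12 in o3; rewrite -e12 in o2.
have lt l : l \in s -> can l = l -> l \in t l by move=> ls e; rewrite mem_filter e eqxx.
have /and3P[a1 c1 _] := hs _ i1; have /and3P[a2 c2 _] := hs _ i2.
have /and3P[a3 c3 _] := hs _ i3.
have [h|h|h] := line_two_classes p_pr p_odd b_unit um hk a1 a2 a3 c1 c2 c3
  (o1 _ (lt _ i1 e1)) (o2 _ (lt _ i2 e2)) (o3 _ (lt _ i3 e3)).
- by apply: Or31; rewrite -e1 -e2; apply: can_eq.
- by apply: Or32; rewrite -e2 -e3; apply: can_eq.
- by apply: Or33; rewrite -e3 -e1; apply: can_eq.
Qed.

(** * Counting points of bounded height up to proportionality *)

Lemma boxed_leq Y Z y : (Y <= Z)%N -> boxed Y y -> boxed Z y.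
Proof.
by move=> h /and3P[h1 h2 h3]; apply/and3P; split; apply: leq_trans h.
Qed.

Lemma normal_boxed Z w : normal w -> boxed Z w -> (0 < Z)%N.
Proof. by move=> [_]; rewrite /lexpos /boxed; lia. Qed.

Lemma normal_ncol (s : seq vec) : {in s, forall w, normal w} -> ncol s.
Proof. by move=> h v w vs ws; apply: normal_inj; apply: h. Qed.

Lemma sum_partition (T U : eqType) (f : T -> U) (F : T -> nat) (s : seq T) (L : seq U) :
  (forall y, y \in s -> f y \in L) ->
  (\sum_(y <- s) F y <= \sum_(l <- L) \sum_(y <- s | f y == l) F y)%N.
Proof.
move=> h; under [X in (_ <= X)%N]eq_bigr do rewrite big_mkcond /=; rewrite exchange_big /=.
rewrite big_seq [X in (_ <= X)%N]big_seq; apply: leq_sum => y ys.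
by rewrite -big_mkcond /= (big_rem (f y)) ?h //= eqxx leq_addr.
Qed.

Lemma leq_pow_cancel e a b : (0 < e)%N -> (a ^ e <= b ^ e)%N -> (a <= b)%N.
Proof. by move=> e0; rewrite leq_exp2r. Qed.

Lemma leq_pow e a b : (a <= b)%N -> (a ^ e <= b ^ e)%N.
Proof. by case: e => // e h; rewrite leq_exp2r. Qed.

(** The count of order Y ^ (8/5). With X about Y ^ 2 / p ^ k, a rich class has at most X points and
    its normal has height at most X. The rich classes therefore contribute O(X ^ 4), which is O(p ^
    k) exactly when Y ^ 8 is O(p ^ (5 k)). *)
Lemma conic_count_crude p : prime p -> (2 < p)%N -> exists C, forall b m k Y (s : seq vec),
  coprimez (vol b) p -> (2 * k <= m)%N -> (Y ^ 8 <= p ^ (5 * k))%N ->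
  uniq s -> {in s, forall y, conic_pt p b m Y y} -> ncol s -> (size s <= C * p ^ k)%N.
Proof.
move=> p_pr p_odd; have p1 := prime_gt1 p_pr; have p0 := prime_gt0 p_pr.
exists (p ^ 3 + (2 * p + 1) ^ 3 + 54 * 8 ^ 4)%N => b m k Y s b_unit hk Yp us hs nc.
have pk0 j : (0 < p ^ j)%N by rewrite expn_gt0 p0.
(* For k <= 1 the height is at most [p] and the whole box is bounded by a constant. For k >= 2 the
   factor 6 in the determinant bound is absorbed, since 6 ^ 8 < 9 ^ 8 <= p ^ (9 k). *)
have [k1|k2] := leqP k 1.
  have Yle : (Y <= p)%N.
    apply: (@leq_pow_cancel 8) => //; apply: (leq_trans Yp).
    by rewrite leq_exp2l // (leq_trans (leq_mul (leqnn 5) k1)).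
  apply: (@leq_trans ((2 * p + 1) ^ 3)).
    apply: leq_trans (_ : (2 * Y + 1) ^ 3 <= _)%N.
      by apply: size_box => // y /hs /and3P[].
    by apply: leq_pow; rewrite leq_add2r leq_mul2l Yle.
  rewrite -{1}[((2 * p + 1) ^ 3)%N]muln1 leq_mul //.
  by rewrite -addnA addnCA leq_addr.
have Y3 : (6 * Y ^ 3 < p ^ (3 * k))%N.
  rewrite -(ltn_exp2r _ _ (isT : 0 < 8)%N) expnMn.
  have -> : ((Y ^ 3) ^ 8 = (Y ^ 8) ^ 3)%N by rewrite -!expnM.
  apply: (@leq_ltn_trans (6 ^ 8 * (p ^ (5 * k)) ^ 3)%N).
    by rewrite leq_mul2l leq_pow ?orbT.
  rewrite -!expnM mulnC.
  have -> : (3 * k * 8 = 5 * k * 3 + 9 * k)%N by lia.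
  rewrite expnD ltn_pmul2l //.
  apply: (@leq_trans ((p ^ 2) ^ 8)%N); last by rewrite -expnM leq_exp2l //; lia.
  rewrite ltn_exp2r //; apply: (@leq_trans (3 ^ 2)%N) => //.
  by rewrite leq_exp2r.
have [L [T [K [W [uL szs hL hW h3]]]]] :=
  rich_lines p_pr p_odd b_unit (ltnW k2) hk Y3 us hs nc.
set X := ((8 * Y ^ 2) %/ p ^ k)%N.
have TX l : l \in L -> (T l <= X)%N /\ boxed X (W l).
  move=> lL; have [T0 nW kK _] := hL _ lL; have bW := hW _ lL.
  have d0 : (0 < T l * p ^ K l)%N by rewrite muln_gt0 T0 pk0.
  have := normal_boxed nW bW; rewrite divn_gt0 // => h; split.
    rewrite leq_divRL //; apply: leq_trans h; rewrite leq_mul2l leq_exp2l // kK.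
    by rewrite orbT.
  apply: boxed_leq bW; apply: leq_div2l; first exact: pk0.
  by rewrite -[X in (X <= _)%N]mul1n leq_mul // leq_exp2l.
have sumT : (\sum_(l <- L) T l <= 54 * X ^ 4)%N.
  case: L uL {szs} hL hW h3 TX => [|l0 L] uL hL hW h3 TX; first by rewrite big_nil.
  have X0 : (0 < X)%N.
    have [T0 _ _ _] := hL l0 (mem_head _ _); apply: leq_trans T0 _.
    by case: (TX l0 (mem_head _ _)).
  have szL : (size (l0 :: L) <= 2 * (2 * X + 1) ^ 3)%N.
    apply: leq_trans (size_fibre2 (f := W) uL h3) _; rewrite leq_pmul2l //.
    apply: size_box; first exact: undup_uniq.
    by move=> w; rewrite mem_undup => /mapP[l lL ->]; case: (TX _ lL).
  apply: (@leq_trans (\sum_(l <- l0 :: L) X)).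
    by rewrite big_seq [X in (_ <= X)%N]big_seq; apply: leq_sum => l /TX[].
  rewrite big_const_seq count_predT iter_addn_0 mulnC.
  apply: leq_trans (leq_mul szL (leqnn X)) _.
  have h : (2 * X + 1 <= 3 * X)%N by lia.
  have -> : (54 * X ^ 4 = 2 * (3 * X) ^ 3 * X)%N.
    by rewrite expnMn [(X ^ 4)%N]expnS; move: (X ^ 3)%N => Z; lia.
  by rewrite leq_mul2r leq_mul2l /= leq_pow ?orbT.
have X4 : (X ^ 4 <= 8 ^ 4 * p ^ k)%N.
  have hX : (X * p ^ k <= 8 * Y ^ 2)%N by rewrite leq_trunc_div.
  have := leq_pow 4 hX; rewrite expnMn [X in (_ <= X)%N]expnMn -!expnM => h.
  rewrite -(leq_pmul2r (pk0 (k * 4)%N)); apply: (leq_trans h).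
  have -> : (8 ^ 4 * Y ^ (2 * 4) = 8 ^ 4 * Y ^ 8)%N by [].
  rewrite -mulnA leq_mul2l (leq_trans Yp) ?orbT //.
  by rewrite -[X in (_ <= X)%N]expnD leq_exp2l //; lia.
apply: (leq_trans szs).
apply: (@leq_trans (p ^ 3 * p ^ k + 54 * 8 ^ 4 * p ^ k)%N).
  by rewrite [(k + 3)%N]addnC expnD leq_add2l; apply: (leq_trans sumT);
    rewrite -mulnA leq_mul2l; apply/orP; right; exact: X4.
rewrite -mulnDl leq_mul2r; apply/orP; right.
by rewrite leq_add2r leq_addr.
Qed.

(** The bootstrapped count, of order Y ^ (5/4). The classes with exponent K and about 2 ^ i points
    have normals of height at most about B = Y ^ 2 / (2 ^ i p ^ K) on the dual conic, and the crude
    count leaves about B ^ (8/5) of them. Their total 2 ^ i B ^ (8/5) is O(p ^ k) once Y ^ 16 <= p ^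
    (13 k). The hypothesis with exponent 4/5 instead of 13/16 leaves room for rounding in the
    modulus condition. The pairs (K, i) number O(k ^ 2), whence the factor [k.+1 ^ 2]. *)
Lemma conic_count p : prime p -> (2 < p)%N -> exists C, forall b m k Y (s : seq vec),
  coprimez (vol b) p -> (2 * k <= m)%N -> (Y ^ 5 <= p ^ (4 * k))%N ->
  uniq s -> {in s, forall y, conic_pt p b m Y y} -> ncol s ->
  (size s <= C * k.+1 ^ 2 * p ^ k)%N.
Proof.
move=> p_pr p_odd; have p1 := prime_gt1 p_pr; have p0 := prime_gt0 p_pr.
have [CA hCA] := conic_count_crude p_pr p_odd.
exists ((2 * p ^ 85 + 1) ^ 3 + (p ^ 3 + 3 * (3 * p) * (4 * CA * (8 ^ 2 * p))))%N.
move=> b m k Y s b_unit hk Yp us hs nc.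
have pk0 j : (0 < p ^ j)%N by rewrite expn_gt0 p0.
have p8 : (8 <= p ^ 2)%N by apply: (@leq_trans (3 ^ 2)%N) => //; rewrite leq_exp2r.
(* The rounded exponent [k2] below satisfies 25 k2 <= 105 + 24 k, and must not exceed k. Small k are
   covered by the box: 4 * 106 <= 5 * 85. *)
have [k1|k1] := leqP k 106.
  have Yle : (Y <= p ^ 85)%N.
    apply: (@leq_pow_cancel 5) => //; apply: (leq_trans Yp).
    by rewrite -expnM leq_exp2l //; move: k1; clear; lia.
  apply: (@leq_trans ((2 * p ^ 85 + 1) ^ 3)).
    apply: leq_trans (_ : (2 * Y + 1) ^ 3 <= _)%N.
      by apply: size_box => // y /hs /and3P[].
    by apply: leq_pow; rewrite leq_add2r leq_pmul2l.
  rewrite -mulnA mulnDl; apply: leq_trans (leq_addr _ _).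
  by rewrite -{1}[((2 * p ^ 85 + 1) ^ 3)%N]muln1 leq_mul // muln_gt0 expn_gt0 pk0.
have Y80 : (Y ^ 80 <= p ^ (64 * k))%N.
  have := leq_pow 16 Yp; rewrite -!expnM.
  by have -> : (4 * k * 16 = 64 * k)%N by clear; lia.
have Yk : (Y <= p ^ k)%N.
  apply: (@leq_pow_cancel 5) => //; apply: (leq_trans Yp); rewrite -expnM leq_exp2l //.
  by rewrite mulnC leq_mul2l orbT.
have Y16 : (Y ^ 16 <= p ^ (13 * k))%N.
  apply: (@leq_pow_cancel 5) => //; rewrite -!expnM; apply: (leq_trans Y80).
  by rewrite leq_exp2l //; clear; lia.
have Y3 : (6 * Y ^ 3 < p ^ (3 * k))%N.
  rewrite -(ltn_exp2r _ _ (isT : 0 < 5)%N) expnMn.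
  have -> : ((Y ^ 3) ^ 5 = (Y ^ 5) ^ 3)%N by rewrite -!expnM.
  apply: (@leq_ltn_trans ((p ^ 2) ^ 5 * (p ^ (4 * k)) ^ 3)%N).
    rewrite leq_mul // leq_pow //; exact: leq_trans p8.
  rewrite -!expnM -expnD ltn_exp2l //; move: k1; clear; lia.
have k0 : (0 < k)%N by apply: leq_trans k1.
have [L [T [K [W [uL szs hL hW h3]]]]] :=
  rich_lines p_pr p_odd b_unit k0 hk Y3 us hs nc.
have hB l : l \in L -> (T l * p ^ K l <= 8 * Y ^ 2)%N.
  move=> lL; have [T0 nW _ _] := hL _ lL.
  by have := normal_boxed nW (hW _ lL); rewrite divn_gt0 ?muln_gt0 ?T0 ?pk0.
have YB : (8 * Y ^ 2 <= p ^ (2 * k + 2))%N.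
  rewrite addnC expnD leq_mul // mulnC expnM; exact: leq_pow.
(* Grouping by the exponent and the dyadic size of the class. *)
pose key l := (K l, trunc_log 2 (T l)).
pose G := [seq (x, y) | x <- iota 0 (2 * k + 3), y <- iota 0 (p * (2 * k + 2) + 1)].
have keyG l : l \in L -> key l \in G.
  move=> lL; have [T0 _ _ _] := hL _ lL; have hl := leq_trans (hB _ lL) YB.
  have hK : (K l <= 2 * k + 2)%N.
    rewrite -(leq_exp2l _ _ p1); apply: leq_trans hl; exact: leq_pmull.
  have hi : (trunc_log 2 (T l) <= p * (2 * k + 2))%N.
    rewrite -(leq_exp2l _ _ (isT : 1 < 2)%N).
    apply: leq_trans (trunc_logP (isT : 1 < 2)%N T0) _.
    apply: (@leq_trans (p ^ (2 * k + 2))%N).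
      by apply: leq_trans hl; rewrite leq_pmulr.
    by rewrite expnM leq_pow // ltnW // ltn_expl.
  apply: allpairs_f; rewrite mem_iota /= add0n.
    by move: hK; clear; lia.
  by rewrite addn1 ltnS.
have group g : (\sum_(l <- L | key l == g) T l <= 4 * CA * (8 ^ 2 * p) * p ^ k)%N.
  case: g => K0 i; rewrite -big_filter.
  set L' := [seq l <- L | key l == (K0, i)].
  have L'P l : l \in L' -> [/\ l \in L, K l = K0, (2 ^ i <= T l)%N & (T l < 2 ^ i.+1)%N].
    rewrite mem_filter => /andP[/eqP[<- <-] lL]; have [T0 _ _ _] := hL _ lL.
    by split=> //; [apply: trunc_logP|apply: trunc_log_ltn].
  case EL: L' => [|l0 r]; first by rewrite big_nil.
  rewrite -EL; have l0L : l0 \in L' by rewrite EL mem_head.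
  have [l0L1 K00 Ti0 _] := L'P _ l0L.
  have [_ _ kK0 _] := hL _ l0L1; rewrite K00 in kK0.
  have d0 : (0 < 2 ^ i * p ^ K0)%N by rewrite muln_gt0 expn_gt0 pk0.
  have hi0 : (2 ^ i * p ^ K0 <= 8 * Y ^ 2)%N.
    by apply: leq_trans (hB _ l0L1); rewrite K00 leq_mul2r Ti0 orbT.
  pose B' := ((8 * Y ^ 2) %/ (2 ^ i * p ^ K0))%N.
  have hB' : (B' * (2 ^ i * p ^ K0) <= 8 * Y ^ 2)%N by rewrite leq_trunc_div.
  have WB l : l \in L' -> boxed B' (W l).
    move=> /L'P[lL EK T1 _]; apply: boxed_leq (hW _ lL); rewrite EK.
    by apply: leq_div2l => //; rewrite leq_mul2r T1 orbT.
  have exk : exists j, (B' ^ 8 <= p ^ (5 * j))%N.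
    exists (B' ^ 8)%N; apply: ltnW; apply: (leq_trans (ltn_expl _ p1)).
    by rewrite leq_exp2l // leq_pmull.
  (* The least exponent for which the crude count applies to height [B']. Minimality bounds p ^ (5
     (k2 - 1)) by [B' ^ 8], so that [k2] is optimal up to one factor [p]. *)
  have [k2 hk2 mink2] := ex_minnP exk.
  have A8 : ((8 * Y ^ 2) ^ 8 <= p ^ 16 * Y ^ 16)%N.
    rewrite expnMn leq_mul //; last by rewrite -expnM.
    by rewrite (_ : p ^ 16 = (p ^ 2) ^ 8)%N ?leq_pow // -expnM.
  (* What the crude count on the dual conic needs: its parameter fits the modulus exponent min(2 K0,
     2 (m - K0)), and points per class times number of normals stays O(p ^ k). *)
  have [h2k2 h2i] : (k2 <= minn K0 (m - K0))%N /\ (2 ^ i * p ^ k2 <= 8 ^ 2 * p * p ^ k)%N.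
    case: k2 hk2 mink2 => [|j] hk2 mink2.
      split => //; rewrite expn0 muln1.
      apply: (@leq_trans (8 * p ^ k)%N).
        rewrite -(leq_pmul2r (pk0 k)); apply: (@leq_trans (8 * Y ^ 2)%N).
          by apply: leq_trans hi0; rewrite leq_pmul2l ?expn_gt0 // leq_exp2l.
        by rewrite -mulnA leq_pmul2l // -[(p ^ k * p ^ k)%N]/((p ^ k) ^ 2)%N leq_pow.
      by rewrite leq_pmul2r // (leq_trans (_ : 8 <= 8 ^ 2)%N) // leq_pmulr.
    have {}mink2 : (p ^ (5 * j) <= B' ^ 8)%N.
      by rewrite leqNgt; apply/negP => /ltnW /mink2; rewrite ltnn.
    have key1 : (p ^ (5 * j) * (2 ^ i * p ^ K0) ^ 8 <= p ^ 16 * Y ^ 16)%N.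
      apply: leq_trans A8; apply: leq_trans (leq_pow 8 hB').
      by rewrite [X in (_ <= X)%N]expnMn leq_mul2r mink2 orbT.
    split.
      have : (p ^ (5 * (5 * j + 8 * K0)) <= p ^ (80 + 64 * k))%N.
        rewrite expnD [(5 * _)%N]mulnC expnM.
        apply: (@leq_trans ((p ^ 16 * Y ^ 16) ^ 5)%N).
          apply: leq_pow; apply: leq_trans key1; rewrite expnD leq_pmul2l //.
          by rewrite mulnC expnM leq_pow // leq_pmull // expn_gt0.
        by rewrite expnMn -!expnM leq_mul.
      by rewrite leq_exp2l //; move: kK0 k1 hk; clear; lia.
    have : (2 ^ i * p ^ j <= 8 ^ 2 * p ^ k)%N.
      apply: (@leq_pow_cancel 5) => //.
      rewrite -(leq_pmul2r (pk0 (8 * k)%N)).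
      apply: (@leq_trans ((8 * Y ^ 2) ^ 8)%N).
        apply: leq_trans (leq_pow 8 hB').
        rewrite expnMn [X in (_ <= X)%N]expnMn [X in (_ <= _ * X)%N]expnMn.
        rewrite [X in (_ <= X)%N]mulnCA -[X in (X <= _)%N]mulnA.
        apply: leq_mul; first by rewrite leq_pexp2l // expn_gt0.
        apply: leq_mul; first by rewrite -expnM mulnC.
        by rewrite mulnC expnM leq_pow // leq_exp2l.
      rewrite (expnM _ 2 4) [X in (X ^ 4)%N]expnMn expnMn [X in (_ <= X * _)%N]expnMn.
      rewrite -[X in (_ <= X)%N]mulnA; apply: leq_mul.
        by apply: leq_pexp2l.
      rewrite -!expnM -expnD; apply: (leq_trans Y16).
      by rewrite leq_exp2l //; clear; lia.
    move=> h; rewrite expnS mulnCA [(8 ^ 2 * p)%N]mulnC -[X in (_ <= X)%N]mulnA.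
    by rewrite leq_mul2l h orbT.
  have szW : (size (undup (map W L')) <= CA * p ^ k2)%N.
    apply: (hCA (dual b) (minn (2 * K0) (2 * (m - K0))) k2 B').
    - have -> : vol (dual b) = vol b ^+ 2 by vec_unfold; ring.
      exact: coprimezXl.
    - by move: h2k2; clear; lia.
    - by [].
    - exact: undup_uniq.
    - move=> w; rewrite mem_undup => /mapP[l lL ->]; have [lL' EK _ _] := L'P _ lL.
      have [_ nW _ hq] := hL _ lL'; rewrite EK in hq.
      by apply/and3P; split=> //; [apply: unimod_pprim => //; case: nW|apply: WB].
    - apply: normal_ncol => w; rewrite mem_undup => /mapP[l /L'P[lL _ _ _] ->].
      by case: (hL _ lL).
  have szL' : (size L' <= 2 * (CA * p ^ k2))%N.
    apply: leq_trans (_ : 2 * size (undup (map W L')) <= _)%N; last by rewrite leq_pmul2l.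
    apply: size_fibre2; first by rewrite filter_uniq.
    by move=> x y z /L'P[xL _ _ _] /L'P[yL _ _ _] /L'P[zL _ _ _]; apply: h3.
  apply: (@leq_trans (\sum_(l <- L') 2 ^ i.+1)%N).
    rewrite big_seq [X in (_ <= X)%N]big_seq; apply: leq_sum => l /L'P[_ _ _ h].
    exact: ltnW.
  rewrite big_const_seq count_predT iter_addn_0.
  apply: (@leq_trans (2 ^ i.+1 * (2 * (CA * p ^ k2)))%N); first by rewrite leq_mul2l szL' orbT.
  rewrite expnS; apply: (@leq_trans (4 * CA * (2 ^ i * p ^ k2))%N).
    by move: (2 ^ i)%N (p ^ k2)%N; clear=> u v; lia.
  by rewrite -[X in (_ <= X)%N]mulnA leq_mul2l h2i orbT.
apply: (leq_trans szs).
have : (\sum_(l <- L) T l <= size G * (4 * CA * (8 ^ 2 * p) * p ^ k))%N.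
  apply: (leq_trans (sum_partition T keyG)).
  apply: (@leq_trans (\sum_(g <- G) (4 * CA * (8 ^ 2 * p) * p ^ k))%N).
    by apply: leq_sum => g _; apply: group.
  by rewrite big_const_seq count_predT iter_addn_0 mulnC.
rewrite size_allpairs !size_iota => hsum.
apply: (@leq_trans (p ^ 3 * p ^ k
    + (3 * k.+1) * (3 * p * k.+1) * (4 * CA * (8 ^ 2 * p) * p ^ k))%N).
  rewrite [(k + 3)%N]addnC expnD leq_add2l; apply: (leq_trans hsum).
  apply: leq_mul => //; apply: leq_mul; first by clear; lia.
  apply: (@leq_trans (p * (2 * k + 2) + p * k.+1)%N).
    by rewrite leq_add2l muln_gt0 p0.
  by clear; lia.
move: (p ^ k)%N (pk0 k) (4 * CA * (8 ^ 2 * p))%N (p ^ 3)%N ((2 * p ^ 85 + 1) ^ 3)%N.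
clear=> q q0 c d e; have -> : ((e + (d + 3 * (3 * p) * c)) * k.+1 ^ 2 * q =
   e * k.+1 ^ 2 * q + (d * (k.+1 ^ 2) * q + 3 * k.+1 * (3 * p * k.+1) * (c * q)))%N by ring.
apply: leq_trans (leq_addl _ _); rewrite leq_add2r leq_mul2r; apply/orP; right.
by rewrite leq_pmulr // expn_gt0.
Qed.

(** With t = n / (K + 1), 2 ^ n is at least (t + 1) ^ (K + 1), and one of these factors t + 1 pays
    for the constant c (K + 1) ^ K. *)
Lemma exp_beats_poly (c K : nat) :
  exists n0, forall n, (n0 <= n)%N -> (c * n.+1 ^ K <= 2 ^ n)%N.
Proof.
exists (K.+1 * (c * K.+1 ^ K))%N => n hn; set t := (n %/ K.+1)%N.
have ht : (c * K.+1 ^ K <= t.+1)%N.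
  by apply: leqW; rewrite leq_divRL // mulnC.
have h1 : (n.+1 <= K.+1 * t.+1)%N by rewrite mulnC ltn_ceil.
have h2 : (t.+1 <= 2 ^ t)%N by rewrite ltn_expl.
have h3 : ((2 ^ t) ^ K.+1 <= 2 ^ n)%N by rewrite -expnM leq_exp2l // leq_trunc_div.
apply: leq_trans h3; apply: leq_trans (leq_pow K.+1 h2); rewrite expnS.
apply: (@leq_trans (c * (K.+1 * t.+1) ^ K)%N); first by rewrite leq_mul2l leq_pow ?orbT.
by rewrite expnMn mulnA leq_mul2r ht orbT.
Qed.

(** * Summation over the frequencies of bounded height *)

Section DualSum.
Variable R : realType.

Lemma ler_sum_partition (T U : eqType) (f : T -> U) (F : T -> R) (s : seq T) (L : seq U) :
  (forall y, 0 <= F y) -> (forall y, y \in s -> f y \in L) ->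
  \sum_(y <- s) F y <= \sum_(l <- L) \sum_(y <- s | f y == l) F y.
Proof.
move=> F0 h; under [leRHS]eq_bigr do rewrite big_mkcond /=; rewrite exchange_big /=.
rewrite big_seq [leRHS]big_seq; apply: ler_sum => y ys.
rewrite -big_mkcond /= (big_rem (f y)) ?h //= eqxx lerDl.
by apply: sumr_ge0 => *; apply: F0.
Qed.

Lemma harmonic_dyadic a : \sum_(1 <= d < 2 ^ a) (d%:R^-1 : R) <= a%:R.
Proof.
elim: a => [|a IH]; first by rewrite expn0 big_geq.
rewrite (big_cat_nat (n := 2 ^ a)) ?expn_gt0 ?leq_exp2l //= -natr1 lerD //.
apply: (@le_trans _ _ (\sum_(2 ^ a <= d < 2 ^ a.+1) ((2 ^ a)%:R^-1 : R))).
  rewrite big_nat [leRHS]big_nat; apply: ler_sum => d /andP[h _].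
  by rewrite lef_pV2 ?ler_nat // posrE ltr0n ?expn_gt0 // (leq_trans _ h) // expn_gt0.
rewrite sumr_const_nat expnS mul2n -addnn addnK -[X in X <= _]mulr_natr mulVf //.
Qed.

Lemma sum_if_const (T : Type) (s : seq T) (P c : pred T) (w : R) :
  \sum_(y <- s | P y) (if c y then w else 0) =
  (size [seq y <- s | P y && c y])%:R * w.
Proof.
by rewrite -big_mkcondr big_const_seq iter_addr addr0 size_filter mulr_natl.
Qed.

Lemma sqrt_sqrt_pow4 (x : R) : 0 <= x -> Num.sqrt (Num.sqrt x) ^+ 4 = x.
Proof.
move=> x0; rewrite (exprM _ 2 2) sqr_sqrtr; last exact: sqrtr_ge0.
exact: sqr_sqrtr.
Qed.

(** Each frequency is p ^ j e w with [w] a normal vector and [e] prime to [p]. For fixed j and d =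
    |e|, [w] is a point of the dual conic modulo p ^ (n - j - 1) of height Y / (p ^ j d), so there
    are about (Y / (p ^ j d)) ^ (5/4) of them. The weight grows only by p ^ (j / 2) with j, so
    summing over j and d costs logarithms. What must be compared is Y ^ (5/4) with p ^ (n / 2). *)
Lemma dual_sum p : prime p -> (2 < p)%N -> forall delta : R, 0 < delta ->
  exists n0, forall n b Y (s : seq vec) (g : vec -> R), (n0 <= n)%N ->
  coprimez (vol b) p -> (Y ^ 18 <= p ^ (7 * n))%N ->
  uniq s -> {in s, forall y, y <> 0 /\ boxed Y y} ->
  (forall j v, comb (p%:Z ^+ j) 0 v 0 \in s -> pprim p v -> (j.+2 <= n)%N ->
    g (comb (p%:Z ^+ j) 0 v 0) <=
      if (p%:Z ^+ (n - j).-1 %| qf (dual b) v)%Z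
      then p%:R ^+ (2 * j) * Num.sqrt p%:R ^+ (3 * (n - j)) else 0) ->
  \sum_(y <- s) g y <= delta * p%:R ^+ (2 * n).
Proof.
move=> p_pr p_odd delta d0; have p1 := prime_gt1 p_pr; have p0 := prime_gt0 p_pr.
have [C hC] := conic_count p_pr p_odd.
set r := Num.sqrt p%:R : R.
have r2 : r ^+ 2 = p%:R by rewrite sqr_sqrtr.
have r0 : 0 < r by rewrite sqrtr_gt0 ltr0n.
pose c := (2 * C * (p + 1))%N.
(* The final comparison is made between 72nd powers, where all quantities are natural numbers once
   the power of 1 / delta is rounded up. *)
pose M := (Num.truncn (delta^-1 ^+ 72)).+1.
have hM : delta^-1 ^+ 72 <= M%:R.
  by apply/ltW/truncnS_gt.
have [n1 hn1] := exp_beats_poly (M * (c ^ 72 * p ^ 72))%N (4 * 72).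
(* From 36 (2 k + j) <= 35 n and n >= 108 follows 2 k + j + 3 <= n. The 3 covers the rounding of the
   exponent and the loss of one factor [p] in the modulus. *)
exists (maxn n1 108) => n b Y s g; rewrite geq_max => /andP[/hn1 {}hn1 n108] b_unit hY us hs hg.
have pk0 j : (0 < p ^ j)%N by rewrite expn_gt0 p0.
have ex y : exists Dw : int * vec, y <> 0 ->
   [/\ Dw.1 <> 0, normal Dw.2 & y = comb Dw.1 0 Dw.2 0].
  have [->|/eqP y0] := eqVneq y 0; first by exists (0, 0).
  by have [D [w h]] := normal_exists y0; exists (D, w).
have [nf hnf] := choice ex.
pose J y := logn p `|(nf y).1|; pose dd y := (`|(nf y).1| %/ p ^ J y)%N.
pose cond y := (p%:Z ^+ (n - J y).-1 %| qf (dual b) (nf y).2)%Z.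
pose wt j : R := r ^+ (3 * n) * r ^+ j.
have wt0 j : 0 <= wt j by rewrite mulr_ge0 // exprn_ge0 // ltW.
have facts y : y \in s -> [/\ normal (nf y).2,
    exists2 e : int, `|e|%N = dd y & [/\ ~~ (p %| e)%Z, (nf y).1 = p%:Z ^+ J y * e,
      (0 < dd y)%N & y = comb (p%:Z ^+ J y * e) 0 (nf y).2 0] &
    boxed (Y %/ (p ^ J y * dd y)) (nf y).2].
  move=> ys; have [y0 bY] := hs _ ys; have [/eqP D0 nw Ey] := hnf _ y0.
  have D1 : (0 < `|(nf y).1|)%N by rewrite absz_gt0.
  have /dvdzP[e He] : (p%:Z ^+ J y %| (nf y).1)%Z.
    by rewrite dvdzE abszX pfactor_dvdnn.
  have Ee : `|e|%N = dd y by rewrite /dd {1}He abszM abszX mulnK.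
  have ue : ~~ (p %| e)%Z.
    apply/negP => /dvdzP[q Eq]; have := pfactor_dvdn (J y).+1 p_pr D1.
    rewrite ltnn => /negbT/negP; apply.
    by rewrite He Eq -mulrA -exprS abszM abszX dvdn_mull.
  have dd0 : (0 < dd y)%N.
    by rewrite -Ee absz_gt0; apply: contraNneq ue => ->; rewrite dvdz0.
  split=> //.
    by exists e => //; split=> //; [rewrite mulrC|rewrite mulrC -He].
  have Dabs : `|(nf y).1|%N = (p ^ J y * dd y)%N by rewrite He abszM abszX Ee mulnC.
  have : boxed Y (comb (nf y).1 0 (nf y).2 0) by rewrite -Ey.
  move=> /and3P[]; rewrite /= !mul0r !addr0 !abszM Dabs => *.
  by apply/and3P; split; rewrite leq_divRL ?muln_gt0 ?pk0 // mulnC.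
have Dle y : y \in s -> (p ^ J y * dd y <= Y)%N.
  move=> ys; have [nw [e _ [_ _ dd0 _]] bw] := facts _ ys.
  by have := normal_boxed nw bw; rewrite divn_gt0 // muln_gt0 pk0.
have exp18 u : (p ^ u <= Y)%N -> (18 * u <= 7 * n)%N.
  move=> h; have := leq_trans (leq_pow 18 h) hY.
  by rewrite -expnM leq_exp2l // mulnC.
have J2 y : y \in s -> ((J y).+2 <= n)%N.
  move=> ys; have [_ [e _ [_ _ dd0 _]] _] := facts _ ys.
  have := exp18 _ (leq_trans (leq_pmulr _ dd0) (Dle _ ys)).
  by move: n108; clear; lia.
have g_le y : y \in s -> g y <= if cond y then wt (J y) else 0.
  move=> ys; have [nw [e _ [ue _ _ Ey]] _] := facts _ ys.
  have Ey' : y = comb (p%:Z ^+ J y) 0 (comb e 0 (nf y).2 0) 0.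
    by rewrite [LHS]Ey; vec_unfold; congr (_, _, _); ring.
  have pv : pprim p (comb e 0 (nf y).2 0).
    apply: contra (unimod_pprim p_pr nw.1); exact: pprim_scale.
  have := hg (J y) (comb e 0 (nf y).2 0); rewrite -Ey' => /(_ ys pv (J2 _ ys)).
  set v := comb e 0 (nf y).2 0.
  have -> : (p%:Z ^+ (n - J y).-1 %| qf (dual b) v)%Z = cond y.
    rewrite /v; have -> : qf (dual b) (comb e 0 (nf y).2 0) = e ^+ 2 * qf (dual b) (nf y).2.
      by vec_unfold; ring.
    rewrite /cond Gauss_dvdzr // coprime_pX // expr2; exact: punit_mul.
  have -> : (p%:R ^+ (2 * J y) * Num.sqrt p%:R ^+ (3 * (n - J y)) : R) = wt (J y).
    rewrite -/r -r2 -exprM /wt -!exprD; congr (_ ^+ _).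
    by have := J2 _ ys; clear; lia.
  by [].
pose h y := if cond y then wt (J y) else 0.
have h0 y : 0 <= h y by rewrite /h; case: ifP.
(* The real number p Y ^ (5/4). *)
pose Z := Num.sqrt (Num.sqrt (p ^ 4 * Y ^ 5)%:R) : R.
have Z0 : 0 <= Z by rewrite sqrtr_ge0.
have Z4 : Z ^+ 4 = (p ^ 4 * Y ^ 5)%:R.
  by apply: sqrt_sqrt_pow4; apply: ler0n.
pose key y := (J y, dd y).
(* Y <= p ^ n < 2 ^ (p n), so all d lie in a dyadic range on which the harmonic sum is at most p
   n. *)
pose L := [seq (x, y) | x <- iota 0 n, y <- index_iota 1 (2 ^ (p * n))].
have YleP : (Y < 2 ^ (p * n))%N.
  have : (Y <= p ^ n)%N.
    apply: (@leq_pow_cancel 18) => //; apply: (leq_trans hY); rewrite -expnM leq_exp2l //.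
    by clear; lia.
  move=> hh; apply: (leq_ltn_trans hh); rewrite expnM.
  have n0 : (0 < n)%N by apply: (leq_trans _ n108).
  by rewrite (ltn_exp2r _ _ n0); apply: ltn_expl.
have keyL y : y \in s -> key y \in L.
  move=> ys; have [_ [e _ [_ _ dd0 _]] _] := facts _ ys.
  apply: allpairs_f; first by rewrite mem_iota /= add0n (ltn_trans _ (J2 _ ys)).
  rewrite mem_index_iota dd0 (leq_ltn_trans _ YleP) //.
  by apply: leq_trans (Dle _ ys); rewrite leq_pmull.
pose A : R := (2 * C * n.+1 ^ 2)%:R * r ^+ (3 * n) * Z.
have A0 : 0 <= A by rewrite !mulr_ge0 // exprn_ge0 // ltW.
have group l : l \in L -> \sum_(y <- s | key y == l) h y <= A * l.2%:R^-1.
  case: l => j d hl; have d1 : (0 < d)%N.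
    by case/allpairsP: hl => -[a e] [_ /= ]; rewrite mem_index_iota => /andP[? _] [_ ->].
  have -> : \sum_(y <- s | key y == (j, d)) h y =
     (size [seq y <- s | (key y == (j, d)) && cond y])%:R * wt j.
    rewrite -sum_if_const; apply: eq_bigr => y /eqP[<- _]; by [].
  set s' := [seq _ <- _ | _].
  have s'P y : y \in s' -> [/\ y \in s, J y = j, dd y = d & cond y].
    by rewrite mem_filter => /andP[/andP[/eqP[<- <-] hc] ys].
  case Es : s' => [|y0 r']; first by rewrite mul0r mulr_ge0 ?invr_ge0.
  rewrite -Es; have ys0 : y0 \in s' by rewrite Es mem_head.
  have [y0s J0 d0' _] := s'P _ ys0.
  have Djd : (p ^ j * d <= Y)%N by rewrite -J0 -d0' Dle.
  have hjn := J2 _ y0s; rewrite J0 in hjn.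
  pose Y' := (Y %/ (p ^ j * d))%N.
  have hY' : (Y' * (p ^ j * d) <= Y)%N by rewrite leq_trunc_div.
  have exk : exists k, (Y' ^ 5 <= p ^ (4 * k))%N.
    exists (Y' ^ 5)%N; apply: ltnW; apply: (leq_trans (ltn_expl _ p1)).
    by rewrite leq_exp2l // leq_pmull.
  have [k hk mink] := ex_minnP exk.
  have Y1 : (0 < Y)%N by apply: leq_trans Djd; rewrite muln_gt0 pk0.
  (* As in the count, [k] is the least admissible exponent: it fits the modulus, and p ^ k times the
     growth p ^ (j / 2) of the weight is at most Z / d. *)
  have [kn kZ] : (2 * k <= (n - j).-1)%N /\ (p ^ (2 * j) * p ^ (4 * k) * d ^ 4 <= p ^ 4 * Y ^ 5)%N.
    have q5 : (p ^ (2 * j) * d ^ 4 <= (p ^ j * d) ^ 5)%N.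
      rewrite expnMn -expnM; apply: leq_mul; last by rewrite leq_pexp2l.
      by rewrite leq_exp2l // mulnC leq_mul2l orbT.
    case: k hk mink => [|k] hk mink.
      split => //; rewrite muln0 expn0 muln1; apply: leq_trans q5 _.
      by apply: leq_trans (leq_pow 5 Djd) _; rewrite leq_pmull.
    have {}mink : (p ^ (4 * k) <= Y' ^ 5)%N.
      by rewrite leqNgt; apply/negP => /ltnW /mink; rewrite ltnn.
    have key5 : (p ^ (4 * k) * (p ^ j * d) ^ 5 <= Y ^ 5)%N.
      apply: leq_trans (leq_pow 5 hY'); rewrite [X in (_ <= X)%N]expnMn.
      by rewrite leq_mul2r mink orbT.
    split.
      have : (p ^ (18 * (4 * k + 5 * j)) <= p ^ (35 * n))%N.
        apply: (@leq_trans ((Y ^ 5) ^ 18)%N).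
          rewrite [(18 * _)%N]mulnC expnM; apply: leq_pow; apply: leq_trans key5.
          rewrite expnD leq_pmul2l // mulnC expnM leq_pow // leq_pmulr //.
        have -> : ((Y ^ 5) ^ 18 = (Y ^ 18) ^ 5)%N by rewrite -!expnM.
        apply: (leq_trans (leq_pow 5 hY)); rewrite -expnM leq_exp2l //.
        by clear; lia.
      by rewrite leq_exp2l //; move: n108; clear; lia.
    have -> : (p ^ (2 * j) * p ^ (4 * k.+1) * d ^ 4 = p ^ 4 * (p ^ (4 * k) * (p ^ (2 * j) * d ^ 4)))%N.
      by rewrite mulnS expnD; clear; move: (p ^ _)%N (p ^ _)%N (p ^ _)%N (d ^ 4)%N => *; ring.
    rewrite leq_pmul2l //; apply: leq_trans key5; rewrite leq_pmul2l //.
  have szw : (size (undup (map (fun y => (nf y).2) s')) <= C * k.+1 ^ 2 * p ^ k)%N.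
    apply: (hC (dual b) (n - j).-1 k Y') => //.
    - have -> : vol (dual b) = vol b ^+ 2 by vec_unfold; ring.
      exact: coprimezXl.
    - exact: undup_uniq.
    - move=> w; rewrite mem_undup => /mapP[y /s'P[ys EJ Ed hc] ->].
      have [nw _ bw] := facts _ ys; apply/and3P; split.
      + by apply: unimod_pprim => //; case: nw.
      + by move: hc; rewrite /cond EJ.
      + by move: bw; rewrite EJ Ed.
    - apply: normal_ncol => w; rewrite mem_undup => /mapP[y /s'P[ys _ _ _] ->].
      by case: (facts _ ys).
  have szs : (size s' <= 2 * (C * n.+1 ^ 2 * p ^ k))%N.
    apply: (@leq_trans (2 * size (undup (map (fun y => (nf y).2) s')))%N).
      apply: size_fibre2; first by rewrite filter_uniq.
      move=> x y z /s'P[xs Jx dx _] /s'P[ys Jy dy _] /s'P[zs Jz dz _] e1 e2.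
      have [_ [ex' ax [_ _ _ Ex]] _] := facts _ xs.
      have [_ [ey' ay [_ _ _ Ey]] _] := facts _ ys.
      have [_ [ez' az [_ _ _ Ez]] _] := facts _ zs.
      have : [\/ ex' = ey', ey' = ez' | ez' = ex'].
        move: ax ay az; rewrite dx dy dz; clear=> ? ? ?.
        have [->|[->|->]] : ex' = ey' \/ ey' = ez' \/ ez' = ex' by lia.
        - exact: Or31.
        - exact: Or32.
        - exact: Or33.
      case=> e; [apply: Or31|apply: Or32|apply: Or33].
      - by rewrite Ex Ey e e1 Jx Jy.
      - by rewrite Ey Ez e e2 Jy Jz.
      - by rewrite Ez Ex e e1 e2 Jx Jz.
    rewrite leq_pmul2l //; apply: (leq_trans szw); rewrite leq_pmul2r // leq_mul2l leq_pow ?orbT //.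
    by move: kn; clear; lia.
  have rk : r ^+ j * (p ^ k)%:R <= Z * d%:R^-1.
    rewrite ler_pdivlMr ?ltr0n //.
    have lhs0 : 0 <= r ^+ j * (p ^ k)%:R * d%:R by rewrite !mulr_ge0 // exprn_ge0 // ltW.
    rewrite -(ler_pXn2r (isT : 0 < 4)%N) ?nnegrE // Z4 !exprMn.
    have -> : r ^+ j ^+ 4 = (p ^ (2 * j))%:R.
      by rewrite -exprM natrX -r2 -exprM; congr (_ ^+ _); clear; lia.
    rewrite -!natrX -!natrM ler_nat -expnM [(k * 4)%N]mulnC //.
  apply: (@le_trans _ _ ((2 * (C * n.+1 ^ 2 * p ^ k))%:R * wt j)).
    by rewrite ler_wpM2r // ler_nat.
  have -> : (2 * (C * n.+1 ^ 2 * p ^ k))%:R * wt j =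
    (2 * C * n.+1 ^ 2)%:R * r ^+ (3 * n) * (r ^+ j * (p ^ k)%:R).
    by rewrite /wt !natrM; ring.
  by rewrite /A -[leRHS]mulrA ler_wpM2l // mulr_ge0 // exprn_ge0 // ltW.
apply: (@le_trans _ _ (\sum_(y <- s) h y)).
  by rewrite big_seq [leRHS]big_seq; apply: ler_sum => y ys; apply: g_le.
apply: (le_trans (ler_sum_partition h0 keyL)).
apply: (@le_trans _ _ (\sum_(l <- L) A * l.2%:R^-1)).
  by rewrite big_seq [leRHS]big_seq; apply: ler_sum => l lL; apply: group.
rewrite big_allpairs /=; under eq_bigr do rewrite -mulr_sumr.
rewrite big_const_seq count_predT size_iota iter_addr_0.
apply: (@le_trans _ _ (n%:R * (A * (p * n)%:R))).
  rewrite -[leLHS]mulr_natl; apply: ler_wpM2l => //; apply: ler_wpM2l => //.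
  exact: harmonic_dyadic.
apply: (@le_trans _ _ ((c * n.+1 ^ 4)%:R * Z * r ^+ (3 * n))).
  rewrite /A; have -> : n%:R * ((2 * C * n.+1 ^ 2)%:R * r ^+ (3 * n) * Z * (p * n)%:R) =
    (2 * C * p * (n.+1 ^ 2 * (n * n)))%:R * (Z * r ^+ (3 * n)) :> R.
    by rewrite !natrM; ring.
  rewrite -[leRHS]mulrA; apply: ler_wpM2r.
    by rewrite mulr_ge0 // exprn_ge0 // ltW.
  rewrite ler_nat /c.
  rewrite -[4%N]/(2 + 2)%N expnD; apply: leq_mul; first by rewrite leq_mul2l leq_addr orbT.
  by rewrite leq_mul2l -[(n * n)%N]/(n ^ 2)%N leq_pow ?orbT.
have -> : delta * p%:R ^+ (2 * n) = delta * r ^+ n * r ^+ (3 * n).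
  by rewrite -r2 -exprM -mulrA -exprD; congr (_ * _ ^+ _); clear; lia.
rewrite ler_pM2r ?exprn_gt0 //.
have lhs0 : 0 <= (c * n.+1 ^ 4)%:R * Z by rewrite mulr_ge0.
have rhs0 : 0 <= delta * r ^+ n by rewrite mulr_ge0 ?exprn_ge0 ?ltW.
rewrite -(ler_pXn2r (isT : 0 < 72)%N) ?nnegrE //.
rewrite [leLHS]exprMn [leRHS]exprMn (exprM Z 4 18) Z4.
have -> : r ^+ n ^+ 72 = (p ^ (36 * n))%:R.
  by rewrite -exprM natrX -r2 -exprM; congr (_ ^+ _); clear; lia.
have delta72 : 0 < delta ^+ 72 by rewrite exprn_gt0.
rewrite -ler_pdivrMl // -exprVn.
apply: (@le_trans _ _ (M%:R * (((c * n.+1 ^ 4) ^ 72 * (p ^ 4 * Y ^ 5) ^ 18)%:R))).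
  rewrite [X in _ <= _ * X]natrM (natrX _ _ 72) (natrX _ _ 18).
  by apply: ler_wpM2r; rewrite // mulr_ge0 // exprn_ge0.
rewrite -natrM ler_nat.
have hY5 : ((p ^ 4 * Y ^ 5) ^ 18 <= p ^ 72 * p ^ (35 * n))%N.
  rewrite expnMn; apply: leq_mul; first by rewrite -expnM.
  have -> : ((Y ^ 5) ^ 18 = (Y ^ 18) ^ 5)%N by rewrite -!expnM.
  apply: (leq_trans (leq_pow 5 hY)); rewrite -expnM leq_exp2l //.
  by clear; lia.
apply: (@leq_trans (M * ((c * n.+1 ^ 4) ^ 72 * (p ^ 72 * p ^ (35 * n))))%N).
  by rewrite leq_mul2l leq_mul2l hY5 !orbT.
have -> : (p ^ (36 * n) = p ^ n * p ^ (35 * n))%N by rewrite -expnD; congr (_ ^ _)%N; clear; lia.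
have : (M * ((c * n.+1 ^ 4) ^ 72 * p ^ 72) <= p ^ n)%N.
  apply: (@leq_trans (2 ^ n)%N); last by apply: leq_pow; apply: ltnW.
  apply: leq_trans hn1; rewrite (expnMn c) -(expnM n.+1).
  move: (c ^ 72)%N (p ^ 72)%N (n.+1 ^ (4 * 72))%N; clear=> u v w.
  by rewrite -!mulnA [(w * v)%N]mulnC.
move: ((c * n.+1 ^ 4) ^ 72)%N (p ^ 72)%N (p ^ n)%N (p ^ (35 * n))%N; clear=> u v w x h.
by rewrite !mulnA leq_mul2r -mulnA h orbT.
Qed.
End DualSum.

(** * Exponential sums over a conic *)

Section Character.
Variables (C : numClosedFieldType) (q : nat) (z : C).
Hypotheses (q1 : (1 < q)%N) (zq : q.-primitive_root z).

Definition echar (x : 'Z_q) : C := z ^+ x.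

Lemma echarD x y : echar (x + y) = echar x * echar y.
Proof.
rewrite /echar -exprD /= -[RHS](prim_expr_mod zq).
by congr (_ ^+ _); congr (_ %% _)%N; rewrite Zp_cast.
Qed.

Lemma echar0 : echar 0 = 1. Proof. by []. Qed.

Lemma echar_eq1 x : (echar x == 1) = (x == 0).
Proof.
rewrite /echar -(prim_order_dvd zq); apply/idP/eqP => [h|->]; last exact: dvdn0.
apply/val_inj => /=; apply/eqP; apply: contraLR h; rewrite -lt0n => h.
by rewrite gtnNdvd // -[X in (_ < X)%N](Zp_cast q1) ltn_ord.
Qed.

Lemma norm_echar x : `|echar x| = 1.
Proof.
have : `|z| ^+ q = 1 by rewrite -normrX (prim_expr_order zq) normr1.
rewrite /echar normrX => /eqP; rewrite pexpr_eq1 //; last exact: ltnW.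
by move/eqP ->; rewrite expr1n.
Qed.

Lemma echar_conj x : (echar x)^* = echar (- x).
Proof.
have e0 : echar x != 0 by rewrite -normr_eq0 norm_echar oner_eq0.
apply: (mulfI e0); rewrite -normCK norm_echar expr1n -echarD subrr; exact: echar0.
Qed.

Lemma sum_echar k : \sum_x echar (k * x) = if k == 0 then q%:R else 0.
Proof.
case: eqP => [->|/eqP k0].
  under eq_bigr do rewrite mul0r echar0.
  by rewrite sumr_const card_ord Zp_cast.
set S := \sum_x _; have : echar k * S = S.
  rewrite /S mulr_sumr [RHS](reindex_inj (addrI 1)) /=; apply: eq_bigr => x _.
  by rewrite mulrDr mulr1 echarD.
move/eqP; rewrite -subr_eq0 -{2}[S]mul1r -mulrBl mulf_eq0 subr_eq0 echar_eq1.
by rewrite (negPf k0) => /eqP.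
Qed.
End Character.

(** * Gauss sums over units modulo a prime power *)

Section Gauss.
Variables (C : numClosedFieldType) (p m : nat) (z : C).
Hypotheses (p_pr : prime p) (p_odd : (2 < p)%N) (m0 : (0 < m)%N).
Hypothesis (zq : (p ^ m).-primitive_root z).
Notation q := (p ^ m)%N.
Notation psi := (@echar C q z).

Lemma q_gt1 : (1 < q)%N.
Proof. by rewrite -(exp1n m) ltn_exp2r // prime_gt1. Qed.
Let q1 := q_gt1.

Lemma unit_natE k : ((k%:R : 'Z_q) \is a GRing.unit) = ~~ (p %| k)%N.
Proof. by rewrite unitZpE // coprime_pexpl // prime_coprime. Qed.

Lemma nonunitE (x : 'Z_q) : x \isn't a GRing.unit -> exists x', x = p%:R * x'.
Proof.
rewrite -[x]natr_Zp unit_natE negbK => /dvdnP[k ->].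
by exists k%:R; rewrite natrM mulrC.
Qed.

Lemma unit2 : (2%:R : 'Z_q) \is a GRing.unit.
Proof. by rewrite unit_natE; apply/negP => /dvdn_leq; move: p_odd; clear; lia. Qed.

(** Multiplication by [top] kills exactly the non-units, and [top] has square 0 once m > 1; hence a
    shift by top * c changes a quadratic phase by a linear term in c. *)
Definition top : 'Z_q := p%:R ^+ m.-1.

Lemma top_p : top * p%:R = 0.
Proof. by rewrite -exprSr prednK // -natrX pchar_Zp. Qed.

Lemma top_nonunit x : x \isn't a GRing.unit -> top * x = 0.
Proof. by move/nonunitE => [x' ->]; rewrite mulrA top_p mul0r. Qed.

Lemma top_unit x : x \is a GRing.unit -> top * x != 0.
Proof.
move=> ux; rewrite -[X in _ != X](mul0r x) (inj_eq (mulIr ux)) /top -natrX.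
rewrite -(inj_eq val_inj) /= val_Zp_nat //; apply/negP.
rewrite -/(dvdn _ _) dvdn_Pexp2l ?prime_gt1 //; move: m0; clear; lia.
Qed.

Definition gsum (a y : 'Z_q) : C := \sum_(x | x \is a GRing.unit) psi (a * x ^+ 2 + y * x).
Definition gauss (a y : 'Z_q) : C := \sum_x psi (a * x ^+ 2 + y * x).

Hypothesis m1 : (1 < m)%N.

Lemma top_sq : top ^+ 2 = 0.
Proof.
rewrite /top -exprM (_ : m.-1 * 2 = m + (m - 2))%N; last by move: m1; clear; lia.
by rewrite exprD -natrX pchar_Zp // mul0r.
Qed.

Lemma topMtop x : top * (top * x) = 0.
Proof. by rewrite mulrA -expr2 top_sq mul0r. Qed.

Lemma unit_shift (x c : 'Z_q) :
  (x + top * c \is a GRing.unit) = (x \is a GRing.unit).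
Proof.
have imp u v : u \is a GRing.unit -> u + top * v \is a GRing.unit.
  move=> uu; have -> : u + top * v = u * (1 + top * (v / u)).
    by rewrite mulrDr mulr1 mulrCA [u * (v / u)]mulrC divrK.
  rewrite unitrM uu /=; apply/unitrP; exists (1 - top * (v / u)).
  have e : (1 - top * (v / u)) * (1 + top * (v / u)) = 1.
    by rewrite -subr_sqr expr1n exprMn top_sq mul0r subr0.
  by rewrite [in X in _ /\ X]mulrC.
apply/idP/idP => [h|]; last exact: imp.
by have := imp _ (- c) h; rewrite mulrN addrK.
Qed.

Lemma psi_shift a y x c :
  psi (a * (x + top * c) ^+ 2 + y * (x + top * c)) =
  psi (a * x ^+ 2 + y * x) * psi (top * (2 * a * x + y) * c).
Proof.
rewrite -(echarD q1 zq); congr echar.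
have -> : a * (x + top * c) ^+ 2 + y * (x + top * c) =
  a * x ^+ 2 + y * x + top * (2 * a * x + y) * c + a * (c * (top * (top * c))) by ring.
by rewrite topMtop !mulr0 addr0.
Qed.

(* Averaging over the shifts [x + top * c] keeps only stationary points. *)
Lemma stationary a y (P : pred 'Z_q) : (forall x c, P (x + top * c) = P x) ->
  (forall x, P x -> 2 * a * x + y \is a GRing.unit) ->
  \sum_(x | P x) psi (a * x ^+ 2 + y * x) = 0.
Proof.
move=> Pc hP; set S := \sum_(x | _) _.
have q0 : (q%:R : C) != 0 by rewrite pnatr_eq0 -lt0n ltnW.
apply: (mulfI q0); rewrite mulr0.
have -> : q%:R * S = \sum_(c : 'Z_q) S.
  by rewrite sumr_const card_ord Zp_cast // mulr_natl.
have -> : \sum_(c : 'Z_q) S =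
    \sum_(c : 'Z_q) \sum_(x | P x) psi (a * x ^+ 2 + y * x) * psi (top * (2 * a * x + y) * c).
  apply: eq_bigr => c _; rewrite /S (reindex_inj (addIr (top * c))) /=.
  by apply: eq_big => [x|x _]; [rewrite Pc|rewrite psi_shift].
rewrite exchange_big /=; apply: big1 => x Px.
rewrite -mulr_sumr (sum_echar q1 zq) ifN ?mulr0 //; exact/top_unit/hP.
Qed.

Lemma nonunitD (x y : 'Z_q) : x \isn't a GRing.unit -> y \is a GRing.unit ->
  x + y \is a GRing.unit.
Proof.
move=> nx uy; apply: contraT => /nonunitE[k Ek]; have [l El] := nonunitE nx.
have Ey : y = p%:R * (k - l) by rewrite mulrBr -Ek -El addrC addKr.
move: uy; rewrite Ey => uy; have := unitrM p%:R (k - l); rewrite uy unit_natE.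
by rewrite dvdnn.
Qed.

(** Here and in the next two lemmas the derivative 2 a x + y is a unit over the whole range that is
    dropped, so [stationary] applies. *)
Lemma gsum_nonunit_l a y : a \isn't a GRing.unit -> y \is a GRing.unit -> gsum a y = 0.
Proof.
move=> na uy; apply: stationary => [x c|x ux]; first exact: unit_shift.
by apply: nonunitD => //; rewrite unitrM negb_and unitrM negb_and na orbT.
Qed.

Lemma gsum_nonunit_r a y : a \is a GRing.unit -> y \isn't a GRing.unit -> gsum a y = 0.
Proof.
move=> ua ny; apply: stationary => [x c|x ux]; first exact: unit_shift.
by rewrite addrC nonunitD // !unitrM unit2 ua ux.
Qed.

Lemma gsum_unit a y : a \is a GRing.unit -> y \is a GRing.unit -> gsum a y = gauss a y.
Proof.
move=> ua uy; rewrite /gauss (bigID (fun x => x \is a GRing.unit)) /=.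
have -> : \sum_(x | x \isn't a GRing.unit) psi (a * x ^+ 2 + y * x) = 0.
  apply: stationary => [x c|x nx]; first by rewrite unit_shift.
  by apply: nonunitD => //; rewrite unitrM negb_and nx orbT.
by rewrite addr0.
Qed.

Lemma gauss_complete a y : a \is a GRing.unit ->
  gauss a y = psi (- (y ^+ 2 / (4 * a))) * gauss a 0.
Proof.
move=> ua; have u2 := unit2.
have u4 : (4 * a : 'Z_q) \is a GRing.unit.
  by rewrite unitrM ua andbT (_ : 4 = 2 * 2 :> 'Z_q) ?unitrM ?u2 // -natrM.
rewrite /gauss mulr_sumr (reindex_inj (addIr (- (y / (2 * a))))) /=.
apply: eq_bigr => x _; rewrite -(echarD q1 zq); congr echar.
have u2a : (2 * a : 'Z_q) \is a GRing.unit by rewrite unitrM u2.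
set w := y / (2 * a); have Ey : y = 2 * a * w by rewrite /w mulrC divrK.
have -> : y ^+ 2 / (4 * a) = a * w ^+ 2.
  apply: (mulIr u4); rewrite divrK // Ey; ring.
by rewrite {1}Ey; ring.
Qed.

Lemma gauss_sq a u : u \is a GRing.unit -> gauss (a * u ^+ 2) 0 = gauss a 0.
Proof.
move=> uu; rewrite /gauss [RHS](reindex_inj (mulrI uu)) /=.
by apply: eq_bigr => x _; rewrite !mul0r !addr0; congr echar; ring.
Qed.

Lemma gauss_norm a : a \is a GRing.unit -> `|gauss a 0| = sqrtC q%:R.
Proof.
move=> ua; have h : `|gauss a 0| ^+ 2 = q%:R.
  rewrite normCK /gauss rmorph_sum /= mulr_suml.
  transitivity (\sum_(x : 'Z_q) \sum_(s : 'Z_q) psi (- (a * s ^+ 2)) * psi (- (2 * a * s) * x)).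
    apply: eq_bigr => x _; rewrite mulr_sumr (reindex_inj (addrI x)) /=.
    apply: eq_bigr => s _; rewrite (echar_conj q1 zq) -!(echarD q1 zq).
    by congr echar; ring.
  rewrite exchange_big /=.
  under eq_bigr do rewrite -mulr_sumr (sum_echar q1 zq).
  rewrite (bigD1 0) //= expr0n /= !mulr0 oppr0 echar0 eqxx mul1r big1 ?addr0 // => s s0.
  rewrite ifN ?mulr0 // oppr_eq0.
  have u2a : (2 * a : 'Z_q) \is a GRing.unit by rewrite unitrM unit2.
  by rewrite -[X in _ != X](mulr0 (2 * a)) (inj_eq (mulrI u2a)).
by rewrite -h sqrCK // normr_ge0.
Qed.
End Gauss.

Section Residues.
Variable (n : nat).
Hypothesis n1 : (1 < n)%N.

Lemma intr_Zp_eq0 (a : int) : ((a%:~R : 'Z_n) == 0) = (n %| a)%Z.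
Proof.
have nat_case k : ((k%:R : 'Z_n) == 0) = (n %| k)%N.
  by rewrite -(inj_eq val_inj) /= val_Zp_nat.
case: a => k; first by rewrite -pmulrn nat_case.
by rewrite NegzE mulrNz oppr_eq0 -pmulrn nat_case dvdzE /= .
Qed.

Lemma big_Zp (V : nmodType) (f : 'Z_n -> V) :
  \sum_x f x = \sum_(0 <= k < n) f k%:R.
Proof.
have E N (F : nat -> V) : N = n -> \sum_(0 <= k < N) F k = \sum_(0 <= k < n) F k.
  by move->.
rewrite -(E _ (fun k => f k%:R) (Zp_cast n1)) big_mkord.
by apply: eq_bigr => x _; rewrite natr_Zp.
Qed.

Lemma echar_intr (C : numClosedFieldType) (z : C) (a : int) :
  n.-primitive_root z -> echar z (a%:~R : 'Z_n) = z ^ a.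
Proof.
move=> zn; have nat_case k : echar z (k%:R : 'Z_n) = z ^+ k.
  by rewrite /echar val_Zp_nat // (prim_expr_mod zn).
case: a => k; first by rewrite -pmulrn nat_case.
rewrite NegzE mulrNz -pmulrn -(echar_conj n1 zn) nat_case -exprnN.
have z1 : `|z ^+ k.+1| = 1 by rewrite -nat_case (norm_echar n1 zn).
have z0 : z ^+ k.+1 != 0 by rewrite -normr_eq0 z1 oner_eq0.
by apply: (mulfI z0); rewrite divff // -normCK z1 expr1n.
Qed.
End Residues.

Lemma intr_unit p m (a : int) : prime p -> (0 < m)%N ->
  ((a%:~R : 'Z_(p ^ m)) \is a GRing.unit) = ~~ (p %| a)%Z.
Proof.
move=> p_pr m0; case: a => k; first by rewrite -pmulrn unit_natE.
by rewrite NegzE mulrNz unitrN -pmulrn unit_natE // dvdzE.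
Qed.

(** * The exponential sum over unit points of the conic *)

Section Conic.
Variables (C : numClosedFieldType) (p : nat) (b : vec).
Hypotheses (p_pr : prime p) (p_odd : (2 < p)%N) (b_unit : coprimez (vol b) p).

(** The sum K of the overview. The root of unity [z] is a parameter because a change of modulus
    replaces it by a power. *)
Definition csum m (z : C) (y : vec) : C :=
  \sum_(x1 : 'Z_(p ^ m) | x1 \is a GRing.unit)
  \sum_(x2 : 'Z_(p ^ m) | x2 \is a GRing.unit)
  \sum_(x3 : 'Z_(p ^ m) | x3 \is a GRing.unit)
    (b.1.1%:~R * x1 ^+ 2 + b.1.2%:~R * x2 ^+ 2 + b.2%:~R * x3 ^+ 2 == 0)%:R *
    echar z (y.1.1%:~R * x1 + y.1.2%:~R * x2 + y.2%:~R * x3).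

Section Level.
Variables (m : nat) (z : C).
Hypotheses (m0 : (0 < m)%N) (zq : (p ^ m).-primitive_root z).
Notation q := (p ^ m)%N.
Let q1 : (1 < q)%N := q_gt1 p_pr m0.
Notation psi := (@echar C q z).

(** The congruence is detected by the characters indexed by [h]; the three coordinates then
    separate. *)
Lemma csum_fourier (y : vec) : q%:R * csum m z y =
  \sum_(h : 'Z_q) gsum z (h * b.1.1%:~R) y.1.1%:~R *
     (gsum z (h * b.1.2%:~R) y.1.2%:~R * gsum z (h * b.2%:~R) y.2%:~R).
Proof.
transitivity (\sum_(h : 'Z_q)
  \sum_(x1 : 'Z_q | x1 \is a GRing.unit) \sum_(x2 : 'Z_q | x2 \is a GRing.unit)
  \sum_(x3 : 'Z_q | x3 \is a GRing.unit)
   psi (h * b.1.1%:~R * x1 ^+ 2 + y.1.1%:~R * x1) *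
   (psi (h * b.1.2%:~R * x2 ^+ 2 + y.1.2%:~R * x2) *
    psi (h * b.2%:~R * x3 ^+ 2 + y.2%:~R * x3))); last first.
  apply: eq_bigr => h _; rewrite /gsum mulr_suml; apply: eq_bigr => x1 _.
  rewrite big_distrlr /= mulr_sumr; apply: eq_bigr => x2 _.
  by rewrite -!mulr_sumr.
rewrite exchange_big /= /csum mulr_sumr; apply: eq_bigr => x1 _.
rewrite [RHS]exchange_big /= mulr_sumr; apply: eq_bigr => x2 _.
rewrite [RHS]exchange_big /= mulr_sumr; apply: eq_bigr => x3 _.
rewrite mulrA; set Q := _ + _; set L := _ + _.
have -> : q%:R * (Q == 0)%:R = \sum_(h : 'Z_q) psi (Q * h).
  by rewrite (sum_echar q1 zq); case: eqP; rewrite ?mulr1 ?mulr0.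
rewrite mulr_suml; apply: eq_bigr => h _; rewrite -!(echarD q1 zq).
by congr echar; rewrite /Q /L; ring.
Qed.

Lemma bunits : [/\ (b.1.1%:~R : 'Z_q) \is a GRing.unit,
  (b.1.2%:~R : 'Z_q) \is a GRing.unit & (b.2%:~R : 'Z_q) \is a GRing.unit].
Proof.
have := vol_punit p_pr b_unit; rewrite /vol => h; split; rewrite intr_unit //;
  apply: contra h => h.
- by apply: dvdz_mulr; apply: dvdz_mulr.
- by apply: dvdz_mulr; apply: dvdz_mull.
- by apply: dvdz_mull.
Qed.

Hypothesis m1 : (1 < m)%N.

(* Replacing [h] by [h / u ^ 2] with [u = 1 + p ^ j * s] and averaging over [s]
   kills the sum as soon as [t] is not divisible by [p ^ m.-1]. *)
Lemma salie_vanish (c : 'Z_q -> C) (t : 'Z_q) : p%:R * t != 0 ->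
  (forall h u, u \is a GRing.unit -> c (h * u ^+ 2) = c h) ->
  \sum_(h | h \is a GRing.unit) psi (- (t / (4 * h))) * c h = 0.
Proof.
move=> pt hc; set K := \sum_(h | _) _.
have u2 : (2%:R : 'Z_q) \is a GRing.unit := unit2 p_pr p_odd m0.
have u4 : (4%:R : 'Z_q) \is a GRing.unit by rewrite -[4%N]/(2 * 2)%N natrM unitrM u2.
(* The hypothesis p t != 0 says that the valuation of [t] is below m - 1. *)
have [f [t0 [fm ut0 Et]]] : exists f t0, [/\ (f < m.-1)%N, t0 \is a GRing.unit & t = p%:R ^+ f * t0].
  have tn0 : (0 < (t : nat))%N.
    by rewrite lt0n; apply: contraNneq pt => h; rewrite (_ : t = 0) ?mulr0 //; apply: val_inj.
  have /dvdnP[k Ek] := pfactor_dvdnn p t; set f := logn p t in Ek.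
  have Et : t = p%:R ^+ f * k%:R by rewrite -[LHS]natr_Zp Ek natrM natrX mulrC.
  exists f, k%:R; split=> //.
    rewrite ltnNge; apply: contra pt => h; rewrite Et mulrA -exprS.
    rewrite (_ : f.+1 = m + (f - m.-1))%N; last by move: h m0; clear; lia.
    by rewrite exprD -natrX pchar_Zp // !mul0r.
  rewrite unit_natE //; apply/negP => /dvdnP[l El].
  have := pfactor_dvdn f.+1 p_pr tn0; rewrite -/f ltnn => /negbT/negP; apply.
  by rewrite Ek El -mulnA -expnS dvdn_mull.
(* The exponent e makes p ^ e times the p-part of [t] equal to [top], so that t (1 + p ^ e s) ^ 2
   differs from t only by 2 top t0 s. *)
pose e := (m.-1 - f)%N; have e0 : (0 < e)%N by rewrite subn_gt0.
pose u (s : 'Z_q) : 'Z_q := 1 + p%:R ^+ e * s.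
have uu s : u s \is a GRing.unit.
  rewrite /u addrC; apply: (nonunitD p_pr m0) => //; last exact: unitr1.
  by rewrite unitrM negb_and -natrX unit_natE // negbK dvdn_exp.
have ut s : t * u s ^+ 2 = t + 2 * top p m * t0 * s.
  have -> : t * u s ^+ 2 = t + 2 * (p%:R ^+ f * p%:R ^+ e) * t0 * s
    + (p%:R ^+ f * p%:R ^+ e) * p%:R ^+ e * t0 * s ^+ 2 by rewrite /u Et; ring.
  rewrite -exprD (_ : f + e = m.-1)%N; last by rewrite /e subnKC // ltnW.
  rewrite -/(top p m) (top_nonunit p_pr m0) ?mul0r ?addr0 //.
  by rewrite -natrX unit_natE // negbK dvdn_exp.
have q0 : (q%:R : C) != 0 by rewrite pnatr_eq0 -lt0n ltnW.
apply: (mulfI q0); rewrite mulr0.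
have -> : q%:R * K = \sum_(s : 'Z_q) K.
  by rewrite sumr_const card_ord Zp_cast // mulr_natl.
have -> : \sum_(s : 'Z_q) K = \sum_(s : 'Z_q) \sum_(h | h \is a GRing.unit)
    psi (- (t / (4 * h))) * c h * psi (top p m * (- (2 * t0 / (4 * h))) * s).
  apply: eq_bigr => s _; rewrite /K.
  have inj : injective (fun h => h * (u s)^-1 ^+ 2).
    by apply: mulIr; rewrite unitrX // unitrV.
  rewrite (reindex_inj inj) /=; apply: eq_big => [h|h].
    by rewrite unitrM unitrX ?unitrV ?uu // andbT.
  rewrite unitrM => /andP[uh _]; rewrite hc ?unitrV // mulrAC -(echarD q1 zq); congr (echar _ _ * _).
  have u4h : (4 * h : 'Z_q) \is a GRing.unit by rewrite unitrM u4.
  have -> : t / (4 * (h * (u s)^-1 ^+ 2)) = t * u s ^+ 2 / (4 * h).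
    rewrite mulrA invrM ?unitrX ?unitrV //.
    by rewrite -exprVn invrK mulrA.
  by rewrite ut; ring.
rewrite exchange_big /=; apply: big1 => h uh.
rewrite -mulr_sumr (sum_echar q1 zq) ifN ?mulr0 //; apply: (top_unit p_pr m0).
by rewrite unitrN !unitrM unitrV unitrM u2 ut0 u4.
Qed.

(** If some but not all coordinates of [y] are divisible by [p], each [h] kills a factor: a non-unit
    [h] one at a unit coordinate, a unit [h] one at a non-unit coordinate. Otherwise completing the
    square leaves a sum over units [h] of psi(- t / (4 h)) c(h), where vol(b) t is the dual form at
    [y], and c is invariant under squares and of modulus q ^ (3/2). It vanishes by [salie_vanish]
    unless p t = 0, and is then bounded termwise. *)
Lemma csum_bound (y : vec) : pprim p y ->
  `|csum m z y| <= if (p%:Z ^+ m.-1 %| qf (dual b) y)%Z then sqrtC q%:R ^+ 3 else 0.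
Proof.
move=> py; have [ub1 ub2 ub3] := bunits.
have q0 : (0 : C) < q%:R by rewrite ltr0n ltnW.
have sq0 : 0 <= (sqrtC q%:R : C) ^+ 3 by rewrite exprn_ge0 // sqrtC_ge0 ler0n.
have [uy|nuy] := boolP [&& ~~ (p %| y.1.1)%Z, ~~ (p %| y.1.2)%Z & ~~ (p %| y.2)%Z]; last first.
  suff -> : csum m z y = 0 by rewrite normr0; case: ifP.
  apply: (mulfI (lt0r_neq0 q0)); rewrite mulr0 csum_fourier; apply: big1 => h _.
  have key (x1 x2 : int) (b1 b2 : 'Z_q) : ~~ (p %| x1)%Z -> (p %| x2)%Z -> b1 \is a GRing.unit ->
     b2 \is a GRing.unit -> gsum z (h * b1) x1%:~R = 0 \/ gsum z (h * b2) x2%:~R = 0.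
    move=> h1 h2 u1 u2; have [uh|nh] := boolP (h \is a GRing.unit).
      by right; apply: (gsum_nonunit_r p_pr p_odd m0 zq m1); rewrite ?unitrM ?uh // intr_unit // negbK.
    left; apply: (gsum_nonunit_l p_pr m0 zq m1); rewrite ?unitrM ?negb_and ?nh //.
    by rewrite intr_unit.
  move: nuy py; rewrite /pprim /dvdv !negb_and !negbK.
  case: (boolP (p %| y.1.1)%Z) => h1; case: (boolP (p %| y.1.2)%Z) => h2;
    case: (boolP (p %| y.2)%Z) => h3 //= _ _.
  - by have [->|->] := key _ _ _ _ h3 h1 ub3 ub1; rewrite ?(mul0r, mulr0).
  - by have [->|->] := key _ _ _ _ h2 h1 ub2 ub1; rewrite ?(mul0r, mulr0).
  - by have [->|->] := key _ _ _ _ h2 h1 ub2 ub1; rewrite ?(mul0r, mulr0).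
  - by have [->|->] := key _ _ _ _ h1 h2 ub1 ub2; rewrite ?(mul0r, mulr0).
  - by have [->|->] := key _ _ _ _ h1 h2 ub1 ub2; rewrite ?(mul0r, mulr0).
  - by have [->|->] := key _ _ _ _ h1 h3 ub1 ub3; rewrite ?(mul0r, mulr0).
case/and3P: uy => uy1 uy2 uy3.
have {}uy1 : (y.1.1%:~R : 'Z_q) \is a GRing.unit by rewrite intr_unit.
have {}uy2 : (y.1.2%:~R : 'Z_q) \is a GRing.unit by rewrite intr_unit.
have {}uy3 : (y.2%:~R : 'Z_q) \is a GRing.unit by rewrite intr_unit.
pose c (h : 'Z_q) := gauss z (h * b.1.1%:~R) 0 * (gauss z (h * b.1.2%:~R) 0 * gauss z (h * b.2%:~R) 0).
pose t : 'Z_q := y.1.1%:~R ^+ 2 / b.1.1%:~R + y.1.2%:~R ^+ 2 / b.1.2%:~R + y.2%:~R ^+ 2 / b.2%:~R.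
have E : q%:R * csum m z y = \sum_(h | h \is a GRing.unit) psi (- (t / (4 * h))) * c h.
  rewrite csum_fourier (bigID (fun h => h \is a GRing.unit)) /= [X in _ + X]big1; last first.
    move=> h nh; rewrite (gsum_nonunit_l p_pr m0 zq m1) ?mul0r //.
    by rewrite unitrM negb_and nh.
  rewrite addr0; apply: eq_bigr => h uh.
  have u4 : (4 : 'Z_q) \is a GRing.unit.
    rewrite (_ : 4 = 2 * 2 :> 'Z_q) ?unitrM; first by rewrite (unit2 p_pr p_odd m0).
    by rewrite -natrM.
  rewrite !(gsum_unit p_pr m0 zq m1) ?unitrM ?uh //.
  rewrite (gauss_complete p_pr p_odd m0 zq y.1.1%:~R) ?unitrM ?uh //.
  rewrite (gauss_complete p_pr p_odd m0 zq y.1.2%:~R) ?unitrM ?uh //.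
  rewrite (gauss_complete p_pr p_odd m0 zq y.2%:~R) ?unitrM ?uh //.
  rewrite /c; set g1 := gauss _ _ _; set g2 := gauss _ _ _; set g3 := gauss _ _ _.
  transitivity (psi (- (y.1.1%:~R ^+ 2 / (4 * (h * b.1.1%:~R)))) *
   psi (- (y.1.2%:~R ^+ 2 / (4 * (h * b.1.2%:~R)))) * psi (- (y.2%:~R ^+ 2 / (4 * (h * b.2%:~R)))) *
   (g1 * (g2 * g3))); first by ring.
  rewrite -!(echarD q1 zq); congr (echar _ _ * _).
  have split4 (a x : 'Z_q) : x \is a GRing.unit -> a / (4 * (h * x)) = a / x / (4 * h).
    move=> ux; rewrite [4 * _]mulrA invrM ?unitrM ?u4 ?uh //.
    by rewrite mulrA.
  by rewrite !split4 // /t; ring.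
have volt : (vol b)%:~R * t = (qf (dual b) y)%:~R.
  have d1 : (b.1.1%:~R : 'Z_q) / b.1.1%:~R = 1 by rewrite divrr.
  have d2 : (b.1.2%:~R : 'Z_q) / b.1.2%:~R = 1 by rewrite divrr.
  have d3 : (b.2%:~R : 'Z_q) / b.2%:~R = 1 by rewrite divrr.
  rewrite /vol /qf /bf /dual /= !(rmorphD, rmorphM) /= /t.
  set B1 := b.1.1%:~R in d1 *; set B2 := b.1.2%:~R in d2 *; set B3 := b.2%:~R in d3 *.
  move: d1 d2 d3; move: B1^-1 B2^-1 B3^-1 => i1 i2 i3 d1 d2 d3.
  set x1 := y.1.1%:~R; set x2 := y.1.2%:~R; set x3 := y.2%:~R.
  transitivity ((B1 * i1) * (B2 * B3 * x1 ^+ 2) + (B2 * i2) * (B1 * B3 * x2 ^+ 2)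
     + (B3 * i3) * (B1 * B2 * x3 ^+ 2)); first by ring.
  by rewrite d1 d2 d3; ring.
have pt : (p%:R * t == 0) = (p%:Z ^+ m.-1 %| qf (dual b) y)%Z.
  have uv : ((vol b)%:~R : 'Z_q) \is a GRing.unit.
    by rewrite intr_unit // vol_punit.
  rewrite -(inj_eq (mulrI uv)) mulr0 mulrCA volt -[p%:R]/(p%:Z%:~R) -rmorphM intr_Zp_eq0 //.
  have p0 : p%:Z != 0 by rewrite eqz_nat -lt0n prime_gt0.
  rewrite -[RHS](dvdz_mul2l p0) -exprS prednK //; congr (_ \in dvdz _).
  by rewrite -[LHS]natz natrX natz.
have cb h u : u \is a GRing.unit -> c (h * u ^+ 2) = c h.
  move=> uu; have E' x : h * u ^+ 2 * x = h * x * u ^+ 2 by rewrite mulrAC.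
  by rewrite /c !E' !gauss_sq.
have q0n : q%:R != 0 :> C by apply: lt0r_neq0.
case: ifP => [_|/negbT]; last first.
  rewrite -pt => h; rewrite (salie_vanish h cb) in E.
  by move/eqP: E; rewrite mulf_eq0 (negPf q0n) /= => /eqP ->; rewrite normr0.
rewrite -(ler_pM2l q0) -{1}[q%:R]ger0_norm ?ler0n // -normrM E.
apply: (le_trans (ler_norm_sum _ _ _)).
apply: (@le_trans _ _ (\sum_(h : 'Z_q) sqrtC q%:R ^+ 3)).
  rewrite big_mkcond /=; apply: ler_sum => h _; case: ifP => // uh.
  rewrite normrM (norm_echar q1 zq) mul1r /c !normrM.
  by rewrite !(gauss_norm p_pr p_odd m0 zq) ?unitrM ?uh // !exprS expr0 mulr1.
by rewrite sumr_const card_ord Zp_cast // mulr_natl.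
Qed.
End Level.
End Conic.

Lemma sum_periodic (V : nmodType) (F : nat -> V) p q :
  (forall k, F (k + q)%N = F k) ->
  \sum_(0 <= k < p * q) F k = (\sum_(0 <= k < q) F k) *+ p.
Proof.
move=> hF; rewrite big_nat_mul; under eq_bigr => i _.
  rewrite -{1}[(i * q)%N]add0n big_addn mulSn addnK.
  under eq_bigr => k _.
    have -> : F (k + i * q)%N = F k.
      by elim: i => [|i IH]; rewrite ?mul0n ?addn0 // mulSn [(q + _)%N]addnC addnA hF.
  over.
over.
by rewrite sumr_const_nat subn0.
Qed.

Lemma sum_multiples (V : nmodType) (F : nat -> V) p q N : (0 < p)%N -> N = (q * p)%N ->
  \sum_(0 <= k < N | (p %| k)%N) F k = \sum_(0 <= k < q) F (p * k)%N.
Proof.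
move=> p0 ->; rewrite big_mkcond big_nat_mul; apply: eq_bigr => i _.
rewrite -{1}[(i * p)%N]add0n big_addn mulSn addnK big_ltn //= add0n dvdn_mull //.
rewrite big_nat_cond big1 ?addr0 => [|k /andP[/andP[k0 kp] _]]; first by rewrite mulnC.
by rewrite dvdn_addl ?dvdn_mull // gtnNdvd.
Qed.

(** * Change of modulus for frequencies divisible by p *)

Section Lift.
Variables (C : numClosedFieldType) (p : nat) (b : vec).
Hypotheses (p_pr : prime p) (p_odd : (2 < p)%N) (b_unit : coprimez (vol b) p).

Section Level.
Variables (m : nat) (z : C).
Hypotheses (m0 : (0 < m)%N) (zq : (p ^ m.+1).-primitive_root z).
Notation q := (p ^ m)%N.

Lemma prim_lift : q.-primitive_root (z ^+ p).
Proof.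
have := dvdn_prim_root zq (dvdn_exp2l p (leqnSn m)).
by rewrite expnS mulnK ?expn_gt0 ?prime_gt0.
Qed.

Lemma gsum_intr m' (w : C) (a y : int) : (0 < m')%N -> (p ^ m').-primitive_root w ->
  gsum w (a%:~R : 'Z_(p ^ m')) y%:~R =
  \sum_(0 <= k < p ^ m' | ~~ (p %| k)%N) w ^ (a * k%:Z ^+ 2 + y * k%:Z).
Proof.
move=> m0' wp; rewrite /gsum big_mkcond big_Zp ?q_gt1 // [RHS]big_mkcond /=.
apply: eq_bigr => k _; rewrite unit_natE //; case: ifP => // _.
rewrite -(echar_intr (q_gt1 p_pr m0') _ wp); congr echar.
by rewrite rmorphD (rmorphM _ y) (rmorphM _ a) rmorphXn.
Qed.

Lemma gsum_lift (a y : int) :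
  gsum z ((p%:Z * a)%:~R : 'Z_(p ^ m.+1)) (p%:Z * y)%:~R =
  p%:R * gsum (z ^+ p) (a%:~R : 'Z_q) y%:~R.
Proof.
have wq := prim_lift.
rewrite gsum_intr // (gsum_intr _ _ m0 wq) expnS big_mkcond [in RHS]big_mkcond /=.
pose F k : C := if ~~ (p %| k)%N then (z ^+ p) ^ (a * k%:Z ^+ 2 + y * k%:Z) else 0.
have -> : \sum_(0 <= k < p * q) (if ~~ (p %| k)%N then
   z ^ (p%:Z * a * k%:Z ^+ 2 + p%:Z * y * k%:Z) else 0) = \sum_(0 <= k < p * q) F k.
  apply: eq_bigr => k _; rewrite /F; case: ifP => // _.
  rewrite -[z ^+ p]/(z ^ p%:Z) exprz_exp; congr (_ ^ _); ring.
rewrite sum_periodic ?mulr_natl // => k; rewrite /F.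
rewrite dvdn_addl; last by rewrite dvdn_exp.
case: ifP => // _; rewrite -!(echar_intr (q_gt1 p_pr m0) _ wq); congr echar.
have key (u v : int) : u%:~R = v%:~R :> 'Z_q ->
    (a * u ^+ 2 + y * u)%:~R = (a * v ^+ 2 + y * v)%:~R :> 'Z_q.
  by move=> e; rewrite !rmorphD !(rmorphM _ y) !(rmorphM _ a) !rmorphXn /= e.
by apply: key; rewrite -!pmulrn natrD pchar_Zp ?addr0 // q_gt1.
Qed.

(** All coordinates of the frequency are non-units, so only [h] divisible by [p] survive. Each of
    the three Gauss sums then runs through [p] periods of the lower modulus, and one of the three
    factors [p] goes into the modulus. *)
Lemma csum_lift (y : vec) :
  csum p b m.+1 z (comb p%:Z 0 y 0) = p%:R ^+ 2 * csum p b m (z ^+ p) y.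
Proof.
have wq := prim_lift.
have q0 : ((p ^ m.+1)%:R : C) != 0.
  by rewrite pnatr_eq0 -lt0n expn_gt0 prime_gt0.
apply: (mulfI q0); rewrite (csum_fourier b p_pr _ zq) // /comb /= !mul0r !addr0.
rewrite (bigID (fun h => h \is a GRing.unit)) /= big1 ?add0r => [|h uh]; last first.
  have [ub1 _ _] := bunits p_pr b_unit (ltn0Sn m).
  rewrite (gsum_nonunit_r p_pr p_odd _ zq) ?mul0r ?unitrM ?uh //.
  by rewrite intr_unit // negbK dvdz_mulr.
have -> : (p ^ m.+1)%:R * (p%:R ^+ 2 * csum p b m (z ^+ p) y) =
   p%:R ^+ 3 * (q%:R * csum p b m (z ^+ p) y) by rewrite expnS natrM; ring.
rewrite (csum_fourier b p_pr m0 wq).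
rewrite big_mkcond big_Zp ?q_gt1 // -big_mkcond /=.
under eq_bigl => k do rewrite unit_natE // negbK.
rewrite (sum_multiples _ (prime_gt0 p_pr) (expnSr p m)) big_Zp ?q_gt1 // mulr_sumr.
apply: eq_bigr => k _.
have cast (x : int) : ((p * k)%N%:R * x%:~R : 'Z_(p ^ m.+1)) = (p%:Z * (k%:Z * x))%:~R.
  by rewrite natrM !rmorphM /= -!pmulrn mulrA.
have cast' (x : int) : (k%:R * x%:~R : 'Z_q) = (k%:Z * x)%:~R.
  by rewrite rmorphM /= -pmulrn.
by rewrite !cast !cast' !gsum_lift; ring.
Qed.
End Level.

Lemma csum_liftn j m (z : C) (y : vec) : (0 < m)%N -> (p ^ (j + m)).-primitive_root z ->
  (p ^ m).-primitive_root (z ^+ (p ^ j)) /\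
  csum p b (j + m) z (comb (p%:Z ^+ j) 0 y 0) =
  p%:R ^+ (2 * j) * csum p b m (z ^+ (p ^ j)) y.
Proof.
move=> m0; elim: j z y => [|j IH] z y zq.
  rewrite expn0 expr1 muln0 expr0 mul1r; split=> //; congr csum.
  by case: (y) => [[y1 y2] y3]; rewrite /comb /= !mul1r !mul0r !addr0.
have jm : (0 < j + m)%N by rewrite addn_gt0 m0 orbT.
have [h1 h2] := IH (z ^+ p) y (prim_lift zq).
rewrite expnS exprM; split=> //.
have -> : comb (p%:Z ^+ j.+1) 0 y 0 = comb p%:Z 0 (comb (p%:Z ^+ j) 0 y 0) 0.
  by rewrite /comb /= exprS; congr (_, _, _); ring.
by rewrite (csum_lift jm zq) h2 mulrA -exprD; congr (_ ^+ _ * _); clear; lia.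
Qed.
End Lift.

(** * Quadratic characters and the conic over a finite field *)

Section QuadraticCharacter.
Variables (K : finFieldType).
Hypothesis two0 : (2%:R : K) != 0.

Definition chi (c : K) : int :=
  if c == 0 then 0 else if [exists x, x ^+ 2 == c] then 1 else -1.

Lemma sum_pred1 (x : K) : \sum_y ((y == x)%:R : int) = 1.
Proof.
rewrite (bigD1 x) //= eqxx big1 ?addr0 // => y /negPf ->.
by [].
Qed.

Lemma neg_neq (r : K) : r != 0 -> r != - r.
Proof.
move=> r0; rewrite -subr_eq0 opprK -mulr2n -mulr_natl mulf_eq0 negb_or.
by rewrite two0.
Qed.

Lemma count_sqrt c : \sum_x ((x ^+ 2 == c)%:R : int) = 1 + chi c.
Proof.
rewrite /chi; case: eqP => [->|/eqP c0].
  by rewrite addr0 -[RHS](sum_pred1 0); apply: eq_bigr => x _; rewrite sqrf_eq0.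
case: existsP => [[r /eqP Er]|no]; last first.
  rewrite subrr; apply: big1 => x _; case: eqP => // e.
  by case: no; exists x; apply/eqP.
have r0 : r != 0 by apply: contraNneq c0 => r0; rewrite -Er r0 expr0n.
transitivity (\sum_y ((y == r)%:R : int) + \sum_y ((y == - r)%:R : int)); last first.
  by rewrite !sum_pred1.
rewrite -big_split /=; apply: eq_bigr => x _.
rewrite -Er eqf_sqr; have := neg_neq r0; case: (eqVneq x r) => [->|_] /=.
  by move/negPf ->; rewrite addr0.
by rewrite add0r.
Qed.

Lemma card_sum1 : \sum_(x : K) (1 : int) = #|K|%:R.
Proof. by rewrite sumr_const. Qed.

Lemma sum_chi : \sum_c chi c = 0.
Proof.
have : \sum_(c : K) \sum_(x : K) ((x ^+ 2 == c)%:R : int) = #|K|%:R.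
  rewrite exchange_big /= -card_sum1; apply: eq_bigr => x _.
  by rewrite -[RHS](sum_pred1 (x ^+ 2)); apply: eq_bigr => c _; rewrite eq_sym.
under eq_bigr do rewrite count_sqrt.
by rewrite big_split /= card_sum1 => /eqP; rewrite addrC -subr_eq0 addrK => /eqP.
Qed.

Lemma chi0 : chi 0 = 0. Proof. by rewrite /chi eqxx. Qed.

Lemma chi_sqr c r : r != 0 -> chi (c * r ^+ 2) = chi c.
Proof.
move=> r0; have r20 : r ^+ 2 != 0 by rewrite sqrf_eq0.
rewrite /chi mulf_eq0 (negPf r20) orbF; case: eqP => // _.
suff -> : [exists x, x ^+ 2 == c * r ^+ 2] = [exists x, x ^+ 2 == c] by [].
apply/existsP/existsP => -[x /eqP Ex]; last by exists (x * r); rewrite exprMn Ex.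
by exists (x / r); rewrite expr_div_n Ex mulfK.
Qed.

Lemma chi_cases c : c != 0 -> (exists2 r, r != 0 & c = r ^+ 2) \/ chi c = -1.
Proof.
move=> c0; rewrite /chi (negPf c0); case: existsP => [[r /eqP Er]|]; last by right.
left; exists r => //; apply: contraNneq c0 => r0.
by rewrite -Er r0 expr0n.
Qed.

Lemma chi1 : chi 1 = 1.
Proof.
rewrite /chi oner_eq0; case: existsP => // h; case: h; exists 1.
by rewrite expr1n.
Qed.

Lemma chi_le1 c : chi c <= 1.
Proof. by rewrite /chi; case: ifP => // _; case: ifP. Qed.

(* The terms [chi (c * d) + chi d] are non-positive and sum to zero. *)
Lemma chiM c d : chi (c * d) = chi c * chi d.
Proof.
have [->|c0] := eqVneq c 0; first by rewrite mul0r chi0 mul0r.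
have [[r r0 ->]|hc] := chi_cases c0.
  by rewrite mulrC chi_sqr // -[r ^+ 2]mul1r chi_sqr // chi1 mul1r.
have term e : chi (c * e) + chi e <= 0.
  have [->|e0] := eqVneq e 0; first by rewrite mulr0 chi0.
  have [[r r0 ->]|->] := chi_cases e0.
    by rewrite chi_sqr // -[r ^+ 2]mul1r chi_sqr // chi1 hc.
  by rewrite subr_le0 chi_le1.
have : \sum_e (- (chi (c * e) + chi e)) = 0.
  rewrite sumrN big_split /= sum_chi addr0.
  have -> : \sum_e chi (c * e) = \sum_e chi e.
    by rewrite [RHS](reindex_inj (mulfI c0)).
  by rewrite sum_chi oppr0.
move/eqP; rewrite psumr_eq0 => [/allP h|e _]; last by rewrite oppr_ge0.
have := h d (mem_index_enum d); rewrite /= oppr_eq0 addr_eq0 => /eqP ->.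
by rewrite hc mulN1r.
Qed.

Lemma chi_div c d : d != 0 -> chi (c / d) = chi (c * d).
Proof.
move=> d0; rewrite -(chi_sqr (c / d) d0); congr chi.
by rewrite expr2 mulrA divfK.
Qed.

(** Counts the solutions of u ^ 2 = v ^ 2 + e through s = u - v: the equation becomes s (s + 2 v) =
    e, with one v for each nonzero s. *)
Lemma jacobsthal e : e != 0 -> \sum_v chi (v ^+ 2 + e) = -1.
Proof.
move=> e0; have : \sum_(v : K) \sum_(u : K) ((u ^+ 2 == v ^+ 2 + e)%:R : int) = #|K|%:R - 1.
  transitivity (\sum_(v : K) \sum_(s : K) ((s * (s + 2 * v) == e)%:R : int)).
    apply: eq_bigr => v _; rewrite (reindex_inj (addIr v)) /=; apply: eq_bigr => s _.
    congr (nat_of_bool _)%:R; rewrite -subr_eq0 -[RHS]subr_eq0; congr (_ == _).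
    by ring.
  rewrite exchange_big /= (bigD1 0) //= big1 => [|v _]; last first.
    by rewrite mul0r eq_sym (negPf e0).
  have -> : #|K|%:R - 1 = \sum_(s : K | s != 0) (1 : int).
    by rewrite -card_sum1 (bigD1 (0 : K)) //= addrAC subrr add0r.
  rewrite add0r; apply: eq_bigr => s s0.
  rewrite -[RHS](sum_pred1 ((e / s - s) / 2)); apply: eq_bigr => v _.
  congr (nat_of_bool _)%:R; apply/eqP/eqP => [<-|->];
    by field; rewrite ?s0 ?two0.
under eq_bigr do rewrite count_sqrt.
by rewrite big_split /= card_sum1 => /addrI.
Qed.

(** Scaling by x1 reduces to a1 + a2 u ^ 2 + a3 v ^ 2 = 0 with u, v nonzero. From the affine count
    given by [jacobsthal] the points on the two axes are removed; none lies on both, as a1 != 0. *)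
Lemma count_conic a1 a2 a3 : a1 != 0 -> a2 != 0 -> a3 != 0 ->
  \sum_(x1 : K | x1 != 0) \sum_(x2 : K | x2 != 0) \sum_(x3 : K | x3 != 0)
     ((a1 * x1 ^+ 2 + a2 * x2 ^+ 2 + a3 * x3 ^+ 2 == 0)%:R : int) =
  (#|K|%:R - 1) * (#|K|%:R - (2 + chi (- (a1 * a2)) + chi (- (a1 * a3)) + chi (- (a2 * a3)))).
Proof.
move=> h1 h2 h3.
pose f (u v : K) : int := (a1 + a2 * u ^+ 2 + a3 * v ^+ 2 == 0)%:R.
have tot : \sum_u \sum_v f v u = #|K|%:R - chi (- (a2 * a3)).
  transitivity (\sum_(v : K) (1 + chi ((- a3 / a2) * (v ^+ 2 + a1 / a3)))).
    apply: eq_bigr => v _; rewrite -count_sqrt; apply: eq_bigr => u _; rewrite /f.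
    congr (nat_of_bool _)%:R; rewrite -[RHS]subr_eq0 -[RHS](inj_eq (mulfI h2)) mulr0.
    congr (_ == _).
    have -> : a2 * (u ^+ 2 - - a3 / a2 * (v ^+ 2 + a1 / a3)) =
      a2 * u ^+ 2 + (a2 / a2) * (a3 * v ^+ 2 + a3 / a3 * a1) by ring.
    by rewrite !divff // !mul1r; ring.
  rewrite big_split /= card_sum1; under eq_bigr do rewrite chiM.
  rewrite -mulr_sumr jacobsthal ?mulf_neq0 ?invr_eq0 // chi_div //.
  by rewrite mulrN1 mulNr [a3 * a2]mulrC.
have line0 a c : c != 0 -> \sum_v ((a + c * v ^+ 2 == 0)%:R : int) = 1 + chi (- (a * c)).
  move=> c0; rewrite -mulNr -chi_div // -count_sqrt; apply: eq_bigr => v _.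
  congr (nat_of_bool _)%:R; rewrite addrC addr_eq0 -[RHS](inj_eq (mulfI c0)).
  by rewrite [c * (_ / _)]mulrC divfK.
have uv : \sum_(u | u != 0) \sum_(v | v != 0) f u v =
   #|K|%:R - (2 + chi (- (a1 * a2)) + chi (- (a1 * a3)) + chi (- (a2 * a3))).
  have row u : \sum_v f u v = \sum_(v | v != 0) f u v + (a1 + a2 * u ^+ 2 == 0)%:R.
    by rewrite (bigD1 0) //= addrC /f expr0n mulr0 addr0.
  have e0 : \sum_v f 0 v = 1 + chi (- (a1 * a3)).
    by rewrite -line0 //; apply: eq_bigr => v _; rewrite /f expr0n mulr0 addr0.
  have e1 : \sum_u ((a1 + a2 * u ^+ 2 == 0)%:R : int) = 1 + chi (- (a1 * a2)) by rewrite line0.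
  have t2 : \sum_u \sum_v f u v = #|K|%:R - chi (- (a2 * a3)).
    by rewrite exchange_big.
  have : \sum_u \sum_v f u v = \sum_(u | u != 0) \sum_(v | v != 0) f u v
      + (1 + chi (- (a1 * a2))) + (1 + chi (- (a1 * a3))).
    rewrite (bigD1 0) //= e0 addrC; congr (_ + _).
    under eq_bigr do rewrite row; rewrite big_split /=; congr (_ + _).
    rewrite -e1 [RHS](bigD1 0) //= expr0n mulr0 addr0 (negPf h1) add0r.
    by [].
  by rewrite t2 => e; move: e; lia.
transitivity (\sum_(x1 : K | x1 != 0) \sum_(u | u != 0) \sum_(v | v != 0) f u v).
  apply: eq_bigr => x1 x10; rewrite (reindex_inj (mulfI x10)) /=.
  apply: eq_big => u; first by rewrite mulf_eq0 (negPf x10).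
  rewrite mulf_eq0 (negPf x10) => u0; rewrite (reindex_inj (mulfI x10)) /=.
  apply: eq_big => v; first by rewrite mulf_eq0 (negPf x10).
  move=> v0; rewrite /f; congr (nat_of_bool _)%:R.
  have x12 : x1 ^+ 2 != 0 by rewrite sqrf_eq0.
  rewrite -[RHS](inj_eq (mulfI x12)) mulr0; congr (_ == _); ring.
rewrite uv sumr_const -[LHS]mulr_natl; congr (_ * _).
have -> : #|[pred x : K | x != 0]| = #|K|.-1 by rewrite (cardC1 (0 : K)).
by rewrite -subn1 natrB // (cardD1 (0 : K)).
Qed.
End QuadraticCharacter.

Lemma legendre_chi p (a : int) : prime p -> legendre a p = chi (a%:~R : 'F_p).
Proof.
move=> p_pr; have p1 := prime_gt1 p_pr; have p0 := prime_gt0 p_pr.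
have Fp0 (x : int) : ((x%:~R : 'F_p) == 0) = (p %| x)%Z.
  have nat_case k : ((k%:R : 'F_p) == 0) = (p %| k)%N.
    by rewrite -(inj_eq val_inj) /= val_Fp_nat.
  case: x => k; first by rewrite -pmulrn nat_case.
  by rewrite NegzE mulrNz oppr_eq0 -pmulrn nat_case dvdzE.
rewrite /legendre /chi Fp0; case: ifP => // _.
suff -> : [exists x : 'I_p, (p %| x%:Z ^+ 2 - a)%Z] = [exists x : 'F_p, x ^+ 2 == a%:~R] by [].
apply/existsP/existsP => -[x hx].
  exists x%:R; rewrite -subr_eq0.
  have -> : x%:R ^+ 2 - a%:~R = (x%:Z ^+ 2 - a)%:~R :> 'F_p.
    by rewrite rmorphB rmorphXn /= -pmulrn.
  by rewrite Fp0.
have xp : (x < p)%N by rewrite -{2}(Fp_cast p_pr) ltn_ord.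
exists (Ordinal xp); rewrite -Fp0 rmorphB rmorphXn /= subr_eq0 -pmulrn.
have -> // : (x : nat)%:R = x :> 'F_p.
by apply: val_inj; rewrite /= val_Fp_nat // modn_small.
Qed.

Section ConicCount.
Variables (C : numClosedFieldType) (p : nat) (b : vec).
Hypotheses (p_pr : prime p) (p_odd : (2 < p)%N) (b_unit : coprimez (vol b) p).

Lemma conic_count_Fp :
  \sum_(x1 : 'F_p | x1 \is a GRing.unit) \sum_(x2 : 'F_p | x2 \is a GRing.unit)
  \sum_(x3 : 'F_p | x3 \is a GRing.unit)
    (b.1.1%:~R * x1 ^+ 2 + b.1.2%:~R * x2 ^+ 2 + b.2%:~R * x3 ^+ 2 == 0)%:R =
  ((p%:Z - s_p p b.1.1 b.1.2 b.2) * (p%:Z - 1))%:~R :> C.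
Proof.
have Fp0 (x : int) : ((x%:~R : 'F_p) == 0) = (p %| x)%Z.
  have nat_case k : ((k%:R : 'F_p) == 0) = (p %| k)%N.
    by rewrite -(inj_eq val_inj) /= val_Fp_nat.
  case: x => k; first by rewrite -pmulrn nat_case.
  by rewrite NegzE mulrNz oppr_eq0 -pmulrn nat_case dvdzE.
have ub := vol_punit p_pr b_unit; rewrite /vol in ub.
have u1 : (b.1.1%:~R : 'F_p) != 0.
  by rewrite Fp0; apply: contra ub => h; apply: dvdz_mulr; apply: dvdz_mulr.
have u2 : (b.1.2%:~R : 'F_p) != 0.
  by rewrite Fp0; apply: contra ub => h; apply: dvdz_mulr; apply: dvdz_mull.
have u3 : (b.2%:~R : 'F_p) != 0.
  by rewrite Fp0; apply: contra ub => h; apply: dvdz_mull.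
have two0 : (2%:R : 'F_p) != 0.
  have := Fp0 2; rewrite -[2%:~R]/(2%:R) => ->; exact: (punit2 p_odd).
have -> : s_p p b.1.1 b.1.2 b.2 = 2 + chi (- (b.1.1%:~R * b.1.2%:~R) : 'F_p)
  + chi (- (b.1.1%:~R * b.2%:~R) : 'F_p) + chi (- (b.1.2%:~R * b.2%:~R) : 'F_p).
  by rewrite /s_p !legendre_chi // !rmorphN /= !rmorphM.
have := count_conic two0 u1 u2 u3; rewrite card_Fp //.
move/(congr1 (fun x : int => x%:~R : C)).
rewrite mulrC !natz => <-; rewrite rmorph_sum /=.
apply: eq_big => [x1|x1 _]; first by rewrite unitfE.
rewrite rmorph_sum /=; apply: eq_big => [x2|x2 _]; first by rewrite unitfE.
rewrite rmorph_sum /=; apply: eq_big => [x3|x3 _]; first by rewrite unitfE.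
by case: (_ == 0).
Qed.

Lemma csum_mod_p (z : C) :
  csum p b 1 z 0 = ((p%:Z - s_p p b.1.1 b.1.2 b.2) * (p%:Z - 1))%:~R.
Proof.
pose S N : C := \sum_(x1 : 'Z_N | x1 \is a GRing.unit) \sum_(x2 : 'Z_N | x2 \is a GRing.unit)
  \sum_(x3 : 'Z_N | x3 \is a GRing.unit)
    (b.1.1%:~R * x1 ^+ 2 + b.1.2%:~R * x2 ^+ 2 + b.2%:~R * x3 ^+ 2 == 0)%:R.
have -> : csum p b 1 z 0 = S (p ^ 1)%N.
  apply: eq_bigr => x1 _; apply: eq_bigr => x2 _; apply: eq_bigr => x3 _.
  by rewrite !mul0r !addr0 echar0 mulr1.
(* The field 'F_p is by definition the ring of residues modulo [pdiv p]. *)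
have -> : (p ^ 1)%N = pdiv p by rewrite expn1 pdiv_id.
exact: conic_count_Fp.
Qed.

(** The zero frequency is its own dilation by p ^ (n - 1), so the lifting formula takes the place of
    Hensel's lemma. *)
Lemma csum0 n (z : C) : (0 < n)%N -> (p ^ n).-primitive_root z ->
  csum p b n z 0 = ((p%:Z - s_p p b.1.1 b.1.2 b.2) * (p%:Z - 1))%:~R * p%:R ^+ (2 * n.-1).
Proof.
case: n => // n _; rewrite -[n.+1]addn1 => zq.
have [_] := csum_liftn p_pr p_odd b_unit (0 : vec) (ltn0Sn 0) zq.
have -> : comb (p%:Z ^+ n) 0 0 0 = 0.
  by rewrite /comb /= !mulr0 addr0.
by move=> ->; rewrite csum_mod_p addn1 mulrC.
Qed.
End ConicCount.

(** * Exponential sums weighted by a Schwartz function *)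

Section Cis.
Variable R : realType.

Definition cis (t : R) : R[i] := Complex (cos t) (sin t).

Lemma cisD s t : cis (s + t) = cis s * cis t.
Proof.
apply/eqP; rewrite eq_complex /= cosD sinD addrC [cos s * _ + _]addrC.
by apply/andP; split; apply/eqP; ring.
Qed.

Lemma cis0 : cis 0 = 1.
Proof. by rewrite /cis cos0 sin0. Qed.

Lemma cisX t n : cis t ^+ n = cis (n%:R * t).
Proof.
elim: n => [|n IH]; first by rewrite expr0 mul0r cis0.
by rewrite exprS IH -cisD -natr1 mulrDl mul1r addrC.
Qed.

Lemma norm_1_cis t : `|1 - cis t| = (2 * `|sin (t / 2)|)%:C%C.
Proof.
rewrite normc_def /=; congr (_ %:C)%C.
have -> : (1 - cos t) ^+ 2 + (0 - sin t) ^+ 2 = (2 * sin (t / 2)) ^+ 2.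
  have h1 := cos2Dsin2 t; have h2 := cos2Dsin2 (t / 2).
  have h3 : cos t = cos (t / 2) * cos (t / 2) - sin (t / 2) * sin (t / 2).
    by rewrite -cosD -splitr.
  have -> : (1 - cos t) ^+ 2 + (0 - sin t) ^+ 2 = 1 - 2 * cos t + (cos t ^+ 2 + sin t ^+ 2) by ring.
  have {}h2 : cos (t / 2) ^+ 2 = 1 - sin (t / 2) ^+ 2 by exact: (canRL (addrK _) h2).
  by rewrite h1 h3 -!expr2 h2; ring.
by rewrite sqrtr_sqr normrM ger0_norm.
Qed.

(** A weak Jordan inequality. Up to 1 the mean value theorem gives the slope cos 1; beyond 1 the
    sine is at least sin 1 >= cos 1, while x <= pi / 2 < 2. *)
Lemma sin_lower x : 0 <= x -> x <= pi / 2 -> cos 1 / 2 * x <= sin x :> R.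
Proof.
move=> x0 xp; have c0 := cos1_gt0 R; have ph := pihalf_lt2 R.
have small y : 0 <= y -> y <= 1 -> cos 1 * y <= sin y :> R.
  move=> y0 y1; have [|c cy] := @MVT_segment R sin cos 0 y y0 (fun x _ => is_derive_sin x).
  - by apply: continuous_subspaceT => ?; exact: continuous_sin.
  rewrite sin0 !subr0 => ->; apply: ler_wpM2r => //.
  move: cy; rewrite in_itv /= => /andP[c1 c2].
  have p1 : 1 <= (pi : R) by apply: le_trans (pi_ge2 R); rewrite ler1n.
  have [->//|c1'] := eqVneq c 1; apply: ltW.
  have {}c1' : c < 1 by rewrite lt_neqAle c1' (le_trans c2).
  have i1 : 1 \in `[0, (pi : R)] by rewrite in_itv /= ler01 p1.
  have ic : c \in `[0, (pi : R)] by rewrite in_itv /= c1 (le_trans (ltW c1')).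
  by rewrite (ltr_cos ic i1).
have [x1|x1] := leP x 1.
  apply: le_trans (small _ x0 x1); rewrite ler_wpM2r //; lra.
have s1 := small 1 ler01 (lexx 1); rewrite mulr1 in s1.
apply: (@le_trans _ _ (cos 1)).
  rewrite -mulrA ger_pMr // ; lra.
apply: (le_trans s1); apply: ltW.
have i1 : 1 \in `[- (pi / 2), (pi : R) / 2] by rewrite in_itv /=; apply/andP; split; lra.
have ix : x \in `[- (pi / 2), (pi : R) / 2] by rewrite in_itv /=; apply/andP; split; lra.
by rewrite (ltr_sin i1 ix).
Qed.

Variable q : nat.
Hypothesis q0 : (0 < q)%N.

Definition zeta : R[i] := cis (2 * pi / q%:R).

Lemma zetaX k : zeta ^+ k = cis (2 * pi * (k%:R / q%:R)).
Proof. by rewrite /zeta cisX; congr cis; ring. Qed.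

Lemma zeta_dist_nat k : (2 * k <= q)%N ->
  (cos 1 * pi * (k%:R / q%:R))%:C%C <= `|1 - zeta ^+ k|.
Proof.
move=> kq; rewrite zetaX norm_1_cis lecR; set t := k%:R / q%:R.
have t0 : 0 <= t by rewrite divr_ge0.
have t1 : t <= 1 / 2.
  rewrite ler_pdivrMr ?ltr0n // mulrC mulrA mulr1 ler_pdivlMr // -natrM ler_nat mulnC //.
have p0 := pi_gt0 R.
have -> : 2 * pi * t / 2 = pi * t by field.
have s := @sin_lower (pi * t) (mulr_ge0 (ltW p0) t0) _.
apply: (@le_trans _ _ (2 * sin (pi * t))); last by rewrite ler_pM2l // ler_norm.
apply: (@le_trans _ _ (2 * (cos 1 / 2 * (pi * t)))).
  by rewrite le_eqVlt; apply/orP; left; apply/eqP; field.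
rewrite ler_pM2l //; apply: s; rewrite ler_pM2l //.
by rewrite -[_^-1]mul1r.
Qed.

Lemma norm_zeta : `|zeta| = 1.
Proof. by rewrite normc_def /= cos2Dsin2 sqrtr1. Qed.

Lemma zeta_dist (k : int) : (2 * `|k| <= q)%N ->
  (cos 1 * pi * (`|k|%N%:R / q%:R))%:C%C <= `|1 - zeta ^ k|.
Proof.
case: k => k; first exact: zeta_dist_nat.
rewrite NegzE abszN -exprnN => /zeta_dist_nat h; apply: (le_trans h).
have z0 : zeta ^+ k.+1 != 0 by rewrite -normr_eq0 normrX norm_zeta expr1n oner_eq0.
have -> : 1 - zeta ^- k.+1 = - (1 - zeta ^+ k.+1) * zeta ^- k.+1.
  by rewrite opprB mulrBl divff // mul1r.
by rewrite normrM normrN normrV ?unitfE // normrX norm_zeta expr1n invr1 mulr1.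
Qed.

Lemma zeta_prim : q.-primitive_root zeta.
Proof.
have zq : zeta ^+ q = 1.
  have q0' : (q%:R : R) != 0 by rewrite pnatr_eq0 -lt0n.
  rewrite zetaX divff // mulr1 /cis.
  by rewrite mulr_natl cos2pi sin2pi.
rewrite /primitive_root_of_unity q0 /=; apply/forallP => i; rewrite unity_rootE.
apply/eqP; have [->|ne] := eqVneq i.+1 q; first by rewrite zq eqxx.
apply/negP => /eqP e; have iq : (i.+1 < q)%N by rewrite ltn_neqAle ne ltn_ord.
have : `|1 - zeta ^+ i.+1| = 0 by rewrite e subrr normr0.
rewrite zetaX norm_1_cis => -[] /eqP; rewrite mulf_eq0 pnatr_eq0 /= normr_eq0.
apply/negP; apply: lt0r_neq0; apply: sin_gt0_pi.
have p0 := pi_gt0 R; have q0' : (0 : R) < q%:R by rewrite ltr0n.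
have -> : 2 * pi * (i.+1%:R / q%:R) / 2 = pi * (i.+1%:R / q%:R) :> R by field; rewrite gt_eqF.
rewrite mulr_gt0 ?divr_gt0 ?ltr0n //= -[ltRHS]mulr1 ltr_pM2l //.
by rewrite ltr_pdivrMr // mul1r ltr_nat.
Qed.
End Cis.

(** * Repeated summation by parts *)

Section Abel.
Variable (C : numDomainType).

Definition fdiff (a : nat -> C) (i : nat) : C := a i.+1 - a i.

Lemma abel_summation (a : nat -> C) w n :
  (1 - w) * \sum_(0 <= i < n) a i * w ^+ i =
  a 0%N - a n * w ^+ n + w * \sum_(0 <= i < n) fdiff a i * w ^+ i.
Proof.
elim: n => [|n IH]; first by rewrite !big_geq // expr0 mulr1 subrr !mulr0 add0r.
by rewrite !big_nat_recr //= mulrDr IH mulrDr /fdiff !exprS; ring.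
Qed.

Lemma abel_bound A (a : nat -> C) w n : `|w| = 1 ->
  `|1 - w| ^+ A * `|\sum_(0 <= i < n) a i * w ^+ i| <=
  \sum_(0 <= j < A) 2 ^+ A * (`|iter j fdiff a 0| + `|iter j fdiff a n|)
  + \sum_(0 <= i < n) `|iter A fdiff a i|.
Proof.
move=> w1; have w2 : `|1 - w| <= 2.
  by rewrite (le_trans (ler_normB _ _)) // normr1 w1.
have wX k : `|w ^+ k| = 1 by rewrite normrX w1 expr1n.
elim: A a => [|A IH] a.
  rewrite expr0 mul1r [X in _ <= X + _]big_geq // add0r; apply: (le_trans (ler_norm_sum _ _ _)).
  by apply: ler_sum => i _; rewrite normrM wX mulr1.
rewrite exprSr -mulrA -normrM abel_summation.
apply: (@le_trans _ _ (`|1 - w| ^+ A * (`|a 0%N| + `|a n|) +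
   `|1 - w| ^+ A * `|\sum_(0 <= i < n) fdiff a i * w ^+ i|)).
  rewrite -mulrDr ler_wpM2l ?exprn_ge0 //.
  apply: (le_trans (ler_normD _ _)); rewrite normrM w1 mul1r lerD2r.
  by apply: (le_trans (ler_normB _ _)); rewrite normrM wX mulr1.
apply: (le_trans (lerD _ (IH (fdiff a)))).
  apply: (ler_wpM2r (addr_ge0 (normr_ge0 _) (normr_ge0 _))).
  exact: (lerXn2r A (normr_ge0 _ : _ \is Num.nneg) (ler0n _ 2 : _ \is Num.nneg) w2).
rewrite big_nat_recl //= addrA lerD //; last first.
  by apply: ler_sum => i _; rewrite -iterSr.
have X2 : 2 ^+ A <= 2 ^+ A.+1 :> C.
  by rewrite exprS ler_peMl ?exprn_ge0 // ler1n.
rewrite lerD //; first by rewrite ler_wpM2r // addr_ge0.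
apply: ler_sum => j _; rewrite -!iterSr.
by rewrite ler_wpM2r // addr_ge0.
Qed.
End Abel.

(** * Finite differences of Schwartz functions *)

Section Smooth.
Variable R : realType.
Implicit Types (f g : R -> R) (x h : R).

Definition step h f x : R := f (x + h) - f x.
Definition smooth f := forall m x, derivable (derive1n m f) x 1.

Lemma sqr_shift x y : `|y - x| <= 1 -> 1 + x ^+ 2 <= 3 * (1 + y ^+ 2).
Proof.
move=> h; have : (y - x) ^+ 2 <= 1.
  by rewrite -[leRHS](expr1n _ 2%N) -real_normK ?num_real // lerXn2r ?nnegrE.
have := sqr_ge0 (y + (y - x)); have := sqr_ge0 y.
move: (y - x) (subKr y x) => s <-; nra.
Qed.

(** The mean value theorem, together with the fact that the weight 1 + x ^ 2 changes by a factor of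
    at most 3 over a distance of at most 1. *)
Lemma step_bound f f' C h x : 0 < h <= 1 -> (forall x, is_derive x 1 f (f' x)) ->
  (forall x, `|f' x| * (1 + x ^+ 2) <= C) ->
  exists2 y, step h f x = h * f' y & `|step h f x| * (1 + x ^+ 2) <= 3 * h * C.
Proof.
move=> /andP[h0 h1] df bf'.
have xh : x <= x + h by rewrite lerDl ltW.
have cf : {within `[x, (x + h)], continuous f}.
  apply: continuous_subspaceT => y.
  exact/differentiable_continuous/derivable1_diffP.
have [y yx E] := @MVT_segment R f f' x (x + h) xh (fun x _ => df x) cf.
have E' : step h f x = h * f' y by rewrite /step E addrAC subrr add0r mulrC.
exists y => //; rewrite E' normrM (gtr0_norm h0).
have xy : 1 + x ^+ 2 <= 3 * (1 + y ^+ 2).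
  apply: sqr_shift; move: yx; rewrite in_itv /= => /andP[y1 y2].
  by rewrite ger0_norm ?subr_ge0 // lerBlDl (le_trans y2) // lerD2l.
have -> : 3 * h * C = h * (3 * C) by ring.
rewrite -mulrA ler_pM2l //.
apply: (@le_trans _ _ (`|f' y| * (3 * (1 + y ^+ 2)))); first by rewrite ler_wpM2l.
by rewrite mulrCA ler_pM2l.
Qed.

Lemma smooth_is_derive f m x : smooth f -> is_derive x 1 (derive1n m f) (derive1n m.+1 f x).
Proof.
move=> sf; rewrite derive1nS derive1E; apply: DeriveDef => //; exact: sf.
Qed.

Lemma is_derive_step f f' h x : (forall x, is_derive x 1 f (f' x)) ->
  is_derive x 1 (step h f) (step h f' x).
Proof.
move=> df.
have sh : is_derive x 1 (fun x => x + h) 1.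
  by rewrite -[X in is_derive _ _ _ X]addr0; apply: is_deriveD.
have d1 : is_derive x 1 (fun x => f (x + h)) (f' (x + h)).
  have := @is_derive1_comp _ f (fun x => x + h) x _ _ (df (x + h)) sh.
  by rewrite mulr1.
exact: (is_deriveB d1 (df x)).
Qed.

Lemma derive1n_step f h m : smooth f -> derive1n m (step h f) = step h (derive1n m f).
Proof.
move=> sf; elim: m => [//|m IH]; rewrite derive1nS IH; apply/funext => x.
rewrite derive1E; have := @is_derive_step (derive1n m f) (derive1n m.+1 f) h x
  (fun y => smooth_is_derive m y sf).
by move=> [_ ->].
Qed.

Lemma smooth_step f h : smooth f -> smooth (step h f).
Proof.
move=> sf m x; rewrite derive1n_step //.
by have [] := @is_derive_step (derive1n m f) (derive1n m.+1 f) h x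
  (fun y => smooth_is_derive m y sf).
Qed.

Lemma iter_step_bound A f C h : smooth f -> 0 < h <= 1 ->
  (forall x, `|derive1n A f x| * (1 + x ^+ 2) <= C) ->
  forall x, `|iter A (step h) f x| * (1 + x ^+ 2) <= (3 * h) ^+ A * C.
Proof.
move=> sf hh; elim: A f C sf => [|A IH] f C sf bf x.
  by rewrite expr0 mul1r; apply: bf.
rewrite iterSr (exprSr (3 * h)) -[leRHS]mulrA; apply: IH; first by apply: smooth_step; exact: sf.
move=> y; rewrite derive1n_step //.
by have [] := @step_bound (derive1n A f) (derive1n A.+1 f) C h y hh
  (fun y => smooth_is_derive A y sf) bf.
Qed.

Lemma schwartz_decay f : schwartz f -> forall m, exists2 C, 0 < C &
  forall x, `|derive1n m f x| * (1 + x ^+ 2) <= C.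
Proof.
move=> [_ sf] m; have [C0 h0] := sf 0%N m; have [C2 h2] := sf 2%N m.
exists (`|C0| + `|C2| + 1).
  by rewrite ltr_pwDr // addr_ge0.
move=> x; have := h0 x; have := h2 x; rewrite expr0 mul1r => a2 a0.
rewrite mulrDr mulr1 mulrC -[x ^+ 2]ger0_norm ?sqr_ge0 // normrX.
have := ler_norm C0; have := ler_norm C2; lra.
Qed.

(** Past the first term there is a telescoping majorant, (2 / h) (1 / (1 + t) - 1 / (1 + t + h))
    with t = k h. *)
Lemma sum_decay_half h n : 0 < h <= 1 ->
  \sum_(0 <= k < n) (1 + (k%:R * h) ^+ 2)^-1 <= 3 / h.
Proof.
move=> /andP[h0 h1].
case: n => [|n]; first by rewrite big_geq // divr_ge0 // ltW.
have h3 : 3 / h = 1 / h + 2 / h by rewrite -mulrDl.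
rewrite big_nat_recl // mul0r expr0n addr0 invr1 h3 lerD //.
  by rewrite ler_pdivlMr // mul1r.
suff : \sum_(0 <= k < n) (1 + (k.+1%:R * h) ^+ 2)^-1 <= 2 / h * (1 - (1 + n%:R * h)^-1).
  move/le_trans; apply; rewrite ger_pMr ?divr_gt0 // gerBl invr_ge0.
  by rewrite addr_ge0 // mulr_ge0 // ltW.
elim: n => [|n IH]; first by rewrite big_geq // mul0r addr0 invr1 subrr mulr0.
rewrite big_nat_recr //=; apply: (le_trans (lerD IH (lexx _))).
set t := n%:R * h; have t0 : 0 <= t by rewrite mulr_ge0 // ltW.
have -> : n.+1%:R * h = t + h by rewrite -natr1 mulrDl mul1r.
have u1 : 0 < 1 + t by rewrite ltr_pwDl.
have u2 : 0 < 1 + (t + h) by rewrite ltr_pwDl // addr_ge0 // ltW.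
have key : (1 + (t + h) ^+ 2)^-1 <= 2 / h * ((1 + t)^-1 - (1 + (t + h))^-1).
  have -> : 2 / h * ((1 + t)^-1 - (1 + (t + h))^-1) = 2 / ((1 + t) * (1 + (t + h))).
    by field; rewrite !gt_eqF.
  have u3 : 0 < 1 + (t + h) ^+ 2 by rewrite ltr_pwDl // sqr_ge0.
  rewrite ler_pdivlMr ?mulr_gt0 // mulrC ler_pdivrMr //.
  have := sqr_ge0 (t + h - 1); have : 0 <= h * (1 + (t + h)) by rewrite mulr_ge0 // ltW.
  move: u1 u2; clear; nra.
by move: key; rewrite !mulrBr; lra.
Qed.

Lemma sum_decay h T : 0 < h <= 1 ->
  \sum_(0 <= i < T + T) (1 + ((i%:R - T%:R) * h) ^+ 2)^-1 <= 6 / h.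
Proof.
move=> hh; have -> : 6 / h = 3 / h + 3 / h by rewrite -mulrDl -natrD.
rewrite (@big_cat_nat _ _ _ T) ?leq_addr //= lerD //.
  rewrite big_nat_rev /= add0n.
  apply: le_trans (sum_decay_half T.+1 hh); rewrite big_nat_recl //.
  apply: ler_wpDl; first by rewrite invr_ge0 addr_ge0 // sqr_ge0.
  rewrite big_nat [leRHS]big_nat; apply: ler_sum => i /andP[_ iT].
  by rewrite natrB // addrAC subrr add0r mulNr sqrrN.
rewrite -{1}[T]add0n big_addn addnK; apply: le_trans (sum_decay_half T hh).
by apply: ler_sum => i _; rewrite natrD addrK.
Qed.
End Smooth.

(** * Riemann sums and the integral *)

Section RiemannSum.
Variable R : realType.
Variable f : R -> R.
Hypotheses (sf : schwartz f) (f0 : forall x, 0 <= f x).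
Local Notation mu := (@lebesgue_measure R).

Lemma schwartz_continuous : continuous f.
Proof.
move=> x; apply/differentiable_continuous/derivable1_diffP.
by have := sf.1 0%N x.
Qed.

Lemma schwartz_measurable (D : set R) : measurable_fun D (fun x => (f x)%:E).
Proof.
apply/measurable_EFinP; apply: measurable_funTS.
by apply: continuous_measurable_fun; exact: schwartz_continuous.
Qed.

Lemma integral_cell (a h e : R) : 0 < h -> 0 <= e ->
  (forall t, a <= t <= a + h -> `|f t - f a| <= e) ->
  ((h * (f a - e))%R%:E <= \int[mu]_(x in `[a, (a + h)%R[) (f x)%:E <= (h * (f a + e))%R%:E)%E.
Proof.
move=> h0 e0 he.
have muI : mu `[a, (a + h)[ = h%:E.
  by rewrite lebesgue_measure_itv /= lte_fin ltrDl h0 -EFinD addrAC subrr add0r.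
have mI : measurable (`[a, (a + h)[ : set R) by exact: measurable_itv.
have bnd t : `[a, (a + h)[%classic t -> f a - e <= f t <= f a + e.
  rewrite /= in_itv /= => /andP[t1 t2]; have := he t; rewrite t1 ltW // => /(_ isT).
  by rewrite ler_distl.
have icst r : (\int[mu]_(x in `[a, (a + h)%R[) r%:E = (h * r)%R%:E)%E.
  by rewrite integral_cst // EFinM muleC; congr (_ * _)%E.
apply/andP; split.
  (* Monotonicity is used for nonnegative integrands, so a nonpositive lower bound is treated
     apart. *)
  have [neg|pos] := leP (f a - e) 0.
    apply: (@le_trans _ _ 0%E); first by rewrite lee_fin mulr_ge0_le0 // ltW.
    by apply: integral_ge0 => x _; rewrite lee_fin.
  rewrite -icst; apply: ge0_le_integral => //.
  - by move=> x _; rewrite lee_fin ltW.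
  - exact: schwartz_measurable.
  - by move=> x /bnd /andP[]; rewrite lee_fin.
rewrite -icst; apply: ge0_le_integral => //.
- by move=> x _; rewrite lee_fin.
- exact: schwartz_measurable.
- by move=> x /bnd /andP[]; rewrite lee_fin.
Qed.

Lemma integral_grid (a h : R) (e : nat -> R) n : 0 < h -> (forall i, 0 <= e i) ->
  (forall i t, a + i%:R * h <= t <= a + i%:R * h + h ->
     `|f t - f (a + i%:R * h)| <= e i) ->
  ((h * \sum_(0 <= i < n) (f (a + i%:R * h) - e i))%R%:E <=
   \int[mu]_(x in `[a, (a + n%:R * h)%R[) (f x)%:E <=
   (h * \sum_(0 <= i < n) (f (a + i%:R * h) + e i))%R%:E)%E.
Proof.
move=> h0 e0 he; elim: n => [|n /andP[IH1 IH2]].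
  rewrite !big_geq // mulr0 mul0r addr0 set_itvco0 integral_set0 lexx //.
have E : `[a, (a + n.+1%:R * h)[%classic =
   `[a, (a + n%:R * h)[ `|` `[(a + n%:R * h), (a + n%:R * h + h)[ :> set R.
  have -> : a + n.+1%:R * h = a + n%:R * h + h by rewrite -natr1 mulrDl mul1r addrA.
  rewrite -itv_bndbnd_setU // bnd_simp.
  - by rewrite lerDl mulr_ge0 // ltW.
  - by rewrite lerDl ltW.
rewrite E ge0_integral_setU //; last 3 first.
- exact: schwartz_measurable.
- by move=> x _; rewrite lee_fin.
- apply/disj_setPS => x [] /=; rewrite !in_itv /= => /andP[_ h1] /andP[h2 _].
  by have := le_lt_trans h2 h1; rewrite ltxx.
have /andP[c1 c2] := integral_cell h0 (e0 n) (he n).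
apply/andP; split; rewrite big_nat_recr //= [(h * _)%R]mulrDr EFinD; exact: leeD.
Qed.

(** A cell at x deviates by O(h / (1 + x ^ 2)) in the values of the function, so all cells together
    by O(h), uniformly in the number 2 T of cells. The term e is the integral outside [- T h, T h),
    so T0 depends on h. *)
Lemma riemann_sum_cvg : exists2 C : R, 0 < C &
  exists2 I : R, (fourier_hat0 f = I%:E)%E & forall h, 0 < h <= 1 -> forall e, 0 < e ->
  exists T0, forall T, (T0 <= T)%N ->
    `|h * \sum_(0 <= i < T + T) f ((i%:R - T%:R) * h) - I| <= C * h + e.
Proof.
have smf : smooth f := sf.1.
have [C1 C10 hC1] := schwartz_decay sf 1; have [C0 C00 hC0] := schwartz_decay sf 0.
pose x h (T i : nat) : R := (i%:R - T%:R) * h.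
pose er h T i : R := 3 * h * C1 * (1 + x h T i ^+ 2)^-1.
have er0 h T i : 0 < h -> 0 <= er h T i.
  by move=> h0; rewrite mulr_ge0 ?invr_ge0 ?addr_ge0 ?sqr_ge0 // !mulr_ge0 // ltW.
have grid h T : 0 < h <= 1 ->
  ((h * \sum_(0 <= i < T + T) f (x h T i) - 18 * C1 * h)%R%:E <=
   \int[mu]_(t in `[(- (T%:R * h))%R, (T%:R * h)%R[) (f t)%:E <=
   (h * \sum_(0 <= i < T + T) f (x h T i) + 18 * C1 * h)%R%:E)%E.
  move=> hh; have /andP[h0 h1] := hh.
  have xE i : - (T%:R * h) + i%:R * h = x h T i by rewrite /x mulrBl addrC.
  have := @integral_grid (- (T%:R * h)) h (er h T) (T + T) h0 (fun i => er0 h T i h0).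
  have -> : - (T%:R * h) + (T + T)%:R * h = T%:R * h by rewrite natrD mulrDl addKr.
  have hyp i t : - (T%:R * h) + i%:R * h <= t <= - (T%:R * h) + i%:R * h + h ->
     `|f t - f (- (T%:R * h) + i%:R * h)| <= er h T i.
    rewrite !xE /er; move: (x h T i) => y /andP[t1 t2].
    rewrite ler_pdivlMr; last by rewrite ltr_pwDl // sqr_ge0.
    have [->|ne] := eqVneq t y; first by rewrite subrr normr0 mul0r !mulr_ge0 // ltW.
    have st : 0 < t - y <= 1.
      by rewrite subr_gt0 lt_neqAle eq_sym ne t1 /= (le_trans _ h1) // lerBlDl.
    have [_ _] := step_bound y st (fun z => smooth_is_derive 0 z smf) hC1.
    rewrite /step [y + _]addrC subrK => /le_trans; apply.
    by rewrite ler_wpM2r ?(ltW C10) // ler_pM2l // lerBlDl.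
  move/(_ hyp); set J := (\int[mu]_(t in _) _)%E => /andP[l u].
  have S : h * \sum_(0 <= i < T + T) er h T i <= 18 * C1 * h.
    rewrite -mulr_sumr; have := sum_decay T hh; set Sd := \sum_(_ <= _ < _) _ => hS.
    have -> : 18 * C1 * h = h * (3 * h * C1 * (6 / h)) by field; rewrite gt_eqF.
    by rewrite ler_pM2l // ler_pM2l // !mulr_gt0.
  have sE (s : R) : h * \sum_(0 <= i < T + T) (f (- (T%:R * h) + i%:R * h) + s * er h T i)
     = h * \sum_(0 <= i < T + T) f (x h T i) + s * (h * \sum_(0 <= i < T + T) er h T i).
    rewrite big_split /= -mulr_sumr mulrDr [h * (s * _)]mulrCA; congr (_ * _ + _).
    by apply: eq_bigr => i _; rewrite xE.
  have l' : ((h * \sum_(0 <= i < T + T) f (x h T i) - (h * \sum_(0 <= i < T + T) er h T i))%R%:E <= J)%E.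
    apply: le_trans l; rewrite lee_fin -mulN1r -sE; apply: ler_wpM2l; first exact: ltW.
    by apply: ler_sum => i _; rewrite mulN1r.
  have u' : (J <= (h * \sum_(0 <= i < T + T) f (x h T i) + (h * \sum_(0 <= i < T + T) er h T i))%R%:E)%E.
    apply: (le_trans u); rewrite lee_fin -[X in _ <= _ + X]mul1r -sE.
    apply: ler_wpM2l; first exact: ltW.
    by apply: ler_sum => i _; rewrite mul1r.
  apply/andP; split.
    by apply: le_trans l'; rewrite lee_fin lerD2l lerN2.
  by apply: (le_trans u'); rewrite lee_fin lerD2l.
have cvgJ h : 0 < h -> (\int[mu]_(t in `[(- (T%:R * h))%R, (T%:R * h)%R[) (f t)%:E @[T --> \oo]
    --> fourier_hat0 f)%E.
  move=> h0; rewrite /fourier_hat0.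
  have U : \bigcup_T `[(- (T%:R * h)), (T%:R * h)[%classic = setT :> set R.
    apply/seteqP; split => // y _; pose T := (Num.truncn (`|y| / h)).+1.
    have hT : `|y| < T%:R * h.
      by rewrite -ltr_pdivrMr // truncnS_gt.
    exists T => //=; rewrite in_itv /=; move: hT; rewrite ltr_norml => /andP[h1 h2].
    by rewrite h2 ltW.
  rewrite -U; apply: ge0_nondecreasing_set_cvg_integral => //.
  - apply/nondecreasing_seqP => T; rewrite subsetEset => y /=; rewrite !in_itv /= => /andP[h1 h2].
    have hT : T%:R * h <= T.+1%:R * h by rewrite ler_pM2r // ler_nat.
    by rewrite (lt_le_trans h2) // (le_trans _ h1) // lerN2.
  - by move=> T; exact: schwartz_measurable.
  - by move=> T y _; rewrite lee_fin.
pose B := C0 * 6 + 18 * C1.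
(* Finiteness of the integral comes out of the same comparison, with mesh 1. *)
have fin : (fourier_hat0 f <= B%:E)%E.
  have := cvgJ 1 ltr01; move/cvg_lim => <- //.
  apply: lime_le; first by apply/cvg_ex; exists (fourier_hat0 f); exact: cvgJ.
  near=> T; have hh : 0 < (1 : R) <= 1 by rewrite ltr01 lexx.
  have /andP[_ u] := grid 1 T hh; apply: (le_trans u); rewrite lee_fin mul1r mulr1 lerD2r.
  apply: (@le_trans _ _ (C0 * \sum_(0 <= i < T + T) (1 + x 1 T i ^+ 2)^-1)).
    rewrite mulr_sumr; apply: ler_sum => i _; rewrite ler_pdivlMr; last by rewrite ltr_pwDl // sqr_ge0.
    by apply: le_trans (hC0 (x 1 T i)); rewrite ler_wpM2r ?addr_ge0 ?sqr_ge0 // ler_norm.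
  by rewrite ler_pM2l // (le_trans (sum_decay T hh)) // divr1.
have I0 : (0 <= fourier_hat0 f)%E by apply: integral_ge0 => y _; rewrite lee_fin.
have Ifin : fourier_hat0 f \is a fin_num.
  by rewrite ge0_fin_numE // (le_lt_trans fin) // ltry.
exists (18 * C1); first by rewrite mulr_gt0.
exists (fine (fourier_hat0 f)); first by rewrite fineK.
move=> h hh e e0; have /andP[h0 h1] := hh.
have := cvgJ h h0; rewrite -(fineK Ifin) => /fine_cvgP[finJ cJ].
have /cvgrPdist_le/(_ e e0)[T0 _ hT0] := cJ; have [T1 _ hT1] := finJ.
exists (maxn T0 T1) => T; rewrite geq_max => /andP[t0 t1].
have := grid h T hh; have := hT1 T t1; have := hT0 T t0 => /=.
set J := (\int[mu]_(t in _) _)%E => dJ fJ; rewrite -(fineK fJ) !lee_fin => /andP[g1 g2].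
move: dJ g1 g2; rewrite /x; set S := h * _; move: (fine J) (fine _) => j i.
by rewrite !ler_distl => /andP[a1 a2] g1 g2; apply/andP; split; lra.
Unshelve. all: end_near.
Qed.
End RiemannSum.

Section ZeroMass.
Variable R : realType.
Variable f : R -> R.
Hypotheses (sf : schwartz f) (f0 : forall x, 0 <= f x).

(** By continuity a positive value at x persists, up to a factor 2, on an interval of positive
    length. *)
Lemma zero_integral_eq0 : fourier_hat0 f = 0%E -> forall x, f x = 0.
Proof.
move=> I0 x; apply/eqP; case: (eqVneq (f x) 0) => // nz.
have fx : 0 < f x by rewrite lt_def nz f0.
have e0 : 0 < f x / 2 by rewrite divr_gt0.
have /cvgrPdist_le/(_ _ e0) := schwartz_continuous sf (x := x).
move=> /nbhs_ballP[r /= r0 hr]; pose h := r / 2.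
have h0 : 0 < h by rewrite divr_gt0.
have cell t : x <= t <= x + h -> `|f t - f x| <= f x / 2.
  move=> /andP[t1 t2]; rewrite distrC; apply: hr; rewrite /ball /= distrC ger0_norm ?subr_ge0 //.
  by rewrite ltrBlDl (le_lt_trans t2) // ltrD2l /h ltr_pdivrMr // ltr_pMr // ltr1n.
have /andP[l _] := integral_cell sf f0 h0 (ltW e0) cell.
have : (0%:E < (h * (f x - f x / 2))%:E)%E.
  by rewrite lte_fin mulr_gt0 // [in X in X - _](splitr (f x)) addrK.
move=> /lt_le_trans/(_ l).
have le : (\int[lebesgue_measure]_(x0 in `[x, (x + h)%R[) (f x0)%:E <= fourier_hat0 f)%E.
  apply: ge0_subset_integral => //; first exact: schwartz_measurable.
  by move=> y _; rewrite lee_fin.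
by move=> /lt_le_trans/(_ le); rewrite I0 ltxx.
Qed.
End ZeroMass.

(** * Decay of the sampled exponential sums *)

Section ExponentialSum.
Variable R : realType.
Variable f : R -> R.
Hypothesis sf : schwartz f.
Local Open Scope complex_scope.

Definition wsum (h : R) (T : nat) (w : R[i]) : R[i] :=
  \sum_(0 <= i < T + T) (f ((i%:R - T%:R) * h))%:C * w ^+ i.

Lemma iter_fdiff (g : R -> R) (x0 h : R) j i :
  iter j (@fdiff R[i]) (fun i => (g (x0 + i%:R * h))%:C) i =
  (iter j (step h) g (x0 + i%:R * h))%:C.
Proof.
elim: j i => [//|j IH] i; rewrite !iterS /fdiff !IH -rmorphB /step /=.
by rewrite -addrA -natr1 mulrDl mul1r.
Qed.

Lemma iter_step_decay A : exists2 D, 0 < D & forall h, 0 < h <= 1 ->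
  forall j, (j <= A)%N -> forall x, `|iter j (step h) f x| * (1 + x ^+ 2) <= (3 * h) ^+ j * D.
Proof.
elim: A => [|A [D D0 hD]].
  have [C C0 hC] := schwartz_decay sf 0; exists C => // h hh j.
  rewrite leqn0 => /eqP -> x; exact: (iter_step_bound sf.1 hh hC).
have [C C0 hC] := schwartz_decay sf A.+1; exists (C + D); first exact: addr_gt0.
move=> h hh j; have h0 : 0 <= 3 * h by case/andP: hh => /ltW ? _; rewrite mulr_ge0.
rewrite leq_eqVlt => /orP[/eqP ->|jA] x.
  apply: (le_trans (iter_step_bound sf.1 hh hC _)).
  by rewrite ler_wpM2l ?exprn_ge0 // lerDl ltW.
by apply: (le_trans (hD h hh j jA x)); rewrite ler_wpM2l ?exprn_ge0 // lerDr ltW.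
Qed.

(** The A-th differences are O(h ^ A / (1 + x ^ 2)) and sum to O(h ^ A / h). The boundary terms
    decay only with the size of the cube, hence the threshold on T, which is uniform in [w]. *)
Lemma wsum_bound A : exists2 C : R, 0 < C & forall h, 0 < h <= 1 ->
  exists T0, forall T, (T0 <= T)%N -> forall w : R[i], `|w| = 1 ->
  `|1 - w| ^+ A * `|wsum h T w| <= (C * (h ^+ A / h))%:C.
Proof.
have [D D0 hD] := iter_step_decay A.
have p3 : 1 <= 3 ^+ A :> R by rewrite exprn_ege1 // ler1n.
exists (1 + 3 ^+ A * D * 6); first by rewrite ltr_pwDl // !mulr_ge0 // ?ltW // (le_trans ler01).
move=> h hh; have /andP[h0 h1] := hh.
have hA : 0 < h ^+ A / h by rewrite divr_gt0 // exprn_gt0.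
pose K := A%:R * (2 ^+ A * (3 ^+ A * D + 3 ^+ A * D)).
have K0 : 0 <= K by rewrite mulr_ge0 // mulr_ge0 ?exprn_ge0 // addr_ge0 // mulr_ge0 ?ltW // (le_trans ler01).
(* Makes T h so large that 1 + (T h) ^ 2 outweighs the constant of the boundary terms. *)
exists (Num.truncn (K / (h ^+ A / h) / h)).+1 => T hT w w1.
have Th : K / (h ^+ A / h) <= T%:R * h.
  rewrite -ler_pdivrMr //; apply: (@le_trans _ _ (Num.truncn (K / (h ^+ A / h) / h)).+1%:R).
    exact/ltW/truncnS_gt.
  by rewrite ler_nat.
have KT : K <= (h ^+ A / h) * (1 + (T%:R * h) ^+ 2).
  rewrite mulrC -ler_pdivrMr // (le_trans Th) //.
  by move: (T%:R * h) => t; have := sqr_ge0 (t - 1); have := sqr_ge0 t; nra.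
pose x i := - (T%:R * h) + i%:R * h.
have wE : wsum h T w = \sum_(0 <= i < T + T) (f (x i))%:C * w ^+ i.
  by apply: eq_bigr => i _; rewrite mulrBl addrC.
rewrite wE; apply: (le_trans (abel_bound _ _ _ w1)).
have nR (r : R) : `|r%:C| = `|r|%:C by rewrite normc_def /= expr0n addr0 sqrtr_sqr.
have E j i : `|iter j (@fdiff R[i]) (fun i => (f (x i))%:C) i| = `|iter j (step h) f (x i)|%:C.
  by rewrite iter_fdiff nR.
have -> : \sum_(0 <= j < A) 2 ^+ A * (`|iter j (@fdiff R[i]) (fun i => (f (x i))%:C) 0| +
     `|iter j (@fdiff R[i]) (fun i => (f (x i))%:C) (T + T)|) + 
   \sum_(0 <= i < T + T) `|iter A (@fdiff R[i]) (fun i => (f (x i))%:C) i| =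
   (\sum_(0 <= j < A) 2 ^+ A * (`|iter j (step h) f (x 0%N)| + `|iter j (step h) f (x (T + T)%N)|)
    + \sum_(0 <= i < T + T) `|iter A (step h) f (x i)|)%:C.
  rewrite rmorphD !rmorph_sum /=; congr (_ + _); apply: eq_bigr => i _; rewrite !E //.
  by rewrite rmorphM rmorphXn rmorph_nat rmorphD.
rewrite lecR mulrDl mul1r; apply: lerD.
  have x2 : x (T + T)%N = T%:R * h by rewrite /x natrD mulrDl addKr.
  have x1 : x 0%N = - (T%:R * h) by rewrite /x mul0r addr0.
  have pT : 0 < 1 + (T%:R * h) ^+ 2 by rewrite ltr_pwDl // sqr_ge0.
  suff : \sum_(0 <= j < A) 2 ^+ A * (`|iter j (step h) f (x 0%N)| + `|iter j (step h) f (x (T + T)%N)|)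
     <= K / (1 + (T%:R * h) ^+ 2).
    by move/le_trans; apply; rewrite ler_pdivrMr.
  have -> : K / (1 + (T%:R * h) ^+ 2) = \sum_(0 <= j < A) 2 ^+ A * (3 ^+ A * D / (1 + (T%:R * h) ^+ 2)
     + 3 ^+ A * D / (1 + (T%:R * h) ^+ 2)).
    by rewrite big_const_nat subn0 iter_addr_0 /K -[RHS]mulr_natl; ring.
  rewrite big_nat [leRHS]big_nat; apply: ler_sum => j /andP[_ jA].
  have bnd y : (y ^+ 2 = (T%:R * h) ^+ 2)%R -> `|iter j (step h) f y| <= 3 ^+ A * D / (1 + (T%:R * h) ^+ 2).
    move=> y2; rewrite ler_pdivlMr // -y2; apply: (le_trans (hD h hh j (ltnW jA) y)).
    rewrite ler_pM2r // exprMn; apply: (@le_trans _ _ (3 ^+ j)).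
      by rewrite ger_pMr ?exprn_gt0 // exprn_ile1 // ltW.
    by rewrite ler_weXn2l ?ler1n // ltnW.
  by rewrite ler_pM2l ?exprn_gt0 // x1 x2 lerD // bnd // sqrrN.
apply: (@le_trans _ _ (\sum_(0 <= i < T + T) ((3 * h) ^+ A * D) * (1 + ((i%:R - T%:R) * h) ^+ 2)^-1)).
  apply: ler_sum => i _; have -> : (i%:R - T%:R) * h = x i by rewrite /x mulrBl addrC.
  rewrite ler_pdivlMr; last by rewrite ltr_pwDl // sqr_ge0.
  exact: hD.
rewrite -mulr_sumr; apply: (@le_trans _ _ ((3 * h) ^+ A * D * (6 / h))).
  rewrite ler_pM2l; first exact: sum_decay.
  by rewrite mulr_gt0 // exprn_gt0 // mulr_gt0.
by rewrite exprMn le_eqVlt; apply/orP; left; apply/eqP; ring.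
Qed.
End ExponentialSum.

(** * Fourier inversion and the asymptotic formula *)

Section CentredResidue.
Variable q : nat.
Hypothesis q1 : (1 < q)%N.

Definition centred (v : 'Z_q) : int := if (2 * v <= q)%N then v%:Z else v%:Z - q%:Z.

Lemma centredK (v : 'Z_q) : (centred v)%:~R = v.
Proof.
rewrite /centred; case: ifP => _; first by rewrite -pmulrn natr_Zp.
by rewrite rmorphB /= -!pmulrn natr_Zp pchar_Zp // subr0.
Qed.

Lemma centred_le (v : 'Z_q) : (2 * `|centred v| <= q)%N.
Proof.
have : (v < q)%N by rewrite -[X in (_ < X)%N](Zp_cast q1).
rewrite /centred; case: ifPn => //; rewrite -ltnNge; move: (v : nat) q1; clear; lia.
Qed.

Definition centred3 (v : 'Z_q * 'Z_q * 'Z_q) : vec := (centred v.1.1, centred v.1.2, centred v.2).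

Lemma centred3_inj : injective centred3.
Proof.
move=> [[v1 v2] v3] [[u1 u2] u3] [] /= e1 e2 e3.
by rewrite -(centredK v1) -(centredK v2) -(centredK v3) e1 e2 e3 !centredK.
Qed.

Lemma centred3_0 : centred3 0 = 0.
Proof. by []. Qed.
End CentredResidue.

Section FourierInversion.
Variables (C : numClosedFieldType) (q : nat) (z : C).
Hypotheses (q1 : (1 < q)%N) (zq : q.-primitive_root z).
Variables (F : nat -> C) (M T : nat).
Notation psi := (@echar C q z).

Definition pt (i : nat) : 'Z_q := i%:R - T%:R.
(** The index i in [0, M) stands for the integer i - T; with M = 2 T this runs over [- T, T). *)
Definition wt (v : 'Z_q) : C := \sum_(0 <= i < M) F i * psi (- (v * pt i)).
Definition hat (U : 'Z_q -> C) (v : 'Z_q) : C := \sum_t U t * psi (v * t).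

Lemma sum_hat (U : 'Z_q -> C) :
  \sum_v hat U v * wt v = q%:R * \sum_(0 <= i < M) F i * U (pt i).
Proof.
transitivity (\sum_(0 <= i < M) \sum_t F i * U t * \sum_v psi ((t - pt i) * v)).
  have -> : \sum_(0 <= i < M) \sum_t F i * U t * \sum_v psi ((t - pt i) * v) =
    \sum_(0 <= i < M) \sum_v \sum_t F i * U t * psi ((t - pt i) * v).
    by apply: eq_bigr => i _; rewrite [RHS]exchange_big; apply: eq_bigr => t _; rewrite mulr_sumr.
  rewrite [RHS]exchange_big /=; apply: eq_bigr => v _.
  rewrite mulr_sumr; apply: eq_bigr => i _; rewrite mulr_suml; apply: eq_bigr => t _.
  by rewrite [(t - _) * v]mulrC [v * (t - _)]mulrBr (echarD q1 zq); ring.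
rewrite mulr_sumr; apply: eq_bigr => i _.
rewrite (bigD1 (pt i)) //= (sum_echar q1 zq) subrr eqxx big1 ?addr0; first by ring.
by move=> t ti; rewrite (sum_echar q1 zq) subr_eq0 (negPf ti) mulr0.
Qed.

Lemma sum_hat3 (U : 'Z_q -> 'Z_q -> 'Z_q -> C) :
  \sum_v3 \sum_v2 \sum_v1
    hat (fun t1 => hat (fun t2 => hat (U t1 t2) v3) v2) v1 * wt v1 * wt v2 * wt v3 =
  q%:R ^+ 3 * \sum_(0 <= i < M) \sum_(0 <= j < M) \sum_(0 <= k < M)
     F i * F j * F k * U (pt i) (pt j) (pt k).
Proof.
transitivity (\sum_v3 \sum_v2 q%:R * (\sum_(0 <= i < M)
    F i * (hat (fun t2 => hat (U (pt i) t2) v3) v2 * wt v2 * wt v3))).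
  apply: eq_bigr => v3 _; apply: eq_bigr => v2 _.
  rewrite -2!mulr_suml sum_hat -!mulrA; congr (_ * _); rewrite mulr_suml.
  by apply: eq_bigr => i _; ring.
transitivity (\sum_(0 <= i < M) q%:R * F i *
    (\sum_v3 (\sum_v2 hat (fun t2 => hat (U (pt i) t2) v3) v2 * wt v2) * wt v3)).
  under eq_bigr do (rewrite -mulr_sumr exchange_big /=).
  rewrite -mulr_sumr exchange_big /= mulr_sumr; apply: eq_bigr => i _.
  rewrite -mulrA; congr (_ * _); rewrite mulr_sumr; apply: eq_bigr => v3 _.
  by rewrite mulr_suml mulr_sumr.
rewrite mulr_sumr; apply: eq_bigr => i _.
transitivity (q%:R * F i * \sum_(0 <= j < M) q%:R * F j * (\sum_v3 hat (U (pt i) (pt j)) v3 * wt v3)).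
  congr (_ * _); under eq_bigr do rewrite sum_hat mulr_sumr mulr_suml.
  rewrite exchange_big /=; apply: eq_bigr => j _; rewrite mulr_sumr.
  by apply: eq_bigr => v3 _; ring.
rewrite mulr_sumr mulr_sumr; apply: eq_bigr => j _; rewrite sum_hat !mulr_sumr.
by apply: eq_bigr => k _; ring.
Qed.
End FourierInversion.

Section ConicInversion.
Variables (C : numClosedFieldType) (p m : nat) (b : vec) (z : C).
Hypotheses (p_pr : prime p) (m0 : (0 < m)%N) (zq : (p ^ m).-primitive_root z).
Variables (F : nat -> C) (M T : nat).
Notation q := (p ^ m)%N.
Let q1 : (1 < q)%N := q_gt1 p_pr m0.

Definition on_conic (x : vec) : bool :=
  coprimez (x.1.1 * x.1.2 * x.2) p &&
  (q%:Z %| b.1.1 * x.1.1 ^+ 2 + b.1.2 * x.1.2 ^+ 2 + b.2 * x.2 ^+ 2)%Z.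

Lemma on_conicE (x : vec) : on_conic x =
  [&& (x.1.1%:~R : 'Z_q) \is a GRing.unit, (x.1.2%:~R : 'Z_q) \is a GRing.unit,
      (x.2%:~R : 'Z_q) \is a GRing.unit &
      (b.1.1%:~R * x.1.1%:~R ^+ 2 + b.1.2%:~R * x.1.2%:~R ^+ 2 + b.2%:~R * x.2%:~R ^+ 2 : 'Z_q) == 0].
Proof.
rewrite /on_conic -(intr_Zp_eq0 q1) !rmorphD !rmorphM /= !intr_unit //.
have cop (x1 : int) : ~~ (p %| x1)%Z = coprimez x1 p.
  by rewrite coprimezE /= coprime_sym prime_coprime // dvdzE.
by rewrite !cop !coprimezMl -!andbA.
Qed.

(** The indicator of the unit points of the conic has [csum] as its transform modulo q, and
    inversion is applied in each coordinate. The range is a cube, so all sums are finite. *)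
Lemma conic_inversion :
  \sum_(v : 'Z_q * 'Z_q * 'Z_q) csum p b m z (centred3 v) *
     (wt z F M T v.1.1 * wt z F M T v.1.2 * wt z F M T v.2) =
  q%:R ^+ 3 * \sum_(0 <= i < M) \sum_(0 <= j < M) \sum_(0 <= k < M)
     F i * F j * F k * (on_conic (i%:Z - T%:Z, j%:Z - T%:Z, k%:Z - T%:Z))%:R.
Proof.
pose U (t1 t2 t3 : 'Z_q) : C := ([&& t1 \is a GRing.unit, t2 \is a GRing.unit,
      t3 \is a GRing.unit & b.1.1%:~R * t1 ^+ 2 + b.1.2%:~R * t2 ^+ 2 + b.2%:~R * t3 ^+ 2 == 0])%:R.
transitivity (q%:R ^+ 3 * \sum_(0 <= i < M) \sum_(0 <= j < M) \sum_(0 <= k < M)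
     F i * F j * F k * U (pt q T i) (pt q T j) (pt q T k)); last first.
  congr (_ * _); apply: eq_bigr => i _; apply: eq_bigr => j _; apply: eq_bigr => k _.
  by congr (_ * _); rewrite on_conicE /= !rmorphB /=.
have csumE (v1 v2 v3 : 'Z_q) : csum p b m z (centred3 (v1, v2, v3)) =
    hat z (fun t1 => hat z (fun t2 => hat z (U t1 t2) v3) v2) v1.
  rewrite /csum /hat /= !(centredK q1) big_mkcond; apply: eq_bigr => t1 _.
  rewrite mulr_suml; case: ifPn => u1; last first.
    symmetry; apply: big1 => t2 _; rewrite big1 ?mul0r // => t3 _.
    by rewrite /U (negPf u1) mul0r.
  rewrite big_mkcond; apply: eq_bigr => t2 _.
  rewrite !mulr_suml; case: ifPn => u2; last first.
    symmetry; apply: big1 => t3 _.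
    by rewrite /U (negPf u2) andbF !mul0r.
  rewrite big_mkcond; apply: eq_bigr => t3 _.
  case: ifPn => u3; last by rewrite /U (negPf u3) !andbF !mul0r.
  by rewrite /U u1 u2 u3 /= !(echarD q1 zq); ring.
rewrite -(sum_hat3 q1 zq).
rewrite -(pair_bigA _ (fun v12 v3 => csum p b m z (centred3 (v12, v3)) *
     (wt z F M T v12.1 * wt z F M T v12.2 * wt z F M T v3))) /=.
rewrite exchange_big /=; apply: eq_bigr => v3 _.
rewrite -(pair_bigA _ (fun v1 v2 => csum p b m z (centred3 (v1, v2, v3)) *
     (wt z F M T v1 * wt z F M T v2 * wt z F M T v3))) /=.
rewrite exchange_big /=; apply: eq_bigr => v2 _; apply: eq_bigr => v1 _.
by rewrite csumE !mulrA.
Qed.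
End ConicInversion.

Lemma norm_sum_le (C : numDomainType) (I : finType) (P : pred I) (F : I -> C) (B : C) :
  0 <= B -> (forall i, P i -> `|F i| <= B) -> `|\sum_(i | P i) F i| <= #|I|%:R * B.
Proof.
move=> B0 hF; apply: (le_trans (ler_norm_sum _ _ _)).
rewrite big_mkcond mulr_natl -sumr_const; apply: ler_sum => i _.
by case: ifP => // /hF.
Qed.

Lemma csum_trivial (C : numClosedFieldType) p b m (z : C) y : prime p -> (0 < m)%N ->
  (p ^ m).-primitive_root z -> `|csum p b m z y| <= (p ^ m)%:R ^+ 3.
Proof.
move=> p_pr m0 zq; have q1 := q_gt1 p_pr m0.
have cq : #|'Z_(p ^ m)| = (p ^ m)%N by rewrite card_ord Zp_cast.
have -> : (p ^ m)%:R ^+ 3 = (p ^ m)%:R * ((p ^ m)%:R * ((p ^ m)%:R * 1)) :> C by ring.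
rewrite -{1 2 3}cq.
apply: norm_sum_le => [|x1 _]; first by rewrite !mulr_ge0.
apply: norm_sum_le => [|x2 _]; first by rewrite !mulr_ge0.
apply: norm_sum_le => // x3 _.
by rewrite normrM (norm_echar q1 zq) mulr1; case: (_ == 0); rewrite ?normr1 ?normr0.
Qed.

(** * Near and far frequencies *)

Section FrequencyBounds.
Variable R : realType.
Local Notation sqrtR := (@Num.sqrt R).

Lemma sqrtC_real (x : R) m : 0 <= x -> sqrtC ((x ^+ m)%:C%C) = ((sqrtR x ^+ m)%:C)%C.
Proof.
move=> x0; have <- : ((sqrtR x ^+ m)%:C)%C ^+ 2 = ((x ^+ m)%:C)%C.
  by rewrite -rmorphXn /= -exprM mulnC exprM sqr_sqrtr.
by rewrite sqrCK // lecR exprn_ge0 // sqrtr_ge0.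
Qed.

Lemma csum_dilate p b (z : R[i]) j m v : prime p -> (2 < p)%N -> coprimez (vol b) p ->
  (1 < m)%N -> (p ^ (j + m)).-primitive_root z -> pprim p v ->
  `|csum p b (j + m) z (comb (p%:Z ^+ j) 0 v 0)| <=
  (if (p%:Z ^+ m.-1 %| qf (dual b) v)%Z then p%:R ^+ (2 * j) * sqrtR p%:R ^+ (3 * m) else 0)%:C%C.
Proof.
move=> p_pr p_odd b_unit m1 zq pv; have m0 : (0 < m)%N by apply: ltnW.
have [zq' ->] := csum_liftn p_pr p_odd b_unit v m0 zq.
have := csum_bound p_pr p_odd b_unit m0 zq' m1 pv.
rewrite normrM normrX normr_nat; case: ifP => _ h.
  rewrite rmorphM rmorphXn rmorph_nat; apply: ler_wpM2l; first by rewrite exprn_ge0.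
  apply: (le_trans h); rewrite natrX -(rmorph_nat (real_complex R)) -rmorphXn /= sqrtC_real //.
  by rewrite -rmorphXn /= -exprM mulnC.
have -> : csum p b m (z ^+ (p ^ j)) v = 0 by apply/eqP; rewrite -normr_le0.
by rewrite normr0 mulr0.
Qed.

Definition sample (f : R -> R) h T (i : nat) : R[i] := (f ((i%:R - T%:R) * h))%:C%C.

Lemma wt0 f h T p n : (0 < p ^ n)%N ->
  wt (zeta R (p ^ n)) (sample f h T) (T + T) T (0 : 'Z_(p ^ n)) =
  (\sum_(0 <= i < T + T) f ((i%:R - T%:R) * h))%:C%C.
Proof.
by move=> _; rewrite rmorph_sum; apply: eq_bigr => i _; rewrite mul0r oppr0 echar0 mulr1.
Qed.

Lemma norm_wt f h T q (v : 'Z_q) : (1 < q)%N ->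
  `|wt (zeta R q) (sample f h T) (T + T) T v| = `|wsum f h T (echar (zeta R q) (- v))|.
Proof.
move=> q1; have zq := zeta_prim R (ltnW q1); set z := zeta R q in zq *.
have eX (x : 'Z_q) i : echar z (x * i%:R) = echar z x ^+ i.
  by rewrite mulr_natr; elim: i => [|i IH]; rewrite ?mulr0n // mulrS (echarD q1 zq) IH exprS.
suff -> : wt z (sample f h T) (T + T) T v = echar z (v * T%:R) * wsum f h T (echar z (- v)).
  by rewrite normrM (norm_echar q1 zq) mul1r.
rewrite /wt /wsum mulr_sumr; apply: eq_bigr => i _.
have -> : - (v * pt q T i) = v * T%:R + (- v) * i%:R by rewrite /pt; ring.
by rewrite (echarD q1 zq) [echar z (- v * _)]eX /sample; ring.
Qed.

Lemma dist_echar q (v : 'Z_q) : (1 < q)%N ->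
  (cos 1 * pi * (`|centred v|%N%:R / q%:R))%:C%C <= `|1 - echar (zeta R q) (- v)|.
Proof.
move=> q1; have zq := zeta_prim R (ltnW q1).
have -> : - v = (- centred v)%:~R by rewrite mulrNz centredK.
rewrite (echar_intr q1) // -abszN; apply: zeta_dist; first exact: ltnW.
by rewrite abszN centred_le.
Qed.

Lemma floor_root k M : (0 < k)%N -> exists Y, (Y ^ k <= M < Y.+1 ^ k)%N.
Proof.
move=> k0; have ex : exists Y, (Y ^ k <= M)%N by exists 0%N; rewrite exp0n.
have ub Y : (Y ^ k <= M)%N -> (Y <= M)%N.
  by apply: leq_trans; case: Y => // Y; rewrite -{1}[Y.+1]expn1 leq_pexp2l.
have [Y h1 h2] := ex_maxnP ex ub; exists Y; rewrite h1 /= ltnNge.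
by apply/negP => /h2; rewrite ltnn.
Qed.
End FrequencyBounds.

Section ErrorTerms.
Variable R : realType.

Lemma boxed_sum p (delta : R) : prime p -> (2 < p)%N -> 0 < delta ->
  exists n0 : nat, forall n b Y (W : 'Z_(p ^ n) * 'Z_(p ^ n) * 'Z_(p ^ n) -> R[i]) (H : R),
  (n0 <= n)%N -> (0 < n)%N -> coprimez (vol b) p -> (Y ^ 18 <= p ^ (7 * n))%N ->
  0 <= H -> (forall v, `|W v| <= H%:C%C) ->
  `|\sum_(v : 'Z_(p ^ n) * 'Z_(p ^ n) * 'Z_(p ^ n) | (v != 0) && boxed Y (centred3 v))
     csum p b n (zeta R (p ^ n)) (centred3 v) * W v|
  <= (H * (delta * (p ^ n)%:R ^+ 2))%:C%C.
Proof.
move=> p_pr p_odd delta0; have [n0 hn0] := dual_sum p_pr p_odd delta0.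
exists n0 => n b Y W H n0n n_gt0 b_unit Y18 H0 hW.
have q1 := q_gt1 p_pr n_gt0; have zq := zeta_prim R (ltnW q1).
set z := zeta R _ in zq *; set q := (p ^ n)%N in q1 zq *.
(* A norm in [R[i]] is a complex number with zero imaginary part; its real part carries it to
   [R]. *)
pose g (y : vec) : R := complex.Re `|csum p b n z y|.
have gE y : (g y)%:C%C = `|csum p b n z y| by rewrite /g normc_def.
apply: (le_trans (ler_norm_sum _ _ _)).
apply: (@le_trans _ _ (\sum_(v : 'Z_q * 'Z_q * 'Z_q | (v != 0) && boxed Y (centred3 v))
    (H * g (centred3 v))%:C%C)).
  apply: ler_sum => v _; rewrite normrM rmorphM /= gE mulrC.
  by apply: ler_wpM2r.
rewrite -rmorph_sum -mulr_sumr lecR; apply: ler_wpM2l => //.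
pose s : seq vec := map (@centred3 q) [seq v <- index_enum _ | (v != 0) && boxed Y (centred3 v)].
have -> : \sum_(v : 'Z_q * 'Z_q * 'Z_q | (v != 0) && boxed Y (centred3 v)) g (centred3 v) = \sum_(y <- s) g y.
  by rewrite /s big_map big_filter.
rewrite natrX -exprM mulnC; apply: (hn0 n b Y s g) => //.
- by rewrite map_inj_uniq ?filter_uniq ?index_enum_uniq //; exact: centred3_inj.
- move=> y /mapP[v]; rewrite mem_filter => /andP[/andP[v0 bv] _] ->; split=> //.
  by move=> /(@centred3_inj q q1 v 0) v0'; rewrite v0' eqxx in v0.
move=> j v _ pv jn; rewrite -lecR gE.
have nE : n = (j + (n - j))%N by rewrite subnKC // ltnW // ltnW.
move: zq; rewrite /q; clear -nE p_pr p_odd b_unit pv jn.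
have m1 : (1 < n - j)%N by move: jn; clear; lia.
move: (n - j)%N nE m1 => m -> m1 zq; exact: csum_dilate.
Qed.

(** There are q ^ 3 frequencies and each [csum] is trivially at most q ^ 3; the decay of the weights
    more than compensates for this. *)
Lemma far_sum p n b (P : pred ('Z_(p ^ n) * 'Z_(p ^ n) * 'Z_(p ^ n))) W (B : R) :
  prime p -> (0 < n)%N -> 0 <= B -> (forall v, P v -> `|W v| <= B%:C%C) ->
  `|\sum_(v | P v) csum p b n (zeta R (p ^ n)) (centred3 v) * W v| <= ((p ^ n)%:R ^+ 6 * B)%:C%C.
Proof.
move=> p_pr n_gt0 B0 hW; have q1 := q_gt1 p_pr n_gt0; have zq := zeta_prim R (ltnW q1).
have BC : (0 : R[i]) <= B%:C%C by rewrite lecR.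
have -> : ((p ^ n)%:R ^+ 6 * B)%:C%C = 
    #|{: 'Z_(p ^ n) * 'Z_(p ^ n) * 'Z_(p ^ n)}|%:R * ((p ^ n)%:R ^+ 3 * B%:C%C).
  rewrite !card_prod !card_ord !Zp_cast // rmorphM rmorphXn rmorph_nat !natrM /=; ring.
apply: norm_sum_le => [|v Pv]; first by rewrite mulr_ge0 // exprn_ge0.
rewrite normrM; apply: ler_pM => //; first exact: csum_trivial.
exact: hW.
Qed.

Lemma powR_floor_root (q : R) (Y : nat) : 0 < q -> q ^+ 7 <= Y.+1%:R ^+ 18 ->
  powR q (7 / 18) <= Y.+1%:R.
Proof.
move=> q0 h.
have -> : powR q (7 / 18) = powR (q ^+ 7) 18^-1.
  by rewrite -powR_mulrn ?ltW // -powRrM.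
have -> : Y.+1%:R = powR (Y.+1%:R ^+ 18) 18^-1 :> R.
  by rewrite -powR_mulrn // -powRrM divff ?powRr1.
by apply: ge0_ler_powR; rewrite ?nnegrE ?invr_ge0 // exprn_ge0 // ltW.
Qed.

(** Since 11/18 + 7/18 = 1, N t is at least q ^ (1 + eps). A saving of q ^ 5 against the trivial q ^
    6 leaves a far contribution O(q N ^ 3), below the main size q ^ 2 N ^ 3. *)
Lemma far_ratio (q N eps t : R) A : 1 <= q -> 0 < eps -> 5 <= A%:R * eps ->
  powR q (11 / 18 + eps) <= N -> powR q (7 / 18) <= t ->
  (q / (N * t)) ^+ A <= (q ^+ 5)^-1.
Proof.
move=> q1 e0 eA hN ht; have q0 : 0 < q by apply: lt_le_trans q1.
have Nt : powR q (1 + eps) <= N * t.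
  have -> : 1 + eps = (11 / 18 + eps) + 7 / 18 :> R by field.
  rewrite powRD; last by rewrite (gt_eqF q0) implybT.
  by apply: ler_pM => //; exact: powR_ge0.
have Nt0 : 0 < N * t by apply: lt_le_trans Nt; rewrite powR_gt0.
have r : q / (N * t) <= powR q (- eps).
  rewrite ler_pdivrMr //; apply: (@le_trans _ _ (powR q (- eps) * powR q (1 + eps))).
    rewrite -powRD; last by rewrite (gt_eqF q0) implybT.
    by rewrite addrCA addNr addr0 powRr1 // ltW.
  by apply: ler_wpM2l; rewrite ?powR_ge0.
apply: (@le_trans _ _ (powR q (- eps) ^+ A)).
  by apply: lerXn2r; rewrite ?nnegrE ?powR_ge0 // divr_ge0 // ltW.
rewrite -powR_mulrn ?powR_ge0 // -powRrM -powR_mulrn ?(ltW q0) // -powRN.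
by apply: ler_powR => //; rewrite mulNr lerN2 mulrC.
Qed.
End ErrorTerms.

(** * The weighted count in a large cube *)

Section Asymptotics.
Variables (R : realType) (f : R -> R).
Hypothesis sf : schwartz f.

Definition box_sum p n (b : vec) (h : R) T : R :=
  \sum_(0 <= i < T + T) \sum_(0 <= j < T + T) \sum_(0 <= k < T + T)
    f ((i%:R - T%:R) * h) * f ((j%:R - T%:R) * h) * f ((k%:R - T%:R) * h) *
    (on_conic p n b (i%:Z - T%:Z, j%:Z - T%:Z, k%:Z - T%:Z))%:R.

(** The two bounds are [wsum_bound] of orders 0 and A at the root of unity attached to - v, whose
    distance from 1 is at least cos 1 times pi |v| / q for the centred representative. *)
Lemma wt_bound : exists2 C0, 0 < C0 & forall A, exists2 C1, 0 < C1 &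
  forall q, (1 < q)%N -> forall h, 0 < h <= 1 -> exists T0, forall T, (T0 <= T)%N ->
  forall v : 'Z_q, `|wt (zeta R q) (sample f h T) (T + T) T v| <= (C0 / h)%:C%C /\
  forall t, 0 < t -> t <= (`|centred v|%N)%:R ->
    `|wt (zeta R q) (sample f h T) (T + T) T v| <= (C1 * (q%:R * h / t) ^+ A / h)%:C%C.
Proof.
have [C0 C00 hC0] := wsum_bound sf 0; exists C0 => // A.
have [C1 C10 hC1] := wsum_bound sf A.
have k0 : 0 < cos 1 * pi :> R by rewrite mulr_gt0 ?cos1_gt0 ?pi_gt0.
exists (C1 / (cos 1 * pi) ^+ A); first by rewrite divr_gt0 // exprn_gt0.
move=> q q1 h hh; have /andP[h0 _] := hh.
have [T0 hT0] := hC0 h hh; have [T1 hT1] := hC1 h hh.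
exists (maxn T0 T1) => T; rewrite geq_max => /andP[tT0 tT1] v.
have w1 := norm_echar q1 (zeta_prim R (ltnW q1)) (- v); set w := echar _ _ in w1.
have q0 : (0 : R) < q%:R by rewrite ltr0n ltnW.
rewrite norm_wt // -/w; split.
  by have := hT0 T tT0 w w1; rewrite expr0 mul1r expr0 div1r.
move=> t t0 tv; have := hT1 T tT1 w w1; have := @dist_echar R q v q1; rewrite -/w.
have rE (x : R[i]) : `|x| = (complex.Re `|x|)%:C%C by rewrite normc_def.
rewrite (rE (wsum _ _ _ _)) (rE (1 - w)); set r := complex.Re `|wsum f h T w|; set d := complex.Re `|1 - w|.
rewrite -rmorphXn -rmorphM !lecR => dk hd.
have kt : cos 1 * pi * (t / q%:R) <= d.
  apply: le_trans dk; rewrite ler_pM2l // ler_pM2r ?invr_gt0 //.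
have kt0 : 0 < cos 1 * pi * (t / q%:R) by rewrite mulr_gt0 // divr_gt0.
have r0 : 0 <= r by rewrite -lecR -rE; exact: normr_ge0.
have hr : (cos 1 * pi * (t / q%:R)) ^+ A * r <= C1 * (h ^+ A / h).
  apply: le_trans hd; apply: ler_wpM2r => //; apply: lerXn2r => //; rewrite nnegrE; first exact: ltW.
  exact/ltW/(lt_le_trans kt0 kt).
move: hr; rewrite -ler_pdivlMl ?exprn_gt0 // => hr; apply: (le_trans hr).
rewrite le_eqVlt; apply/orP; left; apply/eqP.
rewrite !(exprMn, exprVn); field.
have := cos1_gt0 R; have := pi_gt0 R => pi0 cos0.
by rewrite ?expf_neq0 ?gt_eqF.
Qed.

Lemma box_sum_asymp p (eps delta : R) : prime p -> (2 < p)%N -> 0 < eps -> 0 < delta ->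
  exists n0, forall n b N, (n0 <= n)%N -> coprimez (vol b) p ->
  powR (p ^ n)%:R (11 / 18 + eps) <= N ->
  exists T0, forall T, (T0 <= T)%N ->
  `|box_sum p n b N^-1 T -
    C_p p b.1.1 b.1.2 b.2 * (\sum_(0 <= i < T + T) f ((i%:R - T%:R) * N^-1)) ^+ 3 / (p ^ n)%:R|
  <= delta * (N ^+ 3 / (p ^ n)%:R).
Proof.
move=> p_pr p_odd eps0 delta0.
have [C0 C00 hw] := wt_bound.
pose A := (Num.truncn (5 / eps)).+1.
have eA : 5 <= A%:R * eps.
  by rewrite -ler_pdivrMr // ltW // truncnS_gt.
have {hw} [C1 C10 hw] := hw A.
(* Half of delta goes to the near frequencies, whose weights are at most (C0 N) ^ 3. *)
have d1 : 0 < delta / 2 / C0 ^+ 3 by rewrite !divr_gt0 // exprn_gt0.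
have [n1 hn1] := @boxed_sum R p _ p_pr p_odd d1.
pose K := C0 ^+ 2 * C1.
(* The far frequencies contribute K q N ^ 3, which is at most half of delta q ^ 2 N ^ 3 once q >= 2
   K / delta. *)
exists (maxn (maxn n1 1) (Num.truncn (2 * K / delta)).+1) => n b N.
rewrite !geq_max => /andP[/andP[n1n n_gt0] Kn] b_unit hN.
have q1 := q_gt1 p_pr n_gt0; set q := (p ^ n)%N in hN q1 *.
have q0 : (0 : R) < q%:R by rewrite ltr0n ltnW.
have q1R : (1 : R) <= q%:R by rewrite ler1n ltnW.
have Kq : 2 * K / delta <= q%:R.
  apply: (@le_trans _ _ (Num.truncn (2 * K / delta)).+1%:R); first exact/ltW/truncnS_gt.
  by rewrite ler_nat (leq_trans Kn) // ltnW // ltn_expl // prime_gt1.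
have N1 : 1 <= N.
  apply: le_trans hN; apply: (@le_trans _ _ (powR q%:R 0)); first by rewrite powRr0.
  apply: ler_powR => //.
  by rewrite addr_ge0 ?divr_ge0 // ltW.
have N0 : 0 < N by apply: lt_le_trans N1.
have hh : 0 < N^-1 <= 1 by rewrite invr_gt0 N0 invf_le1.
have [T0 hT0] := hw q q1 N^-1 hh; exists T0 => T tT; have {hT0 hw} hw := hT0 T tT.
(* Y is the integer part of q ^ (7/18). *)
have [Y /andP[Y1 Y2]] := floor_root (p ^ (7 * n)) (isT : (0 < 18)%N).
have hY : powR q%:R (7 / 18) <= Y.+1%:R :> R.
  by apply: powR_floor_root => //; rewrite -!natrX ler_nat /q -expnM mulnC ltnW.
pose w (v : 'Z_q) : R[i] := wt (zeta R q) (sample f N^-1 T) (T + T) T v.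
have wH v : `|w v| <= (C0 * N)%:C%C by have [] := hw v; rewrite invrK.
have CN0 : 0 <= C0 * N by rewrite mulr_ge0 // ltW.
pose H1 := C1 * (q%:R ^+ 5)^-1 * N.
have H10 : 0 <= H1 by rewrite !mulr_ge0 ?invr_ge0 ?exprn_ge0 // ltW.
have wF (v : 'Z_q) : (Y < `|centred v|)%N -> `|w v| <= H1%:C%C.
  move=> Yv; have [_ /(_ Y.+1%:R (ltr0Sn _ _))] := hw v; rewrite ler_nat => /(_ Yv) /le_trans; apply.
  rewrite lecR invrK ler_pM2r // ler_pM2l //.
  rewrite -mulrA -invfM; exact: (@far_ratio R q%:R N eps).
pose W (v : 'Z_q * 'Z_q * 'Z_q) : R[i] := w v.1.1 * w v.1.2 * w v.2.
have WH v : `|W v| <= ((C0 * N) ^+ 3)%:C%C.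
  rewrite !normrM exprSr rmorphM rmorphXn /= expr2.
  by apply: ler_pM; rewrite ?mulr_ge0 //; apply: ler_pM.
(* Outside the box one coordinate exceeds Y; only that factor is given the decay bound. *)
have WF v : ~~ boxed Y (centred3 v) -> `|W v| <= ((C0 * N) ^+ 2 * H1)%:C%C.
  rewrite /boxed !negb_and -!ltnNge !normrM rmorphM rmorphXn /= expr2.
  case/or3P => /wF hF.
  - rewrite -[leLHS]mulrA [leLHS]mulrC.
    by apply: ler_pM; rewrite ?mulr_ge0 //; apply: ler_pM.
  - by rewrite [leLHS]mulrAC; apply: ler_pM; rewrite ?mulr_ge0 //; apply: ler_pM.
  - by apply: ler_pM; rewrite ?mulr_ge0 //; apply: ler_pM.
have H30 : 0 <= (C0 * N) ^+ 3 by rewrite exprn_ge0.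
have bnear := hn1 n b Y W _ n1n n_gt0 b_unit Y1 H30 WH.
have B0 : 0 <= (C0 * N) ^+ 2 * H1 by rewrite mulr_ge0 // exprn_ge0.
have bfar := @far_sum R p n b (fun v => (v != 0) && ~~ boxed Y (centred3 v)) W _ p_pr n_gt0 B0.
have {bfar} bfar := bfar (fun v h => WF v (proj2 (andP h))).
have zq := zeta_prim R (ltnW q1).
have := conic_inversion b p_pr n_gt0 zq (sample f N^-1 T) (T + T) T.
rewrite (bigD1 (0 : 'Z_q * 'Z_q * 'Z_q)) //= centred3_0 csum0 // (bigID (fun v => boxed Y (centred3 v))) /=.
rewrite wt0; last exact: ltnW.
pose X1 := \sum_(v : 'Z_q * 'Z_q * 'Z_q | (v != 0) && boxed Y (centred3 v))
  csum p b n (zeta R q) (centred3 v) * W v.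
pose X2 := \sum_(v : 'Z_q * 'Z_q * 'Z_q | (v != 0) && ~~ boxed Y (centred3 v))
  csum p b n (zeta R q) (centred3 v) * W v.
rewrite -/X1 -/X2.
rewrite -/X1 in bnear; rewrite -/X2 in bfar.
set G := \sum_(0 <= i < T + T) f _.
have -> : \sum_(0 <= i < T + T) \sum_(0 <= j < T + T) \sum_(0 <= k < T + T)
     sample f N^-1 T i * sample f N^-1 T j * sample f N^-1 T k *
     (on_conic p n b (i%:Z - T%:Z, j%:Z - T%:Z, k%:Z - T%:Z))%:R = (box_sum p n b N^-1 T)%:C%C.
  rewrite rmorph_sum; apply: eq_bigr => i _; rewrite rmorph_sum; apply: eq_bigr => j _.
  rewrite rmorph_sum; apply: eq_bigr => k _.
  by rewrite !rmorphM rmorph_nat.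
set S := box_sum _ _ _ _ _; set Cp := C_p _ _ _ _ => E.
have Cq : (p%:Z - s_p p b.1.1 b.1.2 b.2)%:~R * (p%:R - 1) * p%:R ^+ (2 * n.-1) = Cp * q%:R ^+ 2 :> R.
  have -> : q%:R ^+ 2 = p%:R ^+ 2 * p%:R ^+ (2 * n.-1) :> R.
    by rewrite /q natrX -exprM -exprD; congr (_ ^+ _); move: n_gt0; clear; lia.
  by rewrite /Cp /C_p; field; rewrite pnatr_eq0 -lt0n prime_gt0.
have {}E : (q%:R ^+ 3 * S - Cp * q%:R ^+ 2 * G ^+ 3)%:C%C = X1 + X2.
  rewrite rmorphB rmorphM rmorphXn rmorph_nat -E -Cq.
  rewrite !(rmorphM, rmorphXn, rmorphB, rmorph_int, rmorph_nat, rmorph1) /=; ring.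
have : `|q%:R ^+ 3 * S - Cp * q%:R ^+ 2 * G ^+ 3| <= delta * (N ^+ 3 * q%:R ^+ 2).
  rewrite -lecR; apply: (@le_trans _ _ (`|X1| + `|X2|)).
    by apply: le_trans (ler_normD _ _); rewrite -E normc_def /= expr0n addr0 sqrtr_sqr.
  apply: (le_trans (lerD bnear bfar)); rewrite -rmorphD lecR.
  have -> : (C0 * N) ^+ 3 * (delta / 2 / C0 ^+ 3 * q%:R ^+ 2) = delta / 2 * (N ^+ 3 * q%:R ^+ 2).
    by field; rewrite gt_eqF.
  have -> : q%:R ^+ 6 * ((C0 * N) ^+ 2 * H1) = K * (N ^+ 3 * q%:R).
    by rewrite /H1 /K; field; rewrite gt_eqF.
  rewrite [leRHS](_ : _ = delta / 2 * (N ^+ 3 * q%:R ^+ 2) + delta / 2 * q%:R * (N ^+ 3 * q%:R)).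
    rewrite lerD2l ler_pM2r; last by rewrite mulr_gt0 // exprn_gt0.
    by move: Kq; rewrite ler_pdivrMr // => Kq; lra.
  by field.
have -> : S - Cp * G ^+ 3 / q%:R = (q%:R ^+ 3 * S - Cp * q%:R ^+ 2 * G ^+ 3) / q%:R ^+ 3.
  by field; rewrite gt_eqF.
have q30 : (0 : R) < q%:R ^+ 3 by rewrite exprn_gt0.
rewrite normrM normfV (gtr0_norm q30) ler_pdivrMr //.
move/le_trans; apply; rewrite le_eqVlt; apply/orP; left; apply/eqP.
by field; rewrite gt_eqF.
Qed.
End Asymptotics.

(** * From cubes to the full lattice *)

Section LatticeSum.
Variable R : realType.

Lemma fine_dist (x : \bar R) (m e : R) : ((m - e)%:E <= x)%E -> (x <= (m + e)%:E)%E ->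
  (`|x - m%:E| <= e%:E)%E.
Proof. by case: x => [r| |] //; rewrite !lee_fin ler_distl => -> ->. Qed.

Definition cube T : seq vec :=
  let l := [seq i%:Z - T%:Z | i <- index_iota 0 (T + T)] in
  [seq (u, c) | u <- [seq (a, b) | a <- l, b <- l], c <- l].

Lemma cube_uniq T : uniq (cube T).
Proof.
have ul : uniq [seq i%:Z - T%:Z | i <- index_iota 0 (T + T)].
  by rewrite map_inj_uniq ?iota_uniq // => i j /addIr [].
by apply: allpairs_uniq => //; [apply: allpairs_uniq|] => // -[? ?] [? ?] _ _ [-> ->].
Qed.

Lemma mem_cube T (x : vec) : (`|x.1.1| < T)%N -> (`|x.1.2| < T)%N -> (`|x.2| < T)%N ->
  x \in cube T.
Proof.
have ml (a : int) : (`|a| < T)%N -> a \in [seq i%:Z - T%:Z | i <- index_iota 0 (T + T)].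
  move=> aT; apply/mapP; exists `|(a + T%:Z)%R|%N; first by rewrite mem_index_iota; move: aT; clear; lia.
  by move: aT; clear; lia.
case: x => [[a b] c] /= ha hb hc; apply/allpairsP; exists ((a, b), c); split=> //=; last exact: ml.
by apply/allpairsP; exists (a, b); split=> //=; apply: ml.
Qed.

Lemma box_sumE (f : R -> R) p n b h T : box_sum f p n b h T =
  \sum_(x <- cube T | on_conic p n b x)
    f (x.1.1%:~R * h) * f (x.1.2%:~R * h) * f (x.2%:~R * h).
Proof.
rewrite big_mkcond /cube big_allpairs_dep /= big_allpairs_dep /= !big_map.
apply: eq_bigr => i _; rewrite big_map; apply: eq_bigr => j _; rewrite big_map; apply: eq_bigr => k _.
by rewrite !rmorphB /=; case: (on_conic _ _ _ _); rewrite ?mulr1 ?mulr0.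
Qed.

(** The terms are nonnegative: one cube bounds the sum from below, and every finite set of lattice
    points lies in a cube with T >= T0. *)
Lemma count_sum_dist (f : R -> R) p n a1 a2 a3 (N M E : R) T0 : (forall x, 0 <= f x) ->
  (forall T, (T0 <= T)%N -> `|box_sum f p n (a1, a2, a3) N^-1 T - M| <= E) ->
  (`|count_sum f p n a1 a2 a3 N - M%:E| <= E%:E)%E.
Proof.
move=> f0 hT; rewrite /count_sum; set D := [set x | _]; set F := fun x : vec => _%:E.
have F0 x : (0 <= F x)%E by rewrite lee_fin !mulr_ge0.
pose r T := [seq x <- cube T | on_conic p n (a1, a2, a3) x].
have rD T x : x \in r T -> D x by rewrite mem_filter => /andP[/andP[]].
have sumE T : (box_sum f p n (a1, a2, a3) N^-1 T)%:E = (\sum_(x \in [set` r T]) F x)%E.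
  rewrite -fsbig_seq ?filter_uniq ?cube_uniq // box_sumE big_filter.
  by rewrite -sumEFin.
apply: fine_dist.
  apply: esum_ge; exists [set` r T0].
    by split; [exact: finite_seq | move=> x; exact: rD].
  by rewrite -sumE lee_fin; have := hT T0 (leqnn _); rewrite ler_distl => /andP[].
apply: ub_ereal_sup => _ [A [finA AD] <-].
have /finite_seqP[s As] := finA.
pose T := maxn T0 (\max_(x <- s) (`|x.1.1| + `|x.1.2| + `|x.2|).+1).
have sub : A `<=` [set` r T].
  move=> x Ax; rewrite /= mem_filter; apply/andP; split.
    by have [h1 h2] := AD x Ax; rewrite /on_conic h1.
  have xs : x \in s by move: Ax; rewrite As.
  have : ((`|x.1.1| + `|x.1.2| + `|x.2|).+1 <= T)%N.
    rewrite leq_max; apply/orP; right.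
    exact: (@leq_bigmax_seq _ s xpredT (fun x : vec => (`|x.1.1| + `|x.1.2| + `|x.2|).+1) x xs isT).
  move=> h; apply: mem_cube; apply: leq_trans h; rewrite ltnS.
  - by rewrite -addnA leq_addr.
  - by rewrite addnAC leq_addl.
  - by rewrite leq_addl.
apply: (@le_trans _ _ (\sum_(x \in [set` r T]) F x)%E).
  apply: lee_fsum_nneg_subset => //; first exact: finite_seq.
  by move=> x; rewrite inE => /sub; rewrite inE.
rewrite -sumE lee_fin; have := hT T (leq_maxl _ _); rewrite ler_distl => /andP[].
by [].
Qed.
End LatticeSum.

(** * Uniformity in the coefficients and conclusion *)

Section Conclusion.
Variables (R : realType) (p : nat).
Hypotheses (p_pr : prime p) (p_odd : (2 < p)%N).

(** Both p and s_p are integers, so p - s_p >= 1. This keeps the main term away from 0 uniformly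
    while the coefficients vary with n. *)
Lemma C_p_lower (b : vec) : s_p p b.1.1 b.1.2 b.2 < p%:Z ->
  (p%:R - 1) / p%:R ^+ 2 <= C_p p b.1.1 b.1.2 b.2 :> R.
Proof.
move=> sp; rewrite /C_p; apply: ler_wpM2r; first by rewrite invr_ge0 exprn_ge0.
rewrite ler_peMl ?subr_ge0 ?ler1n ?prime_gt0 //.
by rewrite -[1]/(1%:~R) ler_int; move: sp; clear; lia.
Qed.

(** Here x <= 2 I, which bounds the quadratic cofactor by (4 + 2 + 1) I ^ 2. *)
Lemma cube_dist (x I eta : R) : 0 <= eta <= I -> `|x - I| <= eta ->
  `|x ^+ 3 - I ^+ 3| <= 7 * I ^+ 2 * eta.
Proof.
move=> /andP[e0 eI] xI; have -> : x ^+ 3 - I ^+ 3 = (x - I) * (x ^+ 2 + x * I + I ^+ 2) by ring.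
have I0 : 0 <= I by apply: le_trans eI.
have x0 : 0 <= x by move: xI; rewrite ler_distl => /andP[]; lra.
have x2 : x <= 2 * I by move: xI; rewrite ler_distl => /andP[]; lra.
rewrite normrM mulrC; apply: ler_pM => //.
rewrite ger0_norm; last by rewrite !addr_ge0 ?sqr_ge0 // mulr_ge0.
nra.
Qed.

Lemma large_N (eps M : R) : 0 < eps -> exists n0, forall n N, (n0 <= n)%N ->
  powR (p ^ n)%:R (11 / 18 + eps) <= N -> M <= N.
Proof.
move=> eps0; exists (Num.truncn (M ^+ 2)).+1 => n N hn; apply: le_trans.
have qM : M ^+ 2 <= (p ^ n)%:R.
  apply: (@le_trans _ _ (Num.truncn (M ^+ 2)).+1%:R); first exact/ltW/truncnS_gt.
  by rewrite ler_nat (leq_trans hn) // ltnW // ltn_expl // prime_gt1.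
apply: (@le_trans _ _ (powR (p ^ n)%:R 2^-1)).
  by rewrite powR12_sqrt // (le_trans (ler_norm M)) // -sqrtr_sqr ler_wsqrtr.
apply: ler_powR; first by rewrite ler1n expn_gt0 prime_gt0.
by lra.
Qed.
End Conclusion.

(** The asymptotic relation is stated as a relative error of at most delta, multiplied out; if the
    integral of [Phi] is 0 it says that the sum is 0. *)
Theorem theorem1p2 (R : realType) (eps : R) (p : nat) (Phi : R -> R)
  (a1 a2 a3 : nat -> int) (N : nat -> R) :
  0 < eps -> prime p -> (2 < p)%N ->
  schwartz Phi -> (forall x, 0 <= Phi x) ->
  (forall n, coprimez (a1 n) p /\ coprimez (a2 n) p /\ coprimez (a3 n) p) ->
  (forall n, s_p p (a1 n) (a2 n) (a3 n) < p%:Z) ->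
  (forall n, powR ((p ^ n)%:R) (11 / 18 + eps) <= N n) ->
  forall delta : R, 0 < delta ->
  \forall n \near \oo,
    (`| count_sum Phi p n (a1 n) (a2 n) (a3 n) (N n)
        - fourier_hat0 Phi ^+ 3
          * (C_p p (a1 n) (a2 n) (a3 n) * N n ^+ 3 / (p ^ n)%:R)%:E |
     <= delta%:E * (fourier_hat0 Phi ^+ 3
          * (C_p p (a1 n) (a2 n) (a3 n) * N n ^+ 3 / (p ^ n)%:R)%:E))%E.
Proof.
move=> eps0 p_pr p_odd sPhi Phi0 cop sp hN delta delta0.
have [C C0 [I IE hI]] := riemann_sum_cvg sPhi Phi0.
have I0 : 0 <= I.
  by rewrite -lee_fin -IE; apply: integral_ge0 => x _; rewrite lee_fin.
have E3 (x : R) : (I%:E ^+ 3 * x%:E = (I ^+ 3 * x)%:E)%E by rewrite -EFin_expe -EFinM.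
have [Iz|Inz] := eqVneq I 0.
  have Phiz := zero_integral_eq0 sPhi Phi0 (etrans IE (congr1 EFin Iz)).
  exists 0%N => // n _; rewrite IE !E3 Iz expr0n !mul0r -EFinM mulr0.
  by rewrite /count_sum esum1 ?sube0 ?abse0 // => x _; rewrite Phiz !mul0r.
have Ipos : 0 < I by rewrite lt_def Inz.
have p2 : 0 < (p%:R : R) ^+ 2 by rewrite exprn_gt0 // ltr0n prime_gt0.
pose c0 : R := (p%:R - 1) / p%:R ^+ 2.
have c00 : 0 < c0 by rewrite divr_gt0 // subr_gt0 ltr1n prime_gt1.
(* The second entry yields 7 I ^ 2 eta <= (delta / 2) I ^ 3, the first is the hypothesis of
   [cube_dist]. *)
pose eta := Num.min I (delta * I / 14).
have eta0 : 0 < eta by rewrite lt_min Ipos !mulr_gt0.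
have etaI : eta <= I by rewrite ge_min lexx.
have etad : eta <= delta * I / 14 by rewrite ge_min lexx orbT.
(* The factor [c0], a lower bound for the constant C_p, turns the additive error in the cube into a
   relative one. *)
have d1 : 0 < delta / 2 * I ^+ 3 * c0 by rewrite mulr_gt0 // mulr_gt0 ?exprn_gt0 // divr_gt0.
have [n1 hn1] := box_sum_asymp sPhi p_pr p_odd eps0 d1.
(* Such an N makes the mesh error C / N at most eta / 2; the other half of eta is spent on the
   truncation of the integral. *)
have [n2 hn2] := large_N p_pr (1 + 2 * C / eta) eps0.
exists (maxn n1 n2) => // n /=; rewrite geq_max => /andP[n1n n2n].
have N1 := hn2 n (N n) n2n (hN n).
have Ce : 0 < 2 * C / eta by rewrite divr_gt0 // mulr_gt0.
have Npos : 0 < N n by apply: lt_le_trans N1; rewrite addr_gt0.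
have hh : 0 < (N n)^-1 <= 1.
  by rewrite invr_gt0 Npos invf_le1 //; apply: le_trans N1; rewrite lerDl ltW.
have b_unit : coprimez (vol (a1 n, a2 n, a3 n)) p.
  by have [c1 [c2 c3]] := cop n; rewrite /vol /= !coprimezMl c1 c2 c3.
have e20 : 0 < eta / 2 by rewrite divr_gt0.
have [T0 hT0] := hI _ hh _ e20.
have [T1 hT1] := hn1 n _ (N n) n1n b_unit (hN n).
have := @C_p_lower R p p_pr (a1 n, a2 n, a3 n) (sp n).
rewrite -/c0 /= => cC; rewrite IE !E3 -EFinM.
apply: (@count_sum_dist _ _ _ _ _ _ _ _ _ _ (maxn T0 T1) Phi0) => T.
rewrite geq_max => /andP[tT0 tT1].
have := hT1 T tT1; have := hT0 T tT0; rewrite /=.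
set G := \sum_(0 <= i < T + T) _; set S := box_sum _ _ _ _ _ _.
move: (C_p p (a1 n) (a2 n) (a3 n)) cC => Cp cC hG hS.
have q0 : 0 < ((p ^ n)%:R : R) by rewrite ltr0n expn_gt0 prime_gt0.
move: (p ^ n)%:R q0 hS => q q0 hS.
have N0 : N n != 0 by rewrite gt_eqF.
have hG' : `|(N n)^-1 * G - I| <= eta.
  apply: (le_trans hG); suff : C * (N n)^-1 <= eta / 2 by lra.
  rewrite ler_pdivrMr // mulrC -ler_pdivrMr //.
  by apply: le_trans N1; rewrite ler_wpDl // le_eqVlt; apply/orP; left; apply/eqP; field; rewrite gt_eqF.
have := cube_dist (introT andP (conj (ltW eta0) etaI)) hG'.
have etaI3 : 7 * I ^+ 2 * eta <= delta / 2 * I ^+ 3.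
  have -> : delta / 2 * I ^+ 3 = 7 * I ^+ 2 * (delta * I / 14) by field.
  by apply: ler_wpM2l => //; rewrite mulr_ge0 // sqr_ge0.
move=> /le_trans/(_ etaI3) cub.
have Nq : 0 <= N n ^+ 3 / q by rewrite divr_ge0 ?exprn_ge0 // ltW.
have Cp0 : 0 <= Cp by apply: le_trans cC; exact: ltW.
rewrite (_ : S - _ = (S - Cp * G ^+ 3 / q) +
  Cp * (N n ^+ 3 / q) * (((N n)^-1 * G) ^+ 3 - I ^+ 3)); last first.
  by field; rewrite N0 gt_eqF.
apply: (le_trans (ler_normD _ _)).
have -> : delta * (I ^+ 3 * (Cp * N n ^+ 3 / q)) =
  delta / 2 * I ^+ 3 * Cp * (N n ^+ 3 / q) + Cp * (N n ^+ 3 / q) * (delta / 2 * I ^+ 3).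
  by field; rewrite gt_eqF.
apply: lerD.
  apply: (le_trans hS); apply: ler_wpM2r => //; apply: ler_wpM2l => //.
  by rewrite !mulr_ge0 ?exprn_ge0 // ltW.
rewrite normrM (ger0_norm (mulr_ge0 Cp0 Nq)); apply: ler_wpM2l => //.
exact: mulr_ge0.
Qed.
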